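(* Let $f:\mathbb{R}^N\to\mathbb{R}^N$ be a $C^2$ function and let $\Gamma\subseteq O(N)$ be a compact group such that $f(\gamma x)=\gamma f(x)$ for all $x\in\mathbb{R}^N$ and $\gamma\in\Gamma$. Suppose the ODE $\dot x(t)=f(x(t))$ has a periodic solution $x_\ast$ with minimal period $p>0$ which is a discrete wave, i.e. $H/K\cong\mathbb{Z}_n$ for some $n\in\mathbb{N}$, where $K$ and $H$ are defined in the context. Let $Y(t)\in\mathbb{R}^{N\times N}$ be the fundamental solution of $\dot y(t)=f'(x_\ast(t))y(t)$ with $Y(0)=I$. Assume that $x_\ast$ has a spatio-temporal symmetry $h\in H$, with associated time shift $\theta_h$, such that the twisted monodromy operator $Y_h:=h^{-1}Y(\theta_h)$ has the following properties: (1) the eigenvalue $1\in\sigma(Y_h)$ is algebraically simple and $Y_h$ has no other eigenvalues on the unit circle; (2) if $\mu\in\sigma(Y_h)$ and $|\mu|>1$, then $\mu$ is real with $-e^2<\mu<-1$. Then there exists an open interval $I\subseteq(-\infty,0)$ such that for every $b\in I$, $x_\ast$ is a stable solution of the delay differential equation $$\dot x(t)=f(x(t))+b\,[x(t)-h\,x(t-\theta_h)].$$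
   Context: $K:=\{\gamma\in\Gamma\mid \gamma x_\ast(0)=x_\ast(0)\}$ (spatial symmetries) and $H:=\{\gamma\in\Gamma\mid \gamma\mathcal{O}=\mathcal{O}\}$ with $\mathcal{O}=\{x_\ast(t)\mid t\in\mathbb{R}\}$ (spatio-temporal symmetries). For $h\in H$ there is a unique $\theta_h\in[0,p)$ with $h x_\ast(0)=x_\ast(\theta_h)$, and then $h x_\ast(t)=x_\ast(t+\theta_h)$ for all $t$; $K$ is the kernel of the homomorphism $h\mapsto\theta_h\in\mathbb{R}/p\mathbb{Z}$, so $K$ is normal in $H$. $Y_h$ always has the eigenvalue $1$ (eigenvector $\dot x_\ast(0)$). The delay equation is considered with state space $C([-\theta_h,0],\mathbb{R}^N)$; $x_\ast$ is a periodic solution of it, and ''stable'' refers to stability of this periodic solution of the delay equation in the usual sense of stability theory for DDEs. *)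

(* Defs.v *)
From HB Require Import structures.
From mathcomp Require Import all_boot all_order all_algebra.
From mathcomp Require Import all_classical all_reals all_analysis.
From mathcomp Require Import complex.
Import Order.TTheory GRing.Theory Num.Theory numFieldNormedType.Exports.

Set Implicit Arguments.
Unset Strict Implicit.
Unset Printing Implicit Defensive.

Local Open Scope ring_scope.
Local Open Scope classical_set_scope.

Section Defs.
Context {R : realType} {N : nat}.
Local Notation vec := 'cV[R]_N.
Local Notation mat := 'M[R]_N.

(* f : R^N -> R^N is C^2: all first and second directional derivatives exist
   everywhere and the second ones are continuous (equivalent to C^2). *)
Definition C2 (f : vec -> vec) : Prop :=
  [/\ forall (x v : vec), derivable f x v,
      forall (x u v : vec), derivable ('D_v f) x u
    & forall (u v : vec), continuous ('D_u ('D_v f))].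

Definition jacobian (f : vec -> vec) (x : vec) : mat :=
  \matrix_(i < N, j < N) ('D_(delta_mx j 0 : vec) f x) i 0.

Definition compact_subgroup_ON (G : set mat) : Prop :=
  [/\ G 1%:M,
      forall g k, G g -> G k -> G (g *m k),
      forall g, G g -> G (invmx g),
      forall g, G g -> g^T *m g = 1%:M
    & compact G].

Definition equivariant (G : set mat) (f : vec -> vec) : Prop :=
  forall g x, G g -> f (g *m x) = g *m f x.

Definition ode_solution (f : vec -> vec) (xs : R -> vec) : Prop :=
  forall t : R, is_derive t (1 : R) xs (f (xs t)).

Definition minimal_period (xs : R -> vec) (p : R) : Prop :=
  [/\ 0 < p,
      forall t, xs (t + p) = xs t
    & forall q, 0 < q < p -> exists t, xs (t + q) <> xs t].

Definition spatial_sym (G : set mat) (xs : R -> vec) (g : mat) : Prop :=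
  G g /\ g *m xs 0 = xs 0.

Definition spatiotemporal_sym (G : set mat) (xs : R -> vec) (g : mat) : Prop :=
  G g /\ [set g *m xs t | t in setT] = range xs.
 
(* discrete wave: H/K is isomorphic to Z_n for some n (n >= 1), i.e. there is
   a surjective group homomorphism phi : H -> Z/nZ with kernel K. *)
Definition discrete_wave (G : set mat) (xs : R -> vec) : Prop :=
  exists (n : nat) (phi : mat -> nat),
    [/\ (0 < n)%N,
        forall g, spatiotemporal_sym G xs g -> (phi g < n)%N,
        forall g k, spatiotemporal_sym G xs g -> spatiotemporal_sym G xs k ->
          phi (g *m k) = ((phi g + phi k) %% n)%N,
        forall m, (m < n)%N -> exists g, spatiotemporal_sym G xs g /\ phi g = m
      & forall g, spatiotemporal_sym G xs g ->
          (phi g = 0%N <-> spatial_sym G xs g)].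

Definition fundamental_solution (f : vec -> vec) (xs : R -> vec)
    (Y : R -> mat) : Prop :=
  Y 0 = 1%:M /\
  forall t : R, is_derive t (1 : R) Y (jacobian f (xs t) *m Y t).

Definition cmx (M : mat) : 'M[R[i]]_N := map_mx (fun x => Complex x 0) M.

Definition in_spectrum (M : mat) (mu : R[i]) : Prop := eigenvalue (cmx M) mu.

Definition alg_mult (M : mat) (mu : R[i]) : nat := mup mu (char_poly (cmx M)).

Definition dde_rhs (f : vec -> vec) (b : R) (h : mat) (th : R)
    (x : R -> vec) (t : R) : vec :=
  f (x t) + b *: (x t - h *m x (t - th)).

Definition dde_solution (f : vec -> vec) (b : R) (h : mat) (th : R)
    (sigma T : R) (x : R -> vec) : Prop :=
  {within [set t | sigma - th <= t < T], continuous x} /\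
  forall t, sigma < t < T -> is_derive t (1 : R) x (dde_rhs f b h th x t).

(* Lyapunov stability of the solution xs of the DDE with state space
   C([-th, 0], R^N) (sup norm), for every initial time sigma. *)
Definition dde_stable (f : vec -> vec) (b : R) (h : mat) (th : R)
    (xs : R -> vec) : Prop :=
  forall (sigma eps : R), 0 < eps -> exists2 delta : R, 0 < delta &
    forall (T : R) (x : R -> vec), dde_solution f b h th sigma T x ->
      (forall s, sigma - th <= s <= sigma -> `|x s - xs s| < delta) ->
      forall t, sigma <= t < T -> `|x t - xs t| < eps.

End Defs.

(* Main.v *)
Require Import Defs.
From HB Require Import structures.
From mathcomp Require Import all_boot all_order all_algebra.
From mathcomp Require Import all_classical all_reals all_analysis.
From mathcomp Require Import complex ring lra.
Import Order.TTheory GRing.Theory Num.Theory numFieldNormedType.Exports.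

Set Implicit Arguments.
Unset Strict Implicit.
Unset Printing Implicit Defensive.

Local Open Scope ring_scope.

(* Not the homonymous operator of MathComp-Analysis, which acts on row vectors. *)
Local Notation jacobian := Defs.jacobian.

(* In the moving frame u_n(s) = h^-n x(sigma - th + n th + s), s in [0, th], the
   delay disappears: u_(n+1)' = f(u_(n+1)) + b (u_(n+1) - u_n) with
   u_(n+1)(0) = h^-1 u_n(th), and the orbit is the n-independent solution
   v(s) = xs(sigma - th + s).  As Y(t + th) = h Y(t) M with M = h^-1 Y(th), the
   substitution u_n = v + Y w_n gives the autonomous problem
   w_(n+1)' = beta (w_n - w_(n+1)) + e_n, w_(n+1)(0) = M w_n(th), with beta = -b
   and e_n quadratically small.

   Its linear part decays along every eigenvalue mu <> 1 of M: for |mu| < 1 the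
   sup norm contracts; for mu = -e^L with 0 < L < 2 beta th and beta th < 1 the
   problem is the scalar equation x' = (L / th - beta) x - beta x(t - th), for
   which x - beta int_(t-th)^t x yields a strict Lyapunov functional.  Jordan
   blocks are handled by a cascade over the factors of the characteristic
   polynomial.  Along mu = 1 the oscillation on a cell contracts, so w_n tends
   to a multiple of the velocity f(xs(0)).

   Hence after a fixed number of cells the distance to the family of phase
   shifts of the orbit halves, while the phase moves by at most a multiple of
   that distance; summing the geometric series of phases gives stability.  Since
   |mu| < e^2, all unstable mu are covered for beta th close to, and below, 1. *)

(** * Calculus of one real variable *)

Section RealCalculus.
Context {R : realType}.
Implicit Types (f g : R -> R) (a b t x : R).

(** The gain [b] is a scalar and so commutes with [Y]: this is what makes the equation for [w_n]
    autonomous, all dependence on time being left in [e_n]. The fundamental solution may grow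
    without bound along unstable directions, so it is used only over a bounded range of times; the
    factor [h^-1] brings every cell back to the same range, and only the drift of the phase has to
    be controlled. Convergence can hold only up to a phase shift, because every shifted orbit solves
    the same delay equation. Each block therefore compares the solution with a newly chosen shift.
    The linear estimates have the form [eps * A + C * D], with [A] the initial deviation and [D] the
    size of the forcing. [C] may be large and depend on the length of the block: [D] is of order
    [A ^+ 2], and [A] is taken small once the block is fixed. In the Lyapunov functional,
    [L < 2 beta th] is the positivity of [kappa] and [beta th < 1] that of [eta]. *)

Lemma is_derive_addf t f g a b : is_derive t 1 f a -> is_derive t 1 g b ->
  is_derive t 1 (fun s => f s + g s) (a + b).
Proof. exact: is_deriveD. Qed.

Lemma is_derive_oppf t f a : is_derive t 1 f a -> is_derive t 1 (fun s => - f s) (- a).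
Proof. exact: is_deriveN. Qed.

Lemma is_derive_mulf t f g a b : is_derive t 1 f a -> is_derive t 1 g b ->
  is_derive t 1 (fun s => f s * g s) (f t * b + g t * a).
Proof. exact: is_deriveM. Qed.

Lemma is_derive_cstf t a : is_derive t 1 (fun _ : R => a) (@GRing.zero R).
Proof. exact: is_derive_cst. Qed.

Lemma is_derive_idf t : is_derive t 1 (fun s : R => s) (@GRing.one R).
Proof. exact: is_derive_id. Qed.

Lemma is_derive_exprf t f n a : is_derive t 1 f a ->
  is_derive t 1 (fun s => f s ^+ n) (n%:R * f t ^+ n.-1 * a).
Proof.
move=> fa; rewrite (_ : (fun s => _) = f ^+ n); first exact: is_deriveX.
by apply/funext => s; rewrite fctE.
Qed.

Lemma is_derive_expf t f a : is_derive t 1 f a ->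
  is_derive t 1 (fun s => expR (f s)) (expR (f t) * a).
Proof. by move=> fa; apply: (is_derive1_comp (is_derive_expR _) fa). Qed.

Lemma is_derive_compf t f g a b : is_derive (g t) 1 f a -> is_derive t 1 g b ->
  is_derive t 1 (fun s => f (g s)) (a * b).
Proof. exact: is_derive1_comp. Qed.

Lemma is_derive_sumf t (I : Type) (r : seq I) (F : I -> R -> R) (d : I -> R) :
  (forall i, is_derive t 1 (F i) (d i)) ->
  is_derive t 1 (fun s => \sum_(i <- r) F i s) (\sum_(i <- r) d i).
Proof.
move=> Fd; elim: r => [|i r IH].
  rewrite big_nil (_ : (fun s => _) = fun=> 0); first exact: is_derive_cstf.
  by apply/funext => s; rewrite big_nil.
rewrite big_cons (_ : (fun s => _) = fun s => F i s + \sum_(j <- r) F j s).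
  exact: is_derive_addf.
by apply/funext => s; rewrite big_cons.
Qed.

End RealCalculus.

(** Differentiates by unification, reading the derivatives of the atoms off the context, and leaves
    the equation between the computed and the claimed derivative. Derivative facts are therefore
    pushed into the context just before a call. *)
Ltac deriv := eapply is_derive_eq;
  [repeat first [eassumption | eapply is_derive_idf | eapply is_derive_cstf
     | eapply is_derive_addf | eapply is_derive_oppf | eapply is_derive_mulf
     | eapply is_derive_expf | eapply is_derive_exprf]
  | rewrite ?mulr1 ?mulr0].

Section RealAnalysis.
Context {R : realType}.
Implicit Types (f g : R -> R) (a b r s t x tau rho c k l : R).

Lemma is_derive_continuous (V : normedModType R) (f : R -> V) t d :
  is_derive t 1 f d -> {for t, continuous f}.
Proof. by move=> [df _]; apply/differentiable_continuous/derivable1_diffP. Qed.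

Lemma is_derive_itv (V : normedModType R) (f g : R -> V) a b t d :
  (forall s, a < s < b -> f s = g s) -> a < t < b ->
  is_derive t 1 f d -> is_derive t 1 g d.
Proof.
move=> fg tab; apply: near_eq_is_derive.
have : t \in `]a, b[ by rewrite in_itv.
by move/near_in_itvoo; apply: filterS => s; rewrite in_itv; exact: fg.
Qed.

Lemma is_derive_shiftl (V : normedModType R) (f : R -> V) t c d :
  is_derive (c + t) 1 f d -> is_derive t 1 (fun s => f (c + s)) d.
Proof.
case=> df <-; split.
  move: df; rewrite /derivable /=.
  by under eq_fun do rewrite addrCA.
rewrite /derive /=; by under [in RHS]eq_fun do rewrite addrCA.
Qed.

Lemma derive_le0_le f f' a b : a <= b ->
  (forall s, a <= s <= b -> {for s, continuous f}) ->
  (forall s, a < s < b -> is_derive s 1 f (f' s)) ->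
  (forall s, a < s < b -> f' s <= 0) -> f b <= f a.
Proof.
rewrite le_eqVlt => /orP[/eqP ->//|ab] cf df f'0.
have dfi x : x \in `]a, b[ -> is_derive x 1 f (f' x).
  by rewrite in_itv; exact: df.
have cfi : {within `[a, b], continuous f}%classic.
  by apply: continuous_subspace_itv => x; rewrite in_itv; exact: cf.
have [c cab fE] := MVT ab dfi cfi.
rewrite -subr_le0 fE; move: cab; rewrite in_itv /= => cab.
by rewrite mulr_le0_ge0 ?f'0 // subr_ge0 ltW.
Qed.

(** Integrating factor: [expR (l * s) * (f s - B)] does not increase. The sign of [l] is free:
    [l > 0] gives relaxation towards [B], [l < 0] gives Gronwall's inequality. *)
Lemma relax_le f f' l B tau : 0 <= tau ->
  (forall s, 0 <= s <= tau -> {for s, continuous f}) ->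
  (forall s, 0 < s < tau -> is_derive s 1 f (f' s)) ->
  (forall s, 0 < s < tau -> f' s <= - l * (f s - B)) ->
  f tau - B <= expR (- l * tau) * (f 0 - B).
Proof.
move=> tau0 cf df f'le.
pose F s := expR (l * s) * (f s - B).
have : F tau <= F 0.
  apply: (@derive_le0_le F (fun s => expR (l * s) * (f' s + l * (f s - B)))) => //.
  - move=> s /cf fs; apply: continuousM; last exact: continuousB fs (cvg_cst _).
    by apply: (@is_derive_continuous _ _ s); deriv.
  - by move=> s /df fs; rewrite /F; deriv; rewrite ?mulr0; ring.
  - move=> s /f'le fs; rewrite mulr_ge0_le0 ?expR_ge0 //.
    by move: fs; lra.
rewrite /F mulr0 expR0 mul1r mulNr => F0.
by rewrite expRN ler_pdivlMl ?expR_gt0.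
Qed.

(* The base point -1 only serves to make [prim f] differentiable at 0. *)
Definition prim f x : R :=
  \int[lebesgue_measure]_(t in [set` Interval (BLeft (-1)) (BRight x)]) f t.

Lemma is_derive_prim f t : continuous f -> -1 < t ->
  is_derive t 1 (prim f) (f t).
Proof.
move=> cf t1.
have tt : t < t + 1 by rewrite ltrDl.
have [||df dfE] := @continuous_FTC1 _ f (BLeft (-1)) t (t + 1) tt _ _ (cf t).
- apply: (@continuous_compact_integrable R f); first exact: segment_compact.
  exact: continuous_subspaceT.
- by rewrite /= lte_fin.
by split; [exact: df|rewrite -derive1E].
Qed.

(** The infimum of the points with [rho <= f] would itself satisfy [f < rho] by the second
    hypothesis, against continuity. At [s = 0] the premise on earlier points is vacuous, so that
    hypothesis contains the initial bound. *)
Lemma first_exit f rho tau : 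
  (forall s, 0 <= s <= tau -> {for s, continuous f}) ->
  (forall s, 0 <= s <= tau -> (forall r, 0 <= r < s -> f r < rho) -> f s < rho) ->
  forall s, 0 <= s <= tau -> f s < rho.
Proof.
move=> cf fle s0 s0tau; rewrite ltNge; apply/negP => fs0.
pose E : set R := (fun r => 0 <= r <= tau /\ rho <= f r).
have E0 : E s0 by [].
have hE : has_inf E by split; [exists s0|exists 0 => r [/andP[]]].
have lbE r : E r -> inf E <= r by move=> Er; apply: ge_inf => //; case: hE.
have iE0 : 0 <= inf E by apply: lb_le_inf; [exists s0|move=> r [/andP[]]].
have iEtau : inf E <= tau by rewrite (le_trans (lbE _ E0)) //; case/andP: s0tau.
have iEI : 0 <= inf E <= tau by rewrite iE0.
have fi : f (inf E) < rho.
  apply: fle => // r /andP[r0 rE]; rewrite ltNge; apply/negP => fr.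
  have Er : E r by split=> //; rewrite r0 (le_trans (ltW rE)).
  by move: (lbE r Er); rewrite leNgt rE.
have /cvgrPdist_lt/(_ (rho - f (inf E))) := cf _ iEI.
rewrite subr_gt0 => /(_ fi) /nbhs_ballP[e /= e0 he].
have [r Er rlt] : exists2 r, E r & r < inf E + e by apply: inf_adherent.
have := he r; rewrite /ball /= ltr_distlC.
have -> : (inf E - e < r < inf E + e).
  by rewrite rlt andbT (lt_le_trans _ (lbE r Er)) // gtrBl.
move=> /(_ isT); case: Er => _; rewrite ltr_norml => fr /andP[+ _].
lra.
Qed.

(** [expR (- k * t) * f t] does not increase and [expR (k * t) * f t] does not decrease, so a zero
    spreads in both directions of time. The backward direction makes [Y t] invertible for
    [t > 0]. *)
Lemma gronwall0 f f' k t0 : (forall t, is_derive t 1 f (f' t)) ->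
  (forall t, 0 <= f t) -> (forall t, `|f' t| <= k * f t) ->
  f t0 = 0 -> forall t, f t = 0.
Proof.
move=> df f0 f'k ft0 t.
have cexp c s : {for s, continuous (fun r : R => expR (c * r) * f r)}.
  apply: (@is_derive_continuous _ _ s); have := df s => ?; deriv; exact: erefl.
apply/eqP; rewrite eq_le f0 andbT.
have [le_t0t|/ltW le_tt0] := leP t0 t.
  have : expR (- k * t) * f t <= expR (- k * t0) * f t0.
    apply: (@derive_le0_le (fun s => expR (- k * s) * f s)
      (fun s => expR (- k * s) * (f' s - k * f s))) => //.
      by move=> s _; have := df s => ?; deriv; ring.
    move=> s _; rewrite mulr_ge0_le0 ?expR_ge0 // subr_le0.
    exact: le_trans (ler_norm _) (f'k s).
  by rewrite ft0 mulr0 pmulr_rle0 // expR_gt0.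
have : - (expR (k * t0) * f t0) <= - (expR (k * t) * f t).
  apply: (@derive_le0_le (fun s => - (expR (k * s) * f s))
    (fun s => - (expR (k * s) * (f' s + k * f s)))) => //.
  - by move=> s _; apply: continuousN; exact: cexp.
  - by move=> s _; have := df s => ?; deriv; ring.
  - move=> s _; rewrite oppr_le0 mulr_ge0 ?expR_ge0 //.
    by rewrite -lerBlDr sub0r lerNl (le_trans _ (f'k s)) // -normrN ler_norm.
by rewrite ft0 mulr0 oppr0 oppr_ge0 pmulr_rle0 // expR_gt0.
Qed.

Definition clamp a b s : R := Num.min b (Num.max a s).

Lemma clamp_id a b s : a <= s <= b -> clamp a b s = s.
Proof. by move=> /andP[as_ sb]; rewrite /clamp max_r // min_r. Qed.

Lemma clamp_itv a b s : a <= b -> a <= clamp a b s <= b.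
Proof.
by move=> ab; rewrite /clamp le_min ab /= le_max lexx /= ge_min lexx.
Qed.

Lemma clamp_dist a b s t : `|clamp a b s - clamp a b t| <= `|s - t|.
Proof.
rewrite /clamp !minEle !maxEle ler_norml; case: (leP a s) => ?; case: (leP a t) => ?;
  repeat case: (leP b _) => ?; apply/andP; split;
  case: (ler0P (s - t)) => ?; lra.
Qed.

Lemma clamp_continuous a b (T : topologicalType) (x : R -> T) (A : set R) :
  a <= b -> (forall s, a <= s <= b -> A s) ->
  {within A, continuous x}%classic -> continuous (fun s => x (clamp a b s)).
Proof.
move=> ab sA cx t U Ux.
have At : A (clamp a b t) by apply: sA; exact: clamp_itv.
move/subspace_continuousP: cx => /(_ _ At U Ux).
rewrite /within /= => /nbhs_ballP[e /= e0 he].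
apply/nbhs_ballP; exists e => //= s ste.
apply: he; last by apply: sA; exact: clamp_itv.
by rewrite /ball /= (le_lt_trans (clamp_dist _ _ _ _)).
Qed.

End RealAnalysis.

(** * Entrywise calculus, the max norm, and uniqueness for ODEs *)

Section VectorCalculus.
Context {R : realType} {N : nat}.
Implicit Types (v w : 'cV[R]_N) (A B : 'M[R]_N) (r s t c k : R).

Lemma norm_entry m n (F : 'M[R]_(m, n)) i j : `|F i j| <= `|F|.
Proof.
rewrite [leRHS]/Num.norm /= mx_normrE.
exact: (@le_bigmax _ _ _ 0 (fun ij => `|F ij.1 ij.2|) (i, j)).
Qed.

Lemma norm_coord v i : `|v i 0| <= `|v|.
Proof. exact: norm_entry. Qed.

Lemma entry_continuous m n (F : R -> 'M[R]_(m, n)) i j : continuous F ->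
  continuous (fun s : R => F s i j).
Proof.
move=> cF t; apply/cvgrPdist_lt => e e0.
have /cvgrPdist_lt/(_ e e0) := cF t; apply: filterS => s; apply: le_lt_trans.
by have := norm_entry (F t - F s) i j; rewrite !mxE.
Qed.

Lemma norm_cV_le v c : 0 <= c -> (forall i, `|v i 0| <= c) -> `|v| <= c.
Proof.
move=> c0 vc; rewrite /Num.norm /= mx_normrE; apply: bigmax_le => // -[i j] _ /=.
by rewrite ord1.
Qed.

Lemma mulmx_norm_le A v : `|A *m v| <= N%:R * `|A| * `|v|.
Proof.
apply: norm_cV_le => [|i]; first by rewrite !mulr_ge0.
rewrite mxE (le_trans (ler_norm_sum _ _ _)) //.
rewrite (@le_trans _ _ (\sum_(j < N) `|A| * `|v|)) //.
  apply: ler_sum => j _; rewrite normrM ler_pM // ?norm_entry ?norm_coord //.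
by rewrite sumr_const card_ord -[leLHS]mulr_natl mulrA.
Qed.

Lemma is_derive_coord m n (F : R -> 'M[R]_(m, n)) t d :
  is_derive t 1 F d <->
  forall i j, is_derive t 1 (fun s => F s i j) (d i j).
Proof.
split=> [[dF <-] i j|dF].
  split; first exact: (derivable_mxP F t 1).1.
  by rewrite derive_mx // mxE.
have DF : derivable F t 1 by apply/derivable_mxP => i j; case: (dF i j).
split=> //; rewrite derive_mx //; apply/matrixP => i j; rewrite mxE.
by case: (dF i j).
Qed.

Lemma is_derive_mulmx m n q (F : R -> 'M[R]_(m, n)) (G : R -> 'M[R]_(n, q)) t f g :
  is_derive t 1 F f -> is_derive t 1 G g ->
  is_derive t 1 (fun s => F s *m G s) (f *m G t + F t *m g).
Proof.
move=> /is_derive_coord dF /is_derive_coord dG; apply/is_derive_coord => i j.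
rewrite (_ : (fun s => _) = fun s => \sum_k F s i k * G s k j); last first.
  by apply/funext => s; rewrite mxE.
have D : is_derive t 1 (fun s => \sum_k F s i k * G s k j)
    (\sum_k (F t i k * g k j + G t k j * f i k)).
  by apply: is_derive_sumf => k; exact: (is_derive_mulf (dF i k) (dG k j)).
apply: (is_derive_eq D).
rewrite !mxE -big_split /=; apply: eq_bigr => k _; ring.
Qed.

Lemma is_derive_cst_mulmx m n q (A : 'M[R]_(m, n)) (G : R -> 'M[R]_(n, q)) t g :
  is_derive t 1 G g -> is_derive t 1 (fun s => A *m G s) (A *m g).
Proof.
move=> dG; have := is_derive_mulmx (is_derive_cst A t 1) dG.
by rewrite mul0mx add0r.
Qed.

(** The norm of a matrix is its largest entry in modulus, which is not differentiable; differential
    inequalities go through the sum of squares, at the cost of a factor [N]. *)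
Lemma sqnorm_ge0 v : 0 <= \sum_i v i 0 ^+ 2.
Proof. by apply: sumr_ge0 => i _; rewrite sqr_ge0. Qed.

Lemma coord_le_sqnorm v i : v i 0 ^+ 2 <= \sum_i v i 0 ^+ 2.
Proof.
by rewrite (bigD1 i) //= lerDl; apply: sumr_ge0 => j _; rewrite sqr_ge0.
Qed.

Lemma norm_le_sqnorm v : `|v| ^+ 2 <= \sum_i v i 0 ^+ 2.
Proof.
rewrite -[leRHS]sqr_sqrtr ?sqnorm_ge0 // ler_sqr ?nnegrE ?sqrtr_ge0 //.
apply: norm_cV_le => [|i]; first by rewrite sqrtr_ge0.
by rewrite -sqrtr_sqr ler_wsqrtr // coord_le_sqnorm.
Qed.

Lemma sqnorm_le_norm v : \sum_i v i 0 ^+ 2 <= N%:R * `|v| ^+ 2.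
Proof.
rewrite (@le_trans _ _ (\sum_(i < N) `|v| ^+ 2)) //.
  by apply: ler_sum => i _; rewrite -real_normK ?num_real // ler_sqr ?nnegrE ?norm_coord.
by rewrite sumr_const card_ord -[leLHS]mulr_natl.
Qed.

Lemma is_derive_sqnorm (y : R -> 'cV[R]_N) t d : is_derive t 1 y d ->
  is_derive t 1 (fun s => \sum_i y s i 0 ^+ 2) (\sum_i 2 * y t i 0 * d i 0).
Proof.
move=> /is_derive_coord dy; apply: (@is_derive_sumf _ t _ _ _ (fun i => 2 * y t i 0 * d i 0)) => i.
exact: (is_derive_exprf 2 (dy i 0)).
Qed.

Lemma ode_unique (y y' : R -> 'cV[R]_N) k t0 :
  (forall t, is_derive t 1 y (y' t)) ->
  (forall t, `|y' t| <= k * `|y t|) -> y t0 = 0 -> forall t, y t = 0.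
Proof.
move=> dy y'k yt0 t.
have k0 : 0 <= Num.max 0 k by rewrite le_max lexx.
have : \sum_i y t i 0 ^+ 2 = 0.
  apply: (@gronwall0 _ (fun t => \sum_i y t i 0 ^+ 2) (fun t => \sum_i 2 * y t i 0 * y' t i 0)
     (2 * N%:R * Num.max 0 k) t0); first by move=> s; exact: is_derive_sqnorm.
  - by move=> s; exact: sqnorm_ge0.
  - move=> s; rewrite (le_trans (ler_norm_sum _ _ _)) //.
    rewrite (@le_trans _ _ (\sum_(i < N) 2 * Num.max 0 k * `|y s| ^+ 2)) //.
      apply: ler_sum => i _; rewrite !normrM ger0_norm // -!mulrA ler_wpM2l //.
      rewrite mulrC expr2 mulrA ler_pM // ?norm_coord //.
      rewrite (le_trans (norm_coord _ _)) // (le_trans (y'k s)) // ler_wpM2r //.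
      by rewrite le_max lexx orbT.
    rewrite sumr_const card_ord -[leLHS]mulr_natl .
    have := norm_le_sqnorm (y s); set Q := \sum_(i < N) _ => yQ.
    have := ler_wpM2l (mulr_ge0 (mulr_ge0 (ler0n _ 2) (ler0n R N)) k0) yQ.
    by congr (_ <= _); ring.
  - by rewrite yt0 big1 // => i _; rewrite mxE expr0n.
move=> /eqP; rewrite psumr_eq0 => [/allP y0|i _]; last by rewrite sqr_ge0.
apply/colP => i; have := y0 i; rewrite mem_index_enum => /(_ isT).
by rewrite sqrf_eq0 mxE => /eqP.
Qed.

End VectorCalculus.

(** * Scalar cell problems *)

Section ScalarRelaxation.
Context {R : realType} (beta theta : R) (beta_gt0 : 0 < beta) (theta_gt0 : 0 < theta).
Implicit Types (g v e : R -> R) (a b c s t A B D E : R).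

(** A scalar component of the cell problem: [g] is the new cell, [v] the previous one, [e] the
    forcing. *)
Definition relaxes g v e := forall s, 0 < s < theta ->
  is_derive s 1 g (beta * (v s - g s) + e s).

(** This is [relax_le] with target [B + E / beta]. The bound averages the initial value and the
    target, and the initial value keeps a weight of at least [expR (- beta * theta)] over the cell;
    both contractions below come from this weight. *)
Lemma relax_step g v e B E : continuous g -> relaxes g v e ->
  (forall s, 0 <= s <= theta -> v s <= B) ->
  (forall s, 0 < s < theta -> e s <= E) ->
  forall s, 0 <= s <= theta ->
  g s <= expR (- beta * s) * g 0 + (1 - expR (- beta * s)) * (B + E / beta).
Proof.
move=> cg dg vB eE s /andP[s0 st].
have lt_st r : 0 < r < s -> 0 < r < theta.
  by move=> /andP[-> /lt_le_trans ->].
have := @relax_le _ g _ beta (B + E / beta) s s0 (fun t _ => cg t)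
  (fun r rs => dg r (lt_st r rs)).
have H r : 0 < r < s -> beta * (v r - g r) + e r <= - beta * (g r - (B + E / beta)).
  move=> /lt_st rt; have /vB vr : 0 <= r <= theta by case/andP: rt => /ltW -> /ltW ->.
  have := eE r rt; have -> : - beta * (g r - (B + E / beta)) = beta * (B - g r) + E.
    by field; rewrite gt_eqF.
  by move=> er; apply: lerD => //; rewrite ler_pM2l // lerB.
move=> /(_ H); lra.
Qed.

(* [g] and [k] are the real and imaginary parts of a complex solution; its
   modulus is controlled through the combinations [a * g + b * k]. *)
Lemma contracting_decay (m1 m2 rho : R) : 0 <= rho < 1 -> m1 ^+ 2 + m2 ^+ 2 <= rho ^+ 2 ->
  exists C q, [/\ 0 <= C, 0 < q < 1 &
  forall (m : nat) (g k eg ek : nat -> R -> R) (dg dk : nat -> R) A D,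
  0 <= A -> 0 <= D ->
  (forall n, (n <= m)%N -> continuous (g n) /\ continuous (k n)) ->
  (forall n, (n < m)%N -> relaxes (g n.+1) (g n) (eg n) /\
                          relaxes (k n.+1) (k n) (ek n)) ->
  (forall n, (n < m)%N -> g n.+1 0 = m1 * g n theta - m2 * k n theta + dg n /\
                          k n.+1 0 = m1 * k n theta + m2 * g n theta + dk n) ->
  (forall s, 0 <= s <= theta -> `|g 0%N s| <= A /\ `|k 0%N s| <= A) ->
  (forall n, (n < m)%N -> `|dg n| <= D /\ `|dk n| <= D) ->
  (forall n s, (n < m)%N -> 0 < s < theta -> `|eg n s| <= D /\ `|ek n s| <= D) ->
  forall n s, (n <= m)%N -> 0 <= s <= theta ->
    `|g n s| <= C * (q ^+ n * A + D) /\ `|k n s| <= C * (q ^+ n * A + D)].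
Proof.
move=> /andP[rho0 rho1] mrho.
pose x := expR (- beta * theta).
have x0 : 0 < x by exact: expR_gt0.
have x1 : x < 1 by rewrite /x expR_lt1 mulNr oppr_lt0 mulr_gt0.
(* A point of the new cell averages the jump value, at most [rho] times the old bound, with a weight
   [y >= x], and the old cell with the weight [1 - y]; hence the factor [1 - y * (1 - rho) <= q]. *)
pose q := 1 - x * (1 - rho).
have q1 : q < 1 by rewrite /q; nra.
have q0 : 0 < q by rewrite /q; nra.
(* [c0] is what errors of size [D] add in one cell, and [K] is the fixed point of the recursion
   [K = q * K + c0]. *)
pose c0 := 2 / beta + 2.
have c00 : 0 < c0 by rewrite addr_gt0 // divr_gt0.
pose K := c0 / (1 - q).
have K0 : 0 < K by rewrite divr_gt0 // subr_gt0.
have KE : q * K + c0 = K by rewrite /K; field; rewrite subr_eq0 gt_eqF.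
exists (2 + K), q; split; [by rewrite addr_ge0 // ltW|by rewrite q0|].
move=> m g k eg ek dg dk A D A0 D0 cgk rgk jgk gk0 dgk egk n s nm st.
have coef_le a b c : 0 <= c -> a ^+ 2 + b ^+ 2 <= c ^+ 2 -> `|a| <= c /\ `|b| <= c.
  by move=> c_ge0 abc; rewrite !ler_norml; split; apply/andP; split; nra.
have lin_le a b c (u v : R) E : 0 <= c -> `|a| <= c -> `|b| <= c -> `|u| <= E -> `|v| <= E ->
    a * u + b * v <= c * (2 * E).
  move=> c_ge0 ac bc uE vE.
  have le1 a' u' : `|a'| <= c -> `|u'| <= E -> a' * u' <= c * E.
    move=> a'c u'E; apply: le_trans (ler_norm _) _.
    by rewrite normrM ler_pM.
  by have := le1 _ _ ac uE; have := le1 _ _ bc vE; lra.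
have main j : (j <= m)%N -> forall r, 0 <= r <= theta -> forall a b c, 0 <= c ->
    a ^+ 2 + b ^+ 2 <= c ^+ 2 ->
    a * g j r + b * k j r <= c * (q ^+ j * (2 * A) + K * D).
  elim: j => [|j IH] jm r rt a b c c_ge0 abc.
    have [ac bc] := coef_le _ _ _ c_ge0 abc.
    rewrite expr0 mul1r (le_trans (lin_le a b c _ _ A _ _ _ _ _)) //.
    - by case: (gk0 r rt).
    - by case: (gk0 r rt).
    - by rewrite ler_wpM2l // lerDl mulr_ge0 // ltW.
  have [ac bc] := coef_le _ _ _ c_ge0 abc.
  have [rg rk] := rgk _ jm; have [cg ck] := cgk _ jm.
  have {}IH := IH (ltnW jm).
  set B := q ^+ j * (2 * A) + K * D in IH.
  have B0 : 0 <= B.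
    exact: (addr_ge0 (mulr_ge0 (exprn_ge0 _ (ltW q0)) (mulr_ge0 (ler0n _ 2) A0))
      (mulr_ge0 (ltW K0) D0)).
  have cf : continuous (fun s : R => a * g j.+1 s + b * k j.+1 s).
    move=> z; apply: cvgD; apply: cvgM; [exact: cvg_cst|exact: cg|exact: cvg_cst|exact: ck].
  have rf : relaxes (fun s => a * g j.+1 s + b * k j.+1 s)
      (fun s => a * g j s + b * k j s) (fun s => a * eg j s + b * ek j s).
    move=> z zt; have := rg z zt; have := rk z zt => ? ?.
    by deriv; ring.
  have vB z : 0 <= z <= theta -> a * g j z + b * k j z <= c * B.
    by move=> zt; exact: IH.
  have eE z : 0 < z < theta -> a * eg j z + b * ek j z <= c * (2 * D).
    by move=> zt; case: (egk _ _ jm zt) => *; exact: lin_le.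
  have := relax_step cf rf vB eE rt.
  have t_in : 0 <= theta <= theta by rewrite lexx ltW.
  (* The jump acts on the coefficients [(a, b)] by the transposed rotation and scaling, so
     combinations go to combinations and [c] shrinks to [rho * c]; the induction therefore runs over
     all [a], [b], [c]. *)
  have := IH theta t_in (a * m1 + b * m2) (b * m1 - a * m2) (rho * c).
  have -> : (a * m1 + b * m2) ^+ 2 + (b * m1 - a * m2) ^+ 2 =
    (a ^+ 2 + b ^+ 2) * (m1 ^+ 2 + m2 ^+ 2) by ring.
  have -> : (rho * c) ^+ 2 = c ^+ 2 * rho ^+ 2 by ring.
  rewrite mulr_ge0 // ler_pM ?addr_ge0 ?sqr_ge0 // => /(_ isT isT) f0.
  have [dgj dkj] := dgk _ jm; have dj := lin_le a b c _ _ D c_ge0 ac bc dgj dkj.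
  have [-> ->] := jgk _ jm.
  have ex_r : x <= expR (- beta * r) <= 1.
    have /andP[r0 rth] := rt.
    by rewrite /x ler_expR expR_le1 !mulNr lerN2 ler_pM2l // rth oppr_le0 mulr_ge0 // ltW.
  move: ex_r; set y := expR _ => /andP[xy y1].
  move=> /le_trans; apply.
  have y0 : 0 < y by exact: lt_le_trans xy.
  have h1 : y * (a * (m1 * g j theta - m2 * k j theta + dg j) +
     b * (m1 * k j theta + m2 * g j theta + dk j)) <= y * (rho * c * B + c * (2 * D)).
    by rewrite ler_pM2l //; move: f0 dj; lra.
  apply: le_trans (lerD h1 (lexx _)) _.
  have -> : q ^+ j.+1 * (2 * A) + K * D = q * B + c0 * D.
    by rewrite /B exprS -{1}KE; ring.
  have -> : y * (rho * c * B + c * (2 * D)) + (1 - y) * (c * B + c * (2 * D) / beta) =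
    c * ((1 - y * (1 - rho)) * B + y * (2 * D) + (1 - y) * (2 * D / beta)) by ring.
  apply: ler_wpM2l => //; rewrite -addrA; apply: lerD.
    by rewrite ler_wpM2r // /q lerD2l lerN2 ler_wpM2r // subr_ge0 ltW.
  have b0 : 0 <= 2 * D / beta by rewrite divr_ge0 ?mulr_ge0 // ltW.
  have -> : c0 * D = 2 * D / beta + 2 * D by rewrite /c0; ring.
  by nra.
have Cle : q ^+ n * (2 * A) + K * D <= (2 + K) * (q ^+ n * A + D).
  have : 0 <= q ^+ n * A by rewrite mulr_ge0 // exprn_ge0 // ltW.
  by nra.
have mn := main n nm s st.
split; rewrite ler_norml; apply/andP; split.
- by have := mn (-1) 0 1 ler01; rewrite sqrrN expr1n expr0n addr0 lexx => /(_ isT); lra.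
- by have := mn 1 0 1 ler01; rewrite expr1n expr0n addr0 lexx => /(_ isT); lra.
- by have := mn 0 (-1) 1 ler01; rewrite sqrrN expr1n expr0n add0r lexx => /(_ isT); lra.
- by have := mn 0 1 1 ler01; rewrite expr1n expr0n add0r lexx => /(_ isT); lra.
Qed.

(** With multiplier 1 the sup norm need not decay, but the range does: a cell starts at [g n theta],
    inside the range of the previous one, and covers at most the fraction
    [1 - expR (- beta * theta)] of the way to either end of it. *)
Lemma oscillation_decay :
  exists C q, [/\ 0 <= C, 0 < q < 1 &
  forall (m : nat) (g e : nat -> R -> R) A D,
  0 <= A -> 0 <= D ->
  (forall n, (n <= m)%N -> continuous (g n)) ->
  (forall n, (n < m)%N -> relaxes (g n.+1) (g n) (e n)) ->
  (forall n, (n < m)%N -> g n.+1 0 = g n theta) ->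
  (forall s, 0 <= s <= theta -> `|g 0%N s| <= A) ->
  (forall n s, (n < m)%N -> 0 < s < theta -> `|e n s| <= D) ->
  forall n s, (n <= m)%N -> 0 <= s <= theta ->
    `|g n s - g n theta| <= C * (q ^+ n * A + D)].
Proof.
pose x := expR (- beta * theta).
have x0 : 0 < x by exact: expR_gt0.
have x1 : x < 1 by rewrite /x expR_lt1 mulNr oppr_lt0 mulr_gt0.
pose q := 1 - x.
have q1 : q < 1 by rewrite /q; nra.
have q0 : 0 < q by rewrite /q; nra.
pose c0 := q * (2 / beta).
have c00 : 0 < c0 by rewrite mulr_gt0 // divr_gt0.
pose K := c0 / (1 - q).
have K0 : 0 < K by rewrite divr_gt0 // subr_gt0.
have KE : q * K + c0 = K by rewrite /K; field; rewrite subr_eq0 gt_eqF.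
exists (2 + K), q; split; [by rewrite addr_ge0 // ltW|by rewrite q0|].
move=> m g e A D A0 D0 cg rg jg g0 eD n s nm st.
have t_in : 0 <= theta <= theta by rewrite lexx ltW.
have main j : (j <= m)%N -> exists lo hi, (forall r, 0 <= r <= theta ->
    lo <= g j r <= hi) /\ hi - lo <= q ^+ j * (2 * A) + K * D.
  elim: j => [|j IH] jm.
    exists (- A), A; split=> [r rt|]; first by rewrite -ler_norml g0.
    by have := mulr_ge0 (ltW K0) D0; rewrite expr0; lra.
  have [lo [hi [gj hilo]]] := IH (ltnW jm).
  have cgN : continuous (fun s : R => - g j.+1 s) by move=> z; apply: cvgN; exact: cg.
  have rgN : relaxes (fun s => - g j.+1 s) (fun s => - g j s) (fun s => - e j s).
    by move=> z zt; have := rg j jm z zt => ?; deriv; ring.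
  have e1 z : 0 < z < theta -> e j z <= D.
    by move=> zt; exact: le_trans (ler_norm _) (eD _ _ jm zt).
  have e2 z : 0 < z < theta -> - e j z <= D.
    by move=> zt; apply: le_trans (eD _ _ jm zt); rewrite -normrN ler_norm.
  have v1 z : 0 <= z <= theta -> g j z <= hi by case/gj/andP.
  have v2 z : 0 <= z <= theta -> - g j z <= - lo by case/gj/andP; rewrite lerN2.
  have /andP[lot hit] := gj _ t_in.
  have Db : 0 <= D / beta by rewrite divr_ge0 // ltW.
  exists (g j theta - q * (g j theta - lo + D / beta)),
         (g j theta + q * (hi - g j theta + D / beta)); split; last first.
    have -> : q ^+ j.+1 * (2 * A) + K * D = q * (q ^+ j * (2 * A) + K * D) + c0 * D.
      by rewrite exprS -{1}KE; ring.
    have := ler_wpM2l (ltW q0) hilo; rewrite /c0; lra.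
  move=> r rt.
  have := relax_step (cg _ jm) (rg _ jm) v1 e1 rt.
  have := relax_step cgN rgN v2 e2 rt.
  rewrite (jg _ jm).
  have ex_r : x <= expR (- beta * r) <= 1.
    have /andP[r0 rth] := rt.
    by rewrite /x ler_expR expR_le1 !mulNr lerN2 ler_pM2l // rth oppr_le0 mulr_ge0 // ltW.
  move: ex_r; set y := expR _ => /andP[xy y1] h1 h2.
  have yq : 1 - y <= q by rewrite /q; lra.
  have p1 : 0 <= hi - g j theta + D / beta by rewrite addr_ge0 // subr_ge0.
  have p2 : 0 <= g j theta - lo + D / beta by rewrite addr_ge0 // subr_ge0.
  have := ler_wpM2r p1 yq; have := ler_wpM2r p2 yq.
  by move=> h3 h4; apply/andP; split; lra.
have [lo [hi [gn hilo]]] := main n nm.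
have /andP[] := gn s st; have /andP[] := gn theta t_in.
have : q ^+ n * (2 * A) + K * D <= (2 + K) * (q ^+ n * A + D).
  have : 0 <= q ^+ n * A by rewrite mulr_ge0 // exprn_ge0 // ltW.
  by nra.
by move=> *; rewrite ler_norml; apply/andP; split; lra.
Qed.

End ScalarRelaxation.

(** * Integrals expressed through primitives *)

Section PrimitiveBounds.
Context {R : realType}.
Implicit Types (f y : R -> R) (a b c : R).

(** The weight in the Lyapunov functional moves with the endpoint of the window; split into the mass
    [sqprim] and the first moment [wprim], the integrands no longer depend on that endpoint. *)
Definition sqprim y := prim (fun t => y t ^+ 2).
Definition wprim y := prim (fun t => t * y t ^+ 2).

Lemma continuous_sq y : continuous y -> continuous (fun t : R => y t ^+ 2).
Proof. by move=> cy t; apply: cvgM; exact: cy. Qed.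

Lemma continuous_wsq y : continuous y -> continuous (fun t : R => t * y t ^+ 2).
Proof. by move=> cy t; apply: cvgM; [exact: cvg_id|exact: continuous_sq]. Qed.

(** A nonnegative integrand has a nondecreasing primitive. The four coefficients cover all the
    integrands compared below. *)
Lemma combo_prim_ge0 y (c0 c1 c2 c3 : R) a b : continuous y -> -1 < a -> a <= b ->
  (forall s, a < s < b -> 0 <= c0 + c1 * y s + (c2 + c3 * s) * y s ^+ 2) ->
  0 <= c0 * (b - a) + c1 * (prim y b - prim y a) +
       c2 * (sqprim y b - sqprim y a) + c3 * (wprim y b - wprim y a).
Proof.
move=> cy a1 ab pos.
pose F s := - (c0 * s + c1 * prim y s + c2 * sqprim y s + c3 * wprim y s).
pose F' s := - (c0 + c1 * y s + (c2 + c3 * s) * y s ^+ 2).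
have dF (s : R) : -1 < s -> is_derive s 1 F (F' s).
  move=> s1; have d1 := is_derive_prim cy s1.
  have d2 := is_derive_prim (continuous_sq cy) s1.
  have d3 := is_derive_prim (continuous_wsq cy) s1.
  by rewrite /F /F' /sqprim /wprim; deriv; ring.
have := @derive_le0_le _ F F' a b ab.
have -> : F b <= F a = (0 <= F a - F b) by rewrite subr_ge0.
have -> : F a - F b = c0 * (b - a) + c1 * (prim y b - prim y a) +
       c2 * (sqprim y b - sqprim y a) + c3 * (wprim y b - wprim y a).
  by rewrite /F; ring.
apply.
- move=> s /andP[as_ _]; apply: is_derive_continuous (dF s _).
  exact: lt_le_trans as_.
- by move=> s /andP[as_ _]; apply: dF; exact: lt_trans as_.
- by move=> s sab; rewrite /F' oppr_le0 pos.
Qed.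

End PrimitiveBounds.

(* A Lyapunov functional for x'(t) = (beta - kappa) x(t) - beta x(t - theta),
   which is exponentially stable when kappa > 0 and beta * theta < 1:
   with X = x(t) - beta * int_{t-theta}^t x one has X' = - kappa x, and
   V = X^2 + kappa * int_{t-theta}^t ((beta + eta) (s - t + theta) + eta) x(s)^2 ds
   decreases strictly for small eta.  A solution is cut into cells of length
   theta; [energy y0 y1 s] is V at the point s of the cell y1 following y0. *)
Section Energy.
Context {R : realType} (beta theta kappa eta : R).
Hypotheses (beta_gt0 : 0 < beta) (theta_gt0 : 0 < theta) (kappa_gt0 : 0 < kappa)
  (eta_gt0 : 0 < eta) (etaE : eta * (1 + theta) = 1 - beta * theta).
Implicit Types (y : R -> R) (s d D : R).

Local Notation rho := (beta + eta).
Local Notation C2 := (2 + 2 * beta ^+ 2 * theta + kappa * (rho * theta + eta)).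

Definition win (y0 y1 : R -> R) s := (prim y0 theta - prim y0 s) + (prim y1 s - prim y1 0).
Definition sqwin (y0 y1 : R -> R) s :=
  (sqprim y0 theta - sqprim y0 s) + (sqprim y1 s - sqprim y1 0).
(** A point [r] of [y0] lies one delay before the point [r] of [y1]: apart from [eta], the weight is
    [rho * (r - s)] on [y0] and [rho * (r + theta - s)] on [y1]. *)
Definition wwin (y0 y1 : R -> R) s :=
  rho * ((wprim y0 theta - wprim y0 s) - s * (sqprim y0 theta - sqprim y0 s)) +
  rho * ((wprim y1 s - wprim y1 0) + (theta - s) * (sqprim y1 s - sqprim y1 0)) +
  eta * sqwin y0 y1 s.
Definition energy (y0 y1 : R -> R) s :=
  (y1 s - beta * win y0 y1 s) ^+ 2 + kappa * wwin y0 y1 s.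

Section Cell.
Variables (y0 y1 : R -> R) (s : R).
Hypotheses (cy0 : continuous y0) (cy1 : continuous y1) (s_in : 0 <= s <= theta).

Let s0 : 0 <= s. Proof. by case/andP: s_in. Qed.
Let st : s <= theta. Proof. by case/andP: s_in. Qed.
Let N1_lt0 : -1 < 0 :> R. Proof. by rewrite oppr_lt0. Qed.
Let N1_lts : -1 < s. Proof. exact: lt_le_trans s0. Qed.

(** The integral of [(c - y) ^+ 2] over the window is nonnegative. The choice [c = win / theta]
    gives the Cauchy-Schwarz inequality, and [c = y1 s] absorbs the mixed term in the derivative of
    the energy. *)
Lemma win_young (c : R) : 2 * c * win y0 y1 s <= theta * c ^+ 2 + sqwin y0 y1 s.
Proof.
have pos y r : 0 <= c ^+ 2 + (- (2 * c)) * y r + (1 + 0 * r) * y r ^+ 2.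
  by have := sqr_ge0 (c - y r); congr (_ <= _); ring.
have := @combo_prim_ge0 _ y0 _ _ _ _ _ _ cy0 N1_lts st (fun r _ => pos y0 r).
have := @combo_prim_ge0 _ y1 _ _ _ _ _ _ cy1 N1_lt0 s0 (fun r _ => pos y1 r).
rewrite /win /sqwin; lra.
Qed.

Lemma sqwin_ge0 : 0 <= sqwin y0 y1 s.
Proof. by have := win_young 0; rewrite mulr0 mul0r expr0n mulr0 add0r. Qed.

Lemma sqr_win_le : win y0 y1 s ^+ 2 <= theta * sqwin y0 y1 s.
Proof.
have := win_young (win y0 y1 s / theta).
set I := win _ _ _; set J := sqwin _ _ _.
have -> : 2 * (I / theta) * I = (2 * I ^+ 2) / theta by ring.
have -> : theta * (I / theta) ^+ 2 = I ^+ 2 / theta by field; rewrite gt_eqF.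
have -> : 2 * I ^+ 2 / theta = I ^+ 2 / theta + I ^+ 2 / theta by ring.
by rewrite lerD2l ler_pdivrMr // mulrC.
Qed.

Lemma wwin_bounds : eta * sqwin y0 y1 s <= wwin y0 y1 s <=
  (rho * theta + eta) * sqwin y0 y1 s.
Proof.
have lo0 r : s < r < theta -> 0 <= 0 + 0 * y0 r + (- s + 1 * r) * y0 r ^+ 2.
  move=> /andP[sr _]; rewrite mul0r add0r add0r mul1r mulr_ge0 ?sqr_ge0 //.
  by rewrite addrC subr_ge0 ltW.
have lo1 r : 0 < r < s -> 0 <= 0 + 0 * y1 r + ((theta - s) + 1 * r) * y1 r ^+ 2.
  move=> /andP[r0 _]; rewrite mul0r add0r add0r mul1r mulr_ge0 ?sqr_ge0 //.
  by rewrite addr_ge0 ?subr_ge0 // ltW.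
have up0 r : s < r < theta ->
    0 <= 0 + 0 * y0 r + ((theta + s) + (-1) * r) * y0 r ^+ 2.
  move=> /andP[_ rt]; rewrite mul0r add0r add0r mulr_ge0 ?sqr_ge0 //.
  by move: s0; lra.
have up1 r : 0 < r < s -> 0 <= 0 + 0 * y1 r + (s + (-1) * r) * y1 r ^+ 2.
  move=> /andP[_ rt]; rewrite mul0r add0r add0r mulr_ge0 ?sqr_ge0 //.
  by lra.
have := combo_prim_ge0 cy0 N1_lts st lo0; have := combo_prim_ge0 cy0 N1_lts st up0.
have := combo_prim_ge0 cy1 N1_lt0 s0 lo1; have := combo_prim_ge0 cy1 N1_lt0 s0 up1.
rewrite !mul0r !add0r /wwin /sqwin.
set W0 := wprim y0 theta - _; set W1 := wprim y1 s - _.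
set Q0 := sqprim y0 theta - _; set Q1 := sqprim y1 s - _ => h1 h2 h3 h4.
have rho0 : 0 < rho by rewrite addr_gt0.
apply/andP; split.
  by rewrite lerDr -mulrDr; apply: mulr_ge0; [exact: ltW|lra].
rewrite [leRHS]mulrDl lerD2r -mulrDr -mulrA ler_pM2l //; lra.
Qed.


Lemma energy_le : energy y0 y1 s <= C2 * (y1 s ^+ 2 + sqwin y0 y1 s).
Proof.
have /andP[_ W] := wwin_bounds; have := sqr_win_le; have J0 := sqwin_ge0.
rewrite /energy; set I := win _ _ _ in W *; set J := sqwin _ _ _ in W J0 *.
set x := y1 s => IJ.
have h1 : (x - beta * I) ^+ 2 <= 2 * x ^+ 2 + 2 * beta ^+ 2 * I ^+ 2.
  by have := sqr_ge0 (x + beta * I); lra.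
have h2 : 2 * beta ^+ 2 * I ^+ 2 <= 2 * beta ^+ 2 * (theta * J).
  by rewrite ler_wpM2l // mulr_ge0 // sqr_ge0.
have h3 : kappa * wwin y0 y1 s <= kappa * ((rho * theta + eta) * J).
  by rewrite ler_pM2l.
have rt : 0 < rho * theta + eta by rewrite addr_gt0 // mulr_gt0 // addr_gt0.
have h4 : 0 <= (2 * beta ^+ 2 * theta + kappa * (rho * theta + eta)) * x ^+ 2.
  rewrite mulr_ge0 ?sqr_ge0 // addr_ge0 // ?mulr_ge0 ?sqr_ge0 // ltW //.
lra.
Qed.

(** The summand [eta] keeps the weight positive at the old end of the window, so the energy controls
    [sqwin], hence [win], hence the difference between [y1 s] and [y1 s - beta * win]. *)
Lemma coord_le_energy : y1 s ^+ 2 <=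
  (2 + 2 * beta ^+ 2 * theta / (kappa * eta)) * energy y0 y1 s.
Proof.
have /andP[W _] := wwin_bounds; have := sqr_win_le; have J0 := sqwin_ge0.
rewrite /energy; set I := win _ _ _ in W *; set J := sqwin _ _ _ in W J0 *.
set x := y1 s => IJ; set X := x - _; set V := _ + kappa * _.
have ke : 0 < kappa * eta by rewrite mulr_gt0.
have X0 := sqr_ge0 X.
have W0 : kappa * eta * J <= kappa * wwin y0 y1 s by rewrite -mulrA ler_pM2l.
have VX : X ^+ 2 <= V by rewrite lerDl (le_trans _ W0) // mulr_ge0 // ltW.
have VJ : J <= V / (kappa * eta).
  by rewrite ler_pdivlMr // mulrC (le_trans W0) // lerDr.
have xE : x = X + beta * I by rewrite /X subrK.
have h1 : x ^+ 2 <= 2 * X ^+ 2 + 2 * beta ^+ 2 * I ^+ 2.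
  by have := sqr_ge0 (X - beta * I); rewrite [in X in _ -> X]xE; lra.
have h2 : 2 * beta ^+ 2 * I ^+ 2 <= 2 * beta ^+ 2 * (theta * (V / (kappa * eta))).
  apply: ler_wpM2l; first by rewrite mulr_ge0 ?sqr_ge0.
  by apply: (le_trans IJ); rewrite ler_pM2l.
apply: (le_trans h1); rewrite [leRHS]mulrDl; apply: lerD; first by rewrite ler_pM2l.
by apply: (le_trans h2); rewrite le_eqVlt; apply/orP; left; apply/eqP; ring.
Qed.

Lemma energy_ge0 : 0 <= energy y0 y1 s.
Proof.
have /andP[W _] := wwin_bounds; have J0 := sqwin_ge0.
rewrite /energy addr_ge0 ?sqr_ge0 // mulr_ge0 ?(ltW kappa_gt0) // (le_trans _ W) //.
by rewrite mulr_ge0 // ltW.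
Qed.

Lemma win_part_le_energy : (y1 s - beta * win y0 y1 s) ^+ 2 <= energy y0 y1 s.
Proof.
have /andP[W _] := wwin_bounds; have J0 := sqwin_ge0.
by rewrite /energy lerDl mulr_ge0 ?(ltW kappa_gt0) // (le_trans _ W) // mulr_ge0 // ltW.
Qed.

End Cell.

(** At [s = theta] the window is exactly the second cell, so [energy y y theta] can serve as the
    energy of the single cell [y]. *)
Lemma energy_theta y0 y1 y2 : energy y0 y2 theta = energy y1 y2 theta.
Proof. by rewrite /energy /wwin /win /sqwin !subrr; ring. Qed.

Lemma is_derive_energy y0 y1 (e s : R) : continuous y0 -> continuous y1 -> 0 < s ->
  is_derive s 1 y1 ((beta - kappa) * y1 s - beta * y0 s + e) ->
  is_derive s 1 (energy y0 y1)
   (2 * (y1 s - beta * win y0 y1 s) * (- kappa * y1 s + e) +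
    kappa * (rho * theta * y1 s ^+ 2 - rho * sqwin y0 y1 s +
             eta * (y1 s ^+ 2 - y0 s ^+ 2))).
Proof.
move=> cy0 cy1 s0 dy.
have N1s : -1 < s by rewrite (lt_trans _ s0) // oppr_lt0.
have p0 := is_derive_prim cy0 N1s; have p1 := is_derive_prim cy1 N1s.
have q0 := is_derive_prim (continuous_sq cy0) N1s.
have q1 := is_derive_prim (continuous_sq cy1) N1s.
have r0 := is_derive_prim (continuous_wsq cy0) N1s.
have r1 := is_derive_prim (continuous_wsq cy1) N1s.
rewrite -/(sqprim y0) -/(sqprim y1) -/(wprim y0) -/(wprim y1) in q0 q1 r0 r1.
by rewrite /energy /wwin /win /sqwin; deriv; ring.
Qed.

Lemma continuous_energy y0 y1 s : continuous y0 -> continuous y1 -> -1 < s ->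
  {for s, continuous (energy y0 y1)}.
Proof.
move=> cy0 cy1 N1s.
have c1 y : continuous y -> {for s, continuous (prim y)}.
  by move=> cy; exact: is_derive_continuous (is_derive_prim cy N1s).
have c2 := fun y cy => c1 _ (@continuous_sq _ y cy).
have c3 := fun y cy => c1 _ (@continuous_wsq _ y cy).
have cwin : {for s, continuous (win y0 y1)}.
  by apply: cvgD; apply: cvgB; try exact: cvg_cst; exact: c1.
have csq : {for s, continuous (sqwin y0 y1)}.
  by apply: cvgD; apply: cvgB; try exact: cvg_cst; exact: c2.
apply: cvgD.
  by apply: cvgM; (apply: cvgB; [exact: cy1|apply: cvgM; [exact: cvg_cst|exact: cwin]]).
apply: cvgM; first exact: cvg_cst.
apply: cvgD; last by apply: cvgM; [exact: cvg_cst|exact: csq].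
apply: cvgD; (apply: cvgM; first exact: cvg_cst).
  apply: cvgB; first by apply: cvgB; [exact: cvg_cst|exact: c3].
  by apply: cvgM; [exact: cvg_id|apply: cvgB; [exact: cvg_cst|exact: c2]].
apply: cvgD; first by apply: cvgB; [exact: c3|exact: cvg_cst].
apply: cvgM; first by apply: cvgB; [exact: cvg_cst|exact: cvg_id].
by apply: cvgB; [exact: c2|exact: cvg_cst].
Qed.

Variable lam : R.
Hypotheses (lam_gt0 : 0 < lam) (lamE : 2 * lam * C2 = kappa * eta).

Let C2_gt0 : 0 < C2.
Proof.
rewrite addr_gt0 //; first by rewrite addr_gt0 // !mulr_gt0 // exprn_gt0.
by rewrite mulr_gt0 // addr_gt0 // mulr_gt0 // addr_gt0.
Qed.

(** After [win_young] with [c = y1 s], the coefficient of [y1 s ^+ 2] in the derivative is [- kappa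
    * (2 - 2 * beta * theta - eta * (1 + theta))], that is [- kappa * eta * (1 + theta)] by [etaE],
    and that of [sqwin] is [- kappa * eta]. By [energy_le] and [lamE] the energy then decays at the
    rate [2 * lam], half of which is spent on the forcing. *)
Lemma energy_decr y0 y1 (e : R -> R) D : continuous y0 -> continuous y1 ->
  (forall s, 0 < s < theta ->
     is_derive s 1 y1 ((beta - kappa) * y1 s - beta * y0 s + e s)) ->
  (forall s, 0 < s < theta -> `|e s| <= D) ->
  forall s, 0 <= s <= theta ->
  energy y0 y1 s - D ^+ 2 / lam ^+ 2 <=
    expR (- lam * s) * (energy y0 y1 0 - D ^+ 2 / lam ^+ 2).
Proof.
move=> cy0 cy1 dy eD s /andP[s0 st].
have st' r : 0 < r < s -> 0 < r < theta by move=> /andP[-> /lt_le_trans ->].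
apply: (@relax_le _ _ (fun s =>
   (2 * (y1 s - beta * win y0 y1 s) * (- kappa * y1 s + e s) +
    kappa * (rho * theta * y1 s ^+ 2 - rho * sqwin y0 y1 s +
             eta * (y1 s ^+ 2 - y0 s ^+ 2))))) => //.
- move=> r /andP[r0 _]; apply: continuous_energy => //.
  by rewrite (lt_le_trans _ r0) // oppr_lt0.
- by move=> r /st' rt; apply: is_derive_energy (dy r rt) => //; case/andP: rt.
move=> r /st' rt.
have rt' : 0 <= r <= theta by case/andP: rt => /ltW -> /ltW ->.
have := energy_le cy0 cy1 rt'; have := win_part_le_energy cy0 cy1 rt'.
have J0 := sqwin_ge0 cy0 cy1 rt'; have := win_young cy0 cy1 rt' (y1 r).
set V := energy _ _ _; set I := win _ _ _; set J := sqwin _ _ _ in J0 *.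
set x := y1 r; set X := x - _ => yng XV VC.
have {}VC : 2 * lam * V <= kappa * eta * (x ^+ 2 + J).
  have -> : kappa * eta * (x ^+ 2 + J) = 2 * lam * (C2 * (x ^+ 2 + J)).
    by rewrite -lamE; ring.
  by rewrite ler_pM2l // mulr_gt0.
have eX : 2 * X * e r <= lam * V + D ^+ 2 / lam.
  have eD2 : e r ^+ 2 <= D ^+ 2.
    rewrite -real_normK ?num_real // ler_sqr ?nnegrE ?eD //.
    exact: le_trans (eD r rt).
  have h1 : 2 * X * e r <= lam * X ^+ 2 + e r ^+ 2 / lam.
    rewrite -subr_ge0; have -> : lam * X ^+ 2 + e r ^+ 2 / lam - 2 * X * e r =
      lam * (X - e r / lam) ^+ 2 by field; rewrite gt_eqF.
    by rewrite mulr_ge0 ?sqr_ge0 // ltW.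
  by apply: (le_trans h1); apply: lerD; [rewrite ler_pM2l|rewrite ler_pM2r ?invr_gt0].
have -> : - lam * (V - D ^+ 2 / lam ^+ 2) = - lam * V + D ^+ 2 / lam.
  by field; rewrite gt_eqF.
have y00 := mulr_ge0 (mulr_ge0 (ltW kappa_gt0) (ltW eta_gt0)) (sqr_ge0 (y0 r)).
have ky := ler_wpM2l (mulr_ge0 (ltW kappa_gt0) (ltW beta_gt0)) yng.
have kx := mulr_ge0 (ltW kappa_gt0) (sqr_ge0 x).
have keta : kappa * x ^+ 2 * (eta * (1 + theta)) = kappa * x ^+ 2 * (1 - beta * theta).
  by rewrite etaE.
have kt : 0 <= kappa * x ^+ 2 * (eta * theta).
  by rewrite mulr_ge0 // mulr_ge0 // ltW.
rewrite /X in eX *; lra.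
Qed.

(** The window is the same on both sides of the junction, so only the defect [y1 0 - y0 theta]
    matters; it costs a factor [1 + z], as close to 1 as desired. *)
Lemma energy_jump y0 y1 (z D : R) : 0 < z -> continuous y0 -> continuous y1 ->
  `|y1 0 - y0 theta| <= D ->
  energy y0 y1 0 <= (1 + z) * energy y0 y0 theta + (1 + z^-1) * D ^+ 2.
Proof.
move=> z0 cy0 cy1 yD.
have t_in : 0 <= theta <= theta by rewrite lexx ltW.
have /andP[W _] := wwin_bounds cy0 cy0 t_in.
have J0 := sqwin_ge0 cy0 cy0 t_in.
have W0 : 0 <= kappa * wwin y0 y0 theta.
  by rewrite mulr_ge0 ?(ltW kappa_gt0) // (le_trans _ W) // mulr_ge0 // ltW.
have winE : win y0 y1 0 = win y0 y0 theta by rewrite /win !subrr addr0 add0r.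
have wwinE : wwin y0 y1 0 = wwin y0 y0 theta.
  by rewrite /wwin /sqwin !subrr; ring.
rewrite /energy winE wwinE; set X := y0 theta - _; set d := y1 0 - y0 theta in yD.
have -> : y1 0 - beta * win y0 y0 theta = X + d by rewrite /X /d; ring.
have d_le : d ^+ 2 <= D ^+ 2.
  rewrite -real_normK ?num_real // ler_sqr ?nnegrE //; exact: le_trans yD.
have h1 : (X + d) ^+ 2 <= (1 + z) * X ^+ 2 + (1 + z^-1) * d ^+ 2.
  rewrite -subr_ge0; have -> : (1 + z) * X ^+ 2 + (1 + z^-1) * d ^+ 2 - (X + d) ^+ 2 =
    z * (X - d / z) ^+ 2 by field; rewrite gt_eqF.
  by rewrite mulr_ge0 ?sqr_ge0 // ltW.
have h2 : (1 + z^-1) * d ^+ 2 <= (1 + z^-1) * D ^+ 2.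
  by rewrite ler_wpM2l // addr_ge0 // invr_ge0 ltW.
have h3 : 0 <= z * (kappa * wwin y0 y0 theta) by rewrite mulr_ge0 // ltW.
lra.
Qed.

Lemma energy_init y A : continuous y ->
  (forall s, 0 <= s <= theta -> y s ^+ 2 <= A) ->
  energy y y theta <= C2 * ((1 + theta) * A).
Proof.
move=> cy yA.
have t_in : 0 <= theta <= theta by rewrite lexx ltW.
apply: le_trans (energy_le cy cy t_in) _; rewrite ler_pM2l // mulrDl mul1r.
apply: lerD; first exact: yA.
have N1_lt0 : -1 < 0 :> R by rewrite oppr_lt0.
have := @combo_prim_ge0 _ y A 0 (-1) 0 0 theta cy N1_lt0 (ltW theta_gt0).
have H s : 0 < s < theta -> 0 <= A + 0 * y s + (-1 + 0 * s) * y s ^+ 2.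
  move=> /andP[s0 st]; rewrite !mul0r !addr0 mulN1r subr_ge0.
  by apply: yA; rewrite !ltW.
by move=> /(_ H); rewrite /sqwin subrr; lra.
Qed.

Lemma energy_decay : exists C q, [/\ 0 <= C, 0 < q < 1 &
  forall (m : nat) (y e : nat -> R -> R) (A D : R),
  0 <= A -> 0 <= D ->
  (forall n, (n <= m)%N -> continuous (y n)) ->
  (forall n, (n < m)%N -> forall s, 0 < s < theta ->
    is_derive s 1 (y n.+1) ((beta - kappa) * y n.+1 s - beta * y n s + e n s)) ->
  (forall n, (n < m)%N -> `|y n.+1 0 - y n theta| <= D) ->
  (forall n s, (n < m)%N -> 0 < s < theta -> `|e n s| <= D) ->
  (forall s, 0 <= s <= theta -> `|y 0%N s| <= A) ->
  forall n s, (n <= m)%N -> 0 <= s <= theta -> `|y n s| <= C * (q ^+ n * A + D)].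
Proof.
pose x := expR (- lam * theta).
have x0 : 0 < x by exact: expR_gt0.
have x1 : x < 1 by rewrite /x expR_lt1 mulNr oppr_lt0 mulr_gt0.
(* Half of the decay over a cell pays for the jump: [x * (1 + z) = (1 + x) / 2]. *)
pose z := (1 - x) / (2 * x).
have z0 : 0 < z by rewrite divr_gt0 ?subr_gt0 // mulr_gt0.
pose r := (1 + x) / 2.
have r0 : 0 < r by rewrite divr_gt0 // addr_gt0.
have r1 : r < 1 by rewrite /r; lra.
have xzr : x * (1 + z) = r by rewrite /z /r; field; rewrite gt_eqF.
pose K0 := (1 + z^-1) + (lam ^+ 2)^-1.
have K00 : 0 < K0.
  by apply: addr_gt0; [apply: addr_gt0|]; rewrite ?invr_gt0 // exprn_gt0.
pose K1 := K0 / (1 - r).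
have K10 : 0 < K1 by rewrite divr_gt0 // subr_gt0.
have K1E : r * K1 + K0 = K1 by rewrite /K1; field; rewrite subr_eq0 gt_eqF.
pose C3 := 2 + 2 * beta ^+ 2 * theta / (kappa * eta).
have C30 : 0 < C3.
  by rewrite /C3 addr_gt0 // divr_gt0 ?mulr_gt0 // exprn_gt0.
pose K2 := C2 * (1 + theta).
have K20 : 0 < K2 by rewrite mulr_gt0 // addr_gt0.
pose K3 := C3 * ((1 + z) * K2 / r + (1 + z) * K1 + K0).
have K30 : 0 < K3.
  have z1 : 0 < 1 + z by rewrite addr_gt0.
  exact: (mulr_gt0 C30 (addr_gt0 (addr_gt0 (divr_gt0 (mulr_gt0 z1 K20) r0)
    (mulr_gt0 z1 K10)) K00)).
(* The energy is quadratic in the solution, so its rate [r] becomes [Num.sqrt r]. *)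
pose q := Num.sqrt r.
have q0 : 0 < q by rewrite sqrtr_gt0.
have q2 : q ^+ 2 = r by rewrite sqr_sqrtr // ltW.
have q1 : q < 1 by rewrite -(@expr_lt1 _ 2) ?(ltW q0) // q2.
exists (1 + Num.sqrt K3), q; split; [by rewrite addr_ge0 // sqrtr_ge0|by rewrite q0|].
move=> m y e A D A0 D0 cy dy jy eD yA.
have t_in : 0 <= theta <= theta by rewrite lexx ltW.
have step n s : (n < m)%N -> 0 <= s <= theta -> energy (y n) (y n.+1) s <=
    expR (- lam * s) * ((1 + z) * energy (y n) (y n) theta) + K0 * D ^+ 2.
  move=> nm st; have ED := energy_decr (cy _ (ltnW nm)) (cy _ nm) (dy n nm)
    (fun s => eD n s nm) st.
  have EJ := energy_jump z0 (cy _ (ltnW nm)) (cy _ nm) (jy n nm).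
  set w := expR _ in ED *.
  have w0 : 0 < w by exact: expR_gt0.
  have w1 : w <= 1.
    rewrite /w expR_le1 mulNr oppr_le0 mulr_ge0 // ?(ltW lam_gt0) //.
    by case/andP: st.
  have := ler_wpM2l (ltW w0) EJ.
  have h1 : w * ((1 + z^-1) * D ^+ 2) <= (1 + z^-1) * D ^+ 2.
    by rewrite ler_piMl // mulr_ge0 ?sqr_ge0 // addr_ge0 // invr_ge0 ltW.
  have h2 : 0 <= w * (D ^+ 2 / lam ^+ 2).
    by rewrite mulr_ge0 // ?divr_ge0 ?sqr_ge0 // ltW.
  by rewrite /K0; move: ED; lra.
have En n : (n <= m)%N ->
    energy (y n) (y n) theta <= r ^+ n * (K2 * A ^+ 2) + K1 * D ^+ 2.
  elim: n => [|n IH] nm.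
    have kd := mulr_ge0 (ltW K10) (sqr_ge0 D).
    have : energy (y 0%N) (y 0%N) theta <= C2 * ((1 + theta) * A ^+ 2).
      apply: energy_init => [|s st]; first exact: cy.
      by rewrite -real_normK ?num_real // ler_sqr ?nnegrE ?yA.
    by rewrite mulrA -/K2 expr0; lra.
  rewrite (energy_theta _ (y n)); apply: le_trans (step n theta nm t_in) _.
  rewrite -[expR _]/x (mulrA x) xzr.
  have := ler_wpM2l (ltW r0) (IH (ltnW nm)).
  have KD : K1 * D ^+ 2 = r * (K1 * D ^+ 2) + K0 * D ^+ 2.
    by rewrite -{1}K1E; ring.
  by rewrite (exprS r n); lra.
have sq n s : (n < m)%N -> 0 <= s <= theta ->
    y n.+1 s ^+ 2 <= K3 * (r ^+ n.+1 * A ^+ 2 + D ^+ 2).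
  move=> nm st.
  apply: le_trans (coord_le_energy (cy _ (ltnW nm)) (cy _ nm) st) _.
  rewrite -/C3 /K3 -mulrA ler_pM2l //; apply: (le_trans (step n s nm st)).
  have V0 := energy_ge0 (cy _ (ltnW nm)) (cy _ (ltnW nm)) t_in.
  have h1 : expR (- lam * s) * ((1 + z) * energy (y n) (y n) theta) <=
     (1 + z) * energy (y n) (y n) theta.
    apply: ler_piMl; first exact: mulr_ge0 (addr_ge0 ler01 (ltW z0)) V0.
    rewrite expR_le1 mulNr oppr_le0 mulr_ge0 // ?(ltW lam_gt0) //.
    by case/andP: st.
  apply: (le_trans (lerD h1 (lexx _))).
  have z10 : 0 <= 1 + z by rewrite addr_ge0 // ltW.
  have := ler_wpM2l z10 (En n (ltnW nm)).
  have -> : (1 + z) * (r ^+ n * (K2 * A ^+ 2) + K1 * D ^+ 2) =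
    (1 + z) * K2 / r * (r ^+ n.+1 * A ^+ 2) + (1 + z) * K1 * D ^+ 2.
    by rewrite (exprS r n); field; rewrite gt_eqF.
  have p1 : 0 <= ((1 + z) * K1 + K0) * (r ^+ n.+1 * A ^+ 2).
    exact: (mulr_ge0 (addr_ge0 (mulr_ge0 z10 (ltW K10)) (ltW K00))
      (mulr_ge0 (exprn_ge0 _ (ltW r0)) (sqr_ge0 A))).
  have p2 : 0 <= (1 + z) * K2 / r * D ^+ 2.
    exact: (mulr_ge0 (divr_ge0 (mulr_ge0 z10 (ltW K20)) (ltW r0)) (sqr_ge0 D)).
  by lra.
case=> [|n] s nm st.
  rewrite expr0 mul1r (le_trans (yA s st)) // mulrDl mul1r.
  have : 0 <= Num.sqrt K3 * (A + D) by rewrite mulr_ge0 ?sqrtr_ge0 // addr_ge0.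
  by lra.
have qA := mulr_ge0 (exprn_ge0 n.+1 (ltW q0)) A0.
have P0 : 0 <= q ^+ n.+1 * A + D by rewrite addr_ge0.
apply: (@le_trans _ _ (Num.sqrt K3 * (q ^+ n.+1 * A + D))); last first.
  by rewrite ler_wpM2r // lerDr.
rewrite -(ler_pXn2r (n := 2)) ?nnegrE ?mulr_ge0 ?sqrtr_ge0 //.
rewrite real_normK ?num_real // (le_trans (sq n s nm st)) //.
rewrite [leRHS]exprMn sqr_sqrtr ?(ltW K30) // ler_pM2l //.
have -> : (q ^+ n.+1 * A + D) ^+ 2 =
   (q ^+ 2) ^+ n.+1 * A ^+ 2 + D ^+ 2 + 2 * (q ^+ n.+1 * A * D).
  by rewrite -exprM mulnC exprM; ring.
by rewrite q2 lerDl; have := mulr_ge0 qA D0; lra.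
Qed.

End Energy.

Section NegativeMultiplier.
Context {R : realType} (beta theta : R) (beta_gt0 : 0 < beta) (theta_gt0 : 0 < theta).

(* With L = log mu, the function (-1)^n e^{L s / theta} g_n(s) on the n-th cell is
   the restriction of a solution of x'(t) = (L / theta - beta) x(t) - beta x(t - theta). *)
Lemma negative_decay (mu : R) : 1 <= mu -> ln mu < 2 * (beta * theta) ->
  beta * theta < 1 ->
  exists C q, [/\ 0 <= C, 0 < q < 1 &
  forall (m : nat) (g e : nat -> R -> R) (d : nat -> R) (A D : R),
  0 <= A -> 0 <= D ->
  (forall n, (n <= m)%N -> continuous (g n)) ->
  (forall n, (n < m)%N -> relaxes beta theta (g n.+1) (g n) (e n)) ->
  (forall n, (n < m)%N -> g n.+1 0 = - mu * g n theta + d n) ->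
  (forall s, 0 <= s <= theta -> `|g 0%N s| <= A) ->
  (forall n, (n < m)%N -> `|d n| <= D) ->
  (forall n s, (n < m)%N -> 0 < s < theta -> `|e n s| <= D) ->
  forall n s, (n <= m)%N -> 0 <= s <= theta -> `|g n s| <= C * (q ^+ n * A + D)].
Proof.
move=> mu1 Llt bt1.
have mu0 : 0 < mu by exact: lt_le_trans mu1.
set L := ln mu in Llt *.
have LE : expR L = mu by rewrite lnK.
have L0 : 0 <= L by rewrite ln_ge0.
(* This [kappa] solves [beta - kappa = L / theta - beta], which matches the rescaled cells with the
   equation behind [energy]. *)
have kappa_gt0 : 0 < 2 * beta - L / theta.
  by rewrite subr_gt0 ltr_pdivrMr // -mulrA.
have t1 : 0 < 1 + theta by rewrite addr_gt0.
have eta_gt0 : 0 < (1 - beta * theta) / (1 + theta) by rewrite divr_gt0 ?subr_gt0.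
set kappa := 2 * beta - L / theta in kappa_gt0.
set eta := (1 - beta * theta) / (1 + theta) in eta_gt0.
have etaE : eta * (1 + theta) = 1 - beta * theta.
  by rewrite /eta; field; rewrite gt_eqF.
pose C2 := 2 + 2 * beta ^+ 2 * theta + kappa * ((beta + eta) * theta + eta).
have C2_gt0 : 0 < C2.
  rewrite addr_gt0 //; first by rewrite addr_gt0 // !mulr_gt0 // exprn_gt0.
  exact: (mulr_gt0 kappa_gt0 (addr_gt0 (mulr_gt0 (addr_gt0 beta_gt0 eta_gt0)
    theta_gt0) eta_gt0)).
pose lam := kappa * eta / (2 * C2).
have lam_gt0 : 0 < lam.
  exact: (divr_gt0 (mulr_gt0 kappa_gt0 eta_gt0) (mulr_gt0 (ltr0n _ 2) C2_gt0)).
have lamE : 2 * lam * C2 = kappa * eta.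
  by rewrite /lam; field; rewrite gt_eqF.
have [C [q [C0 q01 H]]] :=
  energy_decay beta_gt0 theta_gt0 kappa_gt0 eta_gt0 etaE lam_gt0 lamE.
exists (C * mu), q; split=> //; first by rewrite mulr_ge0 // ltW.
move=> m g e d A D A0 D0 cg rg jg gA d_le eD n s nm st.
pose E (s : R) := expR (L / theta * s).
have LT : 0 <= L / theta by rewrite divr_ge0 // ltW.
have E1 r : 0 <= r -> 1 <= E r by move=> r0; rewrite /E -expR0 ler_expR mulr_ge0.
have ET : E theta = mu by rewrite /E divfK ?gt_eqF.
have E2 r : r <= theta -> E r <= mu by move=> rt; rewrite -ET /E ler_expR ler_wpM2l.
have E0 r : 0 < E r by exact: expR_gt0.
pose y n s := (-1) ^+ n * (E s * g n s).
have normy k r : `|y k r| = E r * `|g k r|.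
  by rewrite /y normrMsign normrM gtr0_norm.
have {}H := H m y (fun n s => (-1) ^+ n.+1 * (E s * e n s)) (mu * A) (mu * D).
have mule r a B : 0 <= B -> 0 <= r <= theta -> `|a| <= B -> E r * `|a| <= mu * B.
  by move=> B0 /andP[_ rt] aB; rewrite ler_pM // ?E2 // ltW.
have nt k : (k < m)%N -> forall r, 0 < r < theta -> is_derive r 1 (y k.+1)
    ((beta - kappa) * y k.+1 r - beta * y k r + (-1) ^+ k.+1 * (E r * e k r)).
  move=> km r rt; have := rg k km r rt => dg.
  by rewrite /y /E; deriv; rewrite /kappa exprS; ring.
have -> : C * mu * (q ^+ n * A + D) = C * (q ^+ n * (mu * A) + mu * D) by ring.
have t_in : 0 <= theta <= theta by rewrite lexx ltW.
apply: le_trans (H _ _ _ nt _ _ _ n s nm st).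
- by rewrite normy ler_peMl // E1 //; case/andP: st.
- by rewrite mulr_ge0 // ltW.
- by rewrite mulr_ge0 // ltW.
- move=> k km z; apply: cvgM; first exact: cvg_cst.
  apply: cvgM; last exact: cg.
  by apply: (@is_derive_continuous _ _ _ z); rewrite /E; deriv; exact: erefl.
- move=> k km; rewrite /y jg // ET /E mulr0 expR0 mul1r exprS.
  rewrite (_ : _ - _ = (-1) ^+ k.+1 * d k); last by rewrite exprS; ring.
  by rewrite normrMsign (le_trans (d_le k km)) // ler_peMl.
- move=> k r km rt; rewrite normrMsign normrM gtr0_norm //; apply: mule => //.
    by case/andP: rt => /ltW -> /ltW ->.
  exact: eD.
- by move=> r rt; rewrite normy; apply: mule => //; exact: gA.
Qed.

End NegativeMultiplier.

(** * The linear cell problem *)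

Section Pairing.
Context {R : realType} {N : nat}.
Implicit Types (L : 'rV[R[i]]_N) (v w : 'cV[R]_N).

Lemma ReD (x y : R[i]) : complex.Re (x + y) = complex.Re x + complex.Re y.
Proof. by case: x; case: y. Qed.

Lemma ImD (x y : R[i]) : complex.Im (x + y) = complex.Im x + complex.Im y.
Proof. by case: x; case: y. Qed.

Lemma Re_sum (I : Type) (r : seq I) (F : I -> R[i]) :
  complex.Re (\sum_(i <- r) F i) = \sum_(i <- r) complex.Re (F i).
Proof. exact: (big_morph (fun z : R[i] => complex.Re z) ReD). Qed.

Lemma Im_sum (I : Type) (r : seq I) (F : I -> R[i]) :
  complex.Im (\sum_(i <- r) F i) = \sum_(i <- r) complex.Im (F i).
Proof. exact: (big_morph (fun z : R[i] => complex.Im z) ImD). Qed.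

Definition cplx m n (A : 'M[R]_(m, n)) : 'M[R[i]]_(m, n) :=
  map_mx (real_complex R) A.

(** A complex functional on real vectors; its real and imaginary parts along a cell are the [g] and
    [k] of the scalar problems. *)
Definition pairing L v : R[i] := (L *m cplx v) 0 0.

Lemma cplxM m n q (A : 'M[R]_(m, n)) (B : 'M[R]_(n, q)) :
  cplx (A *m B) = cplx A *m cplx B.
Proof. exact: map_mxM. Qed.

Lemma Re_pairing L v :
  complex.Re (pairing L v) = \sum_j complex.Re (L 0 j) * v j 0.
Proof.
rewrite /pairing mxE Re_sum; apply: eq_bigr => j _; rewrite mxE.
by case: (L 0 j) => a b /=; rewrite mulr0 subr0.
Qed.

Lemma Im_pairing L v :
  complex.Im (pairing L v) = \sum_j complex.Im (L 0 j) * v j 0.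
Proof.
rewrite /pairing mxE Im_sum; apply: eq_bigr => j _; rewrite mxE.
by case: (L 0 j) => a b /=; rewrite mulr0 add0r.
Qed.

Lemma sum_continuous (I : Type) (r : seq I) (F : I -> R -> R) :
  (forall i, continuous (F i)) -> continuous (fun s : R => \sum_(i <- r) F i s).
Proof.
move=> cF; elim: r => [|i r IH].
  rewrite (_ : (fun s => _) = fun=> 0) => [t|]; first exact: cvg_cst.
  by apply/funext => s; rewrite big_nil.
rewrite (_ : (fun s => _) = fun s => F i s + \sum_(j <- r) F j s).
  by move=> t; apply: cvgD; [exact: cF|exact: IH].
by apply/funext => s; rewrite big_cons.
Qed.

Lemma lincomb_continuous (a : 'I_N -> R) (w : R -> 'cV[R]_N) : continuous w ->
  continuous (fun s : R => \sum_j a j * w s j 0).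
Proof.
move=> cw; apply: sum_continuous => j t; apply: cvgM; first exact: cvg_cst.
exact: entry_continuous.
Qed.

Lemma lincomb_is_derive (a : 'I_N -> R) (w : R -> 'cV[R]_N) (t : R) d :
  is_derive t 1 w d ->
  is_derive t 1 (fun s : R => \sum_j a j * w s j 0) (\sum_j a j * d j 0).
Proof.
move=> /is_derive_coord dw.
have H j : is_derive t 1 (fun s : R => a j * w s j 0) (a j * d j 0).
  by have dj := dw j 0; deriv; rewrite addr0.
exact: is_derive_sumf.
Qed.

Lemma lincomb_le (a : 'I_N -> R) v : `|\sum_j a j * v j 0| <= (\sum_j `|a j|) * `|v|.
Proof.
apply: le_trans (ler_norm_sum _ _ _) _; rewrite mulr_suml; apply: ler_sum => j _.
by rewrite normrM ler_wpM2l // norm_coord.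
Qed.

End Pairing.

Lemma geometric_small {R : realType} (a q eps : R) : 0 <= a -> 0 < q < 1 ->
  0 < eps -> exists K, forall n, (K <= n)%N -> a * q ^+ n <= eps.
Proof.
move=> a0 /andP[q0 q1] eps0.
have a1 : 0 < a + 1 by rewrite ltr_wpDl.
have e2 : 0 < eps / (a + 1) by rewrite divr_gt0.
have := cvg_expr (z := q); rewrite gtr0_norm // => /(_ q1).
move=> /cvgrPdist_lt/(_ _ e2)[K _ HK]; exists K => n Kn.
have := HK n Kn; rewrite /= sub0r normrN ger0_norm ?exprn_ge0 ?(ltW q0) //.
rewrite ltr_pdivlMr // mulrDr mulr1 [q ^+ n * a]mulrC => h.
by apply: le_trans (ltW h); rewrite lerDl exprn_ge0 // ltW.
Qed.

(** * Decay of functionals along the linear cell problem *)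

Section LinearSystem.
Context {R : realType} {N : nat} (beta theta : R) (M : 'M[R]_N).
Hypotheses (beta_gt0 : 0 < beta) (theta_gt0 : 0 < theta).
Implicit Types (w e : nat -> R -> 'cV[R]_N) (m n k : nat) (A D s : R)
  (L : 'rV[R[i]]_N).

(** Cell 0 is given data and solves no equation; [e n] drives the cell [n.+1], up to the cell
    [m]. *)
Definition linsys w e m A D :=
  [/\ 0 <= A /\ 0 <= D,
      forall n, (n <= m)%N -> continuous (w n),
      forall n, (n < m)%N -> forall s, 0 < s < theta ->
        is_derive s 1 (w n.+1) (beta *: (w n s - w n.+1 s) + e n s),
      forall n, (n < m)%N -> w n.+1 0 = M *m w n theta &
      (forall s, 0 <= s <= theta -> `|w 0%N s| <= A) /\
      (forall n s, (n < m)%N -> 0 < s < theta -> `|e n s| <= D)].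

Lemma linsys_take w e m k A D : (k <= m)%N -> linsys w e m A D -> linsys w e k A D.
Proof.
move=> km [AD0 cw dw jw [wA eD]]; split=> //.
- by move=> n nk; apply: cw; exact: leq_trans km.
- by move=> n nk; apply: dw; exact: leq_trans km.
- by move=> n nk; apply: jw; exact: leq_trans km.
- by split=> // n s nk; apply: eD; exact: leq_trans km.
Qed.

(** The summands bound the jump, the previous cell, and the forcing divided by [beta], relative to a
    bound that already dominates [D]. *)
Definition growth := N%:R * `|M| + 1 + beta^-1.

Lemma growth_ge1 : 1 <= growth.
Proof. by rewrite /growth -addrA addrCA lerDl addr_ge0 ?mulr_ge0 // invr_ge0 ltW. Qed.

Lemma linsys_growth w e m A D : linsys w e m A D ->
  forall n s, (n <= m)%N -> 0 <= s <= theta -> `|w n s| <= growth ^+ n * (A + D).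
Proof.
move=> [[A0 D0] cw dw jw [wA eD]]; elim=> [|n IH] s nm st.
  by rewrite expr0 mul1r (le_trans (wA s st)) // lerDl.
have g1 := growth_ge1; have g0 : 0 <= growth by exact: le_trans g1.
set B := growth ^+ n * (A + D) in IH.
have B1 : A + D <= B by rewrite ler_peMl ?addr_ge0 // exprn_ege1.
have B0 : 0 <= B by apply: le_trans B1; rewrite addr_ge0.
have DB : D <= B by apply: le_trans B1; rewrite lerDr.
have t_in : 0 <= theta <= theta by rewrite lexx ltW.
rewrite exprS -mulrA -/B; apply: norm_cV_le => [|i]; first by rewrite mulr_ge0.
have side (c : R) : `|c| = 1 -> c * w n.+1 s i 0 <= growth * B.
  move=> c1.
  have cc (v : 'cV[R]_N) (b : R) : `|v| <= b -> c * v i 0 <= b.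
    move=> vb; rewrite (le_trans (ler_norm _)) // normrM c1 mul1r.
    exact: le_trans (norm_coord v i) vb.
  have cg k : (k <= m)%N -> continuous (fun r : R => c * w k r i 0).
    move=> km; rewrite (_ : (fun r => _) =
      fun r => \sum_j (if j == i then c else 0) * w k r j 0).
      by apply: lincomb_continuous; exact: cw.
    apply/funext => r; rewrite (bigD1 i) //= eqxx big1 ?addr0 // => j /negbTE ->.
    by rewrite mul0r.
  have rg : relaxes beta theta (fun r => c * w n.+1 r i 0)
      (fun r => c * w n r i 0) (fun r => c * e n r i 0).
    move=> r rt; have /is_derive_coord/(_ i 0) := dw n nm r rt; rewrite !mxE => dwi.
    by deriv; ring.
  have := relax_step beta_gt0 (cg _ nm) rg (fun r rt => cc _ _ (IH r (ltnW nm) rt))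
    (fun r rt => cc _ _ (eD n r nm rt)) st.
  move=> /le_trans; apply.
  have y1 : expR (- beta * s) <= 1.
    by rewrite expR_le1 mulNr oppr_le0 mulr_ge0 // ?(ltW beta_gt0) //; case/andP: st.
  have y0 := expR_ge0 (- beta * s).
  set y := expR _ in y0 y1 *.
  have w0 : c * w n.+1 0 i 0 <= N%:R * `|M| * B.
    apply: cc; rewrite jw // (le_trans (mulmx_norm_le _ _)) //.
    by rewrite ler_wpM2l ?mulr_ge0 // (IH _ (ltnW nm) t_in).
  have NM := mulr_ge0 (mulr_ge0 (ler0n R N) (normr_ge0 M)) B0.
  have h1 : y * (c * w n.+1 0 i 0) <= N%:R * `|M| * B.
    apply: le_trans (ler_wpM2l y0 w0) _; exact: ler_piMl.
  have BD : 0 <= B + D / beta by rewrite addr_ge0 // divr_ge0 // ltW.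
  have h2 : (1 - y) * (B + D / beta) <= B + D / beta.
    by apply: ler_piMl => //; lra.
  have h3 : D / beta <= B / beta by rewrite ler_pM2r ?invr_gt0.
  by rewrite /growth; lra.
rewrite ler_norml; apply/andP; split.
  by have := side (-1); rewrite normrN normr1 => /(_ erefl); lra.
by have := side 1; rewrite normr1 => /(_ erefl); lra.
Qed.

Lemma linsys_shift w e m k A D : (k <= m)%N -> linsys w e m A D ->
  linsys (fun n => w (k + n)%N) (fun n => e (k + n)%N) (m - k)
    (growth ^+ k * (A + D)) D.
Proof.
move=> km H; have G := linsys_growth H; case: H => [[A0 D0] cw dw jw [wA eD]].
have lt n : (n < m - k)%N -> (k + n < m)%N by rewrite ltn_subRL.
split.
- by split=> //; rewrite mulr_ge0 ?addr_ge0 // exprn_ge0 // (le_trans _ growth_ge1).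
- by move=> n nm; apply: cw; rewrite -(subnKC km) leq_add2l.
- by move=> n /lt nm s st; rewrite addnS; exact: dw.
- by move=> n /lt nm; rewrite addnS; exact: jw.
- by split=> [s st|n s /lt nm st]; [rewrite addn0; exact: G|exact: eD].
Qed.

(** The threshold [K] depends on [eps] alone, whereas [C] may grow with the length [m]. Without a
    prescribed rate, the notion passes unchanged from one factor [M - mu] to the next. *)
Definition decays L := forall eps, 0 < eps -> exists K, forall m, (K <= m)%N ->
  exists C, 0 <= C /\ forall w e A D, linsys w e m A D ->
  forall s, 0 <= s <= theta ->
  `|complex.Re (pairing L (w m s))| <= eps * A + C * D /\
  `|complex.Im (pairing L (w m s))| <= eps * A + C * D.

Lemma decays0 : decays 0.
Proof.
move=> eps eps0; exists 0%N => m _; exists 0; split=> // w e A D [[A0 D0] _ _ _ _] s st.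
by rewrite /pairing mul0mx mxE /= normr0 mul0r addr0 mulr_ge0 // ltW.
Qed.

Lemma decays_uniform L eps : decays L -> 0 < eps -> exists K, forall m,
  exists C, 0 <= C /\ forall n w e A D, (K <= n <= m)%N -> linsys w e n A D ->
  forall s, 0 <= s <= theta ->
  `|complex.Re (pairing L (w n s))| <= eps * A + C * D /\
  `|complex.Im (pairing L (w n s))| <= eps * A + C * D.
Proof.
move=> dL eps0; have [K HK] := dL eps eps0; exists K; elim=> [|m [C [C0 HC]]].
  case: K HK => [|K] HK; last by exists 0; split=> // n ? ? ? ? /andP[]; case: n.
  have [C [C0 HC]] := HK 0%N isT; exists C; split=> // n w e A D.
  by rewrite leqn0 => /= /eqP -> ; exact: HC.
have [Km|mK] := leqP K m.+1; last first.
  by exists 0; split=> // n w e A D /andP[Kn nm]; move: (leq_trans Kn nm); rewrite leqNgt mK.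
have [C' [C'0 HC']] := HK _ Km.
exists (C + C'); split=> [|n w e A D /andP[Kn]]; first exact: addr_ge0.
rewrite leq_eqVlt => /orP[/eqP ->|nm] H s st; have D0 : 0 <= D by case: H => -[].
  have [h1 h2] := HC' _ _ _ _ H s st; have := mulr_ge0 C0 D0.
  by split; rewrite mulrDl; lra.
have [|h1 h2] := HC n w e A D _ H s st; first by rewrite Kn.
by have := mulr_ge0 C'0 D0; split; rewrite mulrDl; lra.
Qed.

Definition stable_multiplier (mu : R[i]) :=
  complex.Re mu ^+ 2 + complex.Im mu ^+ 2 < 1 \/
  complex.Im mu = 0 /\ - expR (2 * (beta * theta)) < complex.Re mu < -1.

Lemma stable_decay (mu : R[i]) : beta * theta < 1 -> stable_multiplier mu ->
  exists C q, [/\ 0 <= C, 0 < q < 1 &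
  forall m (g k eg ek : nat -> R -> R) (dg dk : nat -> R) A D,
  0 <= A -> 0 <= D ->
  (forall n, (n <= m)%N -> continuous (g n) /\ continuous (k n)) ->
  (forall n, (n < m)%N -> relaxes beta theta (g n.+1) (g n) (eg n) /\
                          relaxes beta theta (k n.+1) (k n) (ek n)) ->
  (forall n, (n < m)%N ->
     g n.+1 0 = complex.Re mu * g n theta - complex.Im mu * k n theta + dg n /\
     k n.+1 0 = complex.Re mu * k n theta + complex.Im mu * g n theta + dk n) ->
  (forall s, 0 <= s <= theta -> `|g 0%N s| <= A /\ `|k 0%N s| <= A) ->
  (forall n, (n < m)%N -> `|dg n| <= D /\ `|dk n| <= D) ->
  (forall n s, (n < m)%N -> 0 < s < theta -> `|eg n s| <= D /\ `|ek n s| <= D) ->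
  forall n s, (n <= m)%N -> 0 <= s <= theta ->
    `|g n s| <= C * (q ^+ n * A + D) /\ `|k n s| <= C * (q ^+ n * A + D)].
Proof.
move=> bt1 [mu1|[im0 /andP[mulo muhi]]].
  have mu0 : 0 <= complex.Re mu ^+ 2 + complex.Im mu ^+ 2.
    by rewrite addr_ge0 // sqr_ge0.
  apply: (contracting_decay beta_gt0 theta_gt0
    (rho := Num.sqrt (complex.Re mu ^+ 2 + complex.Im mu ^+ 2))).
    by rewrite sqrtr_ge0 -sqrtr1 ltr_sqrt.
  by rewrite sqr_sqrtr.
set x := complex.Re mu in mulo muhi *.
have x1 : 1 <= - x by lra.
have lx : ln (- x) < 2 * (beta * theta).
  by rewrite -ltr_expR lnK ?posrE; lra.
have [C [q [C0 q01 H]]] := negative_decay beta_gt0 theta_gt0 x1 lx bt1.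
exists C, q; split=> // m g k eg ek dg dk A D A0 D0 cgk rgk jgk gkA dgk egk n s nm st.
split.
- apply: (H m g eg dg) => // [j /cgk[]|j /rgk[]|j jm|r /gkA[]|j /dgk[]|j r jm rt] //.
  + by rewrite opprK; case: (jgk j jm) => -> _; rewrite im0; ring.
  + by case: (egk j r jm rt).
- apply: (H m k ek dk) => // [j /cgk[]|j /rgk[]|j jm|r /gkA[]|j /dgk[]|j r jm rt] //.
  + by rewrite opprK; case: (jgk j jm) => _ ->; rewrite im0; ring.
  + by case: (egk j r jm rt).
Qed.

(** [L w_(n+1)(0) = mu L w_n(theta) + L (M - mu) w_n(theta)]: once the last term has become small,
    it is a mere jump error in the scalar problem with multiplier [mu], which is restarted there. *)
Lemma decays_cascade L (mu : R[i]) : beta * theta < 1 -> stable_multiplier mu ->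
  decays (L *m (cplx M - mu%:M)) -> decays L.
Proof.
move=> bt1 smu dL' eps eps0.
have [C [q [C0 /andP[q0 q1] H]]] := stable_decay bt1 smu.
have C1 : 0 < 2 * (C + 1) by rewrite mulr_gt0 // ltr_wpDl.
have e1 : 0 < eps / (2 * (C + 1)) by rewrite divr_gt0.
set eps1 := eps / (2 * (C + 1)) in e1.
have Ceps1 : C * eps1 <= eps / 2.
  rewrite /eps1 mulrA ler_pdivrMr //; nra.
have [K1 HK1] := decays_uniform dL' e1.
pose cL := (\sum_j `|complex.Re (L 0 j)|) + (\sum_j `|complex.Im (L 0 j)|).
have re0 : 0 <= \sum_j `|complex.Re (L 0 j)| by exact: sumr_ge0.
have im0 : 0 <= \sum_j `|complex.Im (L 0 j)| by exact: sumr_ge0.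
have cL0 : 0 <= cL by exact: addr_ge0.
have RecL v : `|complex.Re (pairing L v)| <= cL * `|v|.
  rewrite Re_pairing (le_trans (lincomb_le _ _)) // ler_wpM2r // /cL lerDl //.
have ImcL v : `|complex.Im (pairing L v)| <= cL * `|v|.
  rewrite Im_pairing (le_trans (lincomb_le _ _)) // ler_wpM2r // /cL lerDr //.
have g1 := growth_ge1; have g0 : 0 <= growth by exact: le_trans g1.
set G := growth ^+ K1.
have G0 : 0 <= G by exact: exprn_ge0.
(* The first [K1] cells are only bounded, by the factor [G]; [K2] further cells outweigh it. *)
have [K2 HK2] : exists K2, forall n, (K2 <= n)%N -> C * (cL * G) * q ^+ n <= eps / 2.
  by apply: geometric_small; rewrite ?q0 ?divr_gt0 // !mulr_ge0.
exists (K1 + K2)%N => m Km.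
have K1m : (K1 <= m)%N by rewrite (leq_trans _ Km) // leq_addr.
have [C' [C'0 HC']] := HK1 m.
exists (C * (q ^+ (m - K1) * (cL * G) + (C' + cL))); split.
  apply: mulr_ge0 => //; apply: addr_ge0; last exact: addr_ge0.
  by rewrite mulr_ge0 ?mulr_ge0 // exprn_ge0 // ltW.
move=> w e A D Hw s st.
have Hs := linsys_shift K1m Hw.
have [[A0 D0] cw dw jw [wA eD]] := Hw.
pose g n r := complex.Re (pairing L (w (K1 + n)%N r)).
pose k n r := complex.Im (pairing L (w (K1 + n)%N r)).
pose eg n r := complex.Re (pairing L (e (K1 + n)%N r)).
pose ek n r := complex.Im (pairing L (e (K1 + n)%N r)).
pose L' := L *m (cplx M - mu%:M).
pose dg n := complex.Re (pairing L' (w (K1 + n)%N theta)).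
pose dk n := complex.Im (pairing L' (w (K1 + n)%N theta)).
pose D' := eps1 * A + (C' + cL) * D.
have D'0 : 0 <= D'.
  by apply: addr_ge0; apply: mulr_ge0 => //; [exact: ltW|exact: addr_ge0].
have A'0 : 0 <= cL * (G * (A + D)) by rewrite !mulr_ge0 // addr_ge0.
have [[_ _] cs ds js [sA sD]] := Hs.
have lt n : (n < m - K1)%N -> (K1 + n < m)%N by rewrite ltn_subRL.
have t_in : 0 <= theta <= theta by rewrite lexx ltW.
have jump n : (n < m - K1)%N -> pairing L (w (K1 + n.+1)%N 0) =
    mu * pairing L (w (K1 + n)%N theta) + pairing L' (w (K1 + n)%N theta).
  move=> nm; rewrite js // /pairing cplxM mulmxA /L' mulmxBr mulmxBl mul_mx_scalar.
  by rewrite -scalemxAl !mxE; ring.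
have relax_pair (a : 'I_N -> R) n : (n < m - K1)%N ->
    relaxes beta theta (fun r => \sum_j a j * w (K1 + n.+1)%N r j 0)
     (fun r => \sum_j a j * w (K1 + n)%N r j 0)
     (fun r => \sum_j a j * e (K1 + n)%N r j 0).
  move=> nm r rt; have := lincomb_is_derive a (ds n nm r rt).
  move=> d; apply: (is_derive_eq d).
  rewrite mulrBr !mulr_sumr -sumrB -big_split /=; apply: eq_bigr => j _.
  by rewrite !mxE; ring.
have ReE n : g n = fun r => \sum_j complex.Re (L 0 j) * w (K1 + n)%N r j 0.
  by apply/funext => r; rewrite /g Re_pairing.
have ImE n : k n = fun r => \sum_j complex.Im (L 0 j) * w (K1 + n)%N r j 0.
  by apply/funext => r; rewrite /k Im_pairing.
have ReeE n : eg n = fun r => \sum_j complex.Re (L 0 j) * e (K1 + n)%N r j 0.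
  by apply/funext => r; rewrite /eg Re_pairing.
have ImeE n : ek n = fun r => \sum_j complex.Im (L 0 j) * e (K1 + n)%N r j 0.
  by apply/funext => r; rewrite /ek Im_pairing.
have step1 n : (n <= m - K1)%N -> continuous (g n) /\ continuous (k n).
  by move=> nm; rewrite ReE ImE; split; apply: lincomb_continuous; exact: cs.
have step2 n : (n < m - K1)%N -> relaxes beta theta (g n.+1) (g n) (eg n) /\
                          relaxes beta theta (k n.+1) (k n) (ek n).
  by move=> nm; rewrite !ReE !ImE ReeE ImeE; split; exact: relax_pair.
have step3 n : (n < m - K1)%N ->
     g n.+1 0 = complex.Re mu * g n theta - complex.Im mu * k n theta + dg n /\
     k n.+1 0 = complex.Re mu * k n theta + complex.Im mu * g n theta + dk n.
  move=> nm; rewrite /g /k jump // ReD ImD /dg /dk.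
  by case: (mu) (pairing L _) => [a b] [c d] /=; split; ring.
have step4 r : 0 <= r <= theta ->
    `|g 0%N r| <= cL * (G * (A + D)) /\ `|k 0%N r| <= cL * (G * (A + D)).
  move=> rt; have := sA r rt => wr; split.
    by apply: le_trans (RecL _) _; rewrite ler_wpM2l.
  by apply: le_trans (ImcL _) _; rewrite ler_wpM2l.
have cLD : 0 <= cL * D by exact: mulr_ge0.
have C'D : 0 <= C' * D by exact: mulr_ge0.
have eA : 0 <= eps1 * A by rewrite mulr_ge0 // ltW.
have step5 n : (n < m - K1)%N -> `|dg n| <= D' /\ `|dk n| <= D'.
  move=> /lt nm; have [||h1 h2] := HC' (K1 + n)%N w e A D _ _ theta t_in.
  - by rewrite leq_addr ltnW.
  - exact: linsys_take (ltnW nm) Hw.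
  - by rewrite /D' mulrDl; split; lra.
have step6 n r : (n < m - K1)%N -> 0 < r < theta -> `|eg n r| <= D' /\ `|ek n r| <= D'.
  move=> nm rt; have er := sD n r nm rt.
  have := RecL (e (K1 + n)%N r); have := ImcL (e (K1 + n)%N r).
  by have := ler_wpM2l cL0 er; rewrite /D' mulrDl; split; lra.
have := H _ _ _ _ _ _ _ _ _ A'0 D'0 step1 step2 step3 step4 step5 step6 (m - K1)%N s (leqnn _) st.
rewrite /g /k subnKC //.
suff le : C * (q ^+ (m - K1) * (cL * (G * (A + D))) + D') <=
    eps * A + C * (q ^+ (m - K1) * (cL * G) + (C' + cL)) * D.
  by move=> [h1 h2]; split; [exact: le_trans le|exact: le_trans le].
have := ler_wpM2r A0 (HK2 (m - K1)%N _); rewrite leq_subRL // => /(_ Km).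
have := ler_wpM2r A0 Ceps1; rewrite /D'; lra.
Qed.

(** The factors are peeled off until the functional 0 is reached. A repeated root is a repeated
    factor, so generalized eigenvectors need no separate treatment. *)
Lemma decays_prod L (r : seq R[i]) : beta * theta < 1 ->
  (forall mu, mu \in r -> stable_multiplier mu) ->
  L *m foldr (fun mu P => (cplx M - mu%:M) *m P) 1%:M r = 0 -> decays L.
Proof.
move=> bt1; elim: r L => [|mu r IH] L sr /= LP.
  by rewrite -[L]mulmx1 LP; exact: decays0.
apply: (@decays_cascade L mu) => //; first by apply: sr; rewrite mem_head.
by apply: IH => [nu nur|]; [apply: sr; rewrite inE nur orbT|rewrite -mulmxA].
Qed.

End LinearSystem.

(** * Spectral projection *)

Section SpectralFacts.

Lemma char_poly_conj (F : fieldType) n (P A : 'M[F]_n) : P \in unitmx ->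
  char_poly (P *m A *m invmx P) = char_poly A.
Proof.
move=> Pu; rewrite /char_poly /char_poly_mx.
have PV : map_mx polyC P *m map_mx polyC (invmx P) = 1%:M.
  by rewrite -map_mxM mulmxV // map_mx1.
have -> : 'X%:M - map_mx polyC (P *m A *m invmx P) =
    map_mx polyC P *m ('X%:M - map_mx polyC A) *m map_mx polyC (invmx P).
  rewrite mulmxBr mulmxBl -!map_mxM mul_mx_scalar -scalemxAl PV.
  by rewrite scalemx1.
by rewrite !det_mulmx mulrAC -det_mulmx PV det1 mul1r.
Qed.

(** In a lower triangular form the simple eigenvalue [a] stands at exactly one diagonal place [k].
    By forward substitution an eigenvector whose coordinate [k] vanishes is 0, so two eigenvectors
    are proportional. *)
Lemma simple_eigenline (C : numClosedFieldType) n (A : 'M[C]_n) (a : C)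
    (u v : 'cV[C]_n) : mup a (char_poly A) = 1%N ->
  A *m u = a *: u -> A *m v = a *: v -> u != 0 -> exists c, v = c *: u.
Proof.
move=> A1 Au Av u0.
have n0 : (0 < n)%N.
  by case: n A u v A1 Au Av u0 => // A u v _ _ _; rewrite [u]flatmx0 eqxx.
have [P Pun] := Schur A n0; have Pu := unitarymx_unit Pun.
rewrite /similar_to /= conjumx //; set T := P *m A *m invmx P => Ttrig.
have TP x : A *m x = a *: x -> T *m (P *m x) = a *: (P *m x).
  by move=> Ax; rewrite /T -!mulmxA (mulmxA (invmx P)) mulVmx // mul1mx Ax -scalemxAr.
have : mup a (char_poly T) = 1%N by rewrite char_poly_conj.
rewrite char_poly_trig // (_ : \prod_(i < n) _ =
  \prod_(z <- [seq T i i | i <- index_enum 'I_n]) ('X - z%:P)); last by rewrite big_map.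
rewrite mu_prod_XsubC count_map.
have -> : count (preim (fun i => T i i) (pred1 a)) (index_enum 'I_n) =
   #|[pred i | T i i == a]|.
  by rewrite cardE size_filter /enum_mem; apply: eq_count.
move/mem_card1 => [k Hk].
have Tkk i : (T i i == a) = (i == k) by have := Hk i; rewrite !inE.
have ker0 (z : 'cV[C]_n) : T *m z = a *: z -> z k 0 = 0 -> z = 0.
  move=> Tz zk; apply/colP => i; rewrite [RHS]mxE.
  have [m] := ubnP (nat_of_ord i); elim: m i => // m IH i im.
  have [->//|ik] := eqVneq i k.
  have /colP/(_ i) := Tz; rewrite !mxE (bigD1 i) //= big1 ?addr0 => [|j ji].
    move/eqP; rewrite -subr_eq0 -mulrBl mulf_eq0 subr_eq0 Tkk (negbTE ik) /=.
    by move/eqP.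
  case: (ltngtP i j) => [ij|ji'|/val_inj ij].
  - by have /is_trig_mxP/(_ i j ij) -> := Ttrig; rewrite mul0r.
  - by rewrite (IH j) ?mulr0 // (leq_trans ji').
  - by rewrite ij eqxx in ji.
have zu0 : (P *m u) k 0 != 0.
  apply: contraNneq u0 => /(ker0 _ (TP _ _ Au)) Pu0.
  by rewrite -[u]mul1mx -(mulVmx Pu) -mulmxA Pu0 mulmx0.
pose c := (P *m v) k 0 / (P *m u) k 0; exists c.
have w0 : P *m (v - c *: u) = 0.
  apply: ker0; first by apply: TP; rewrite mulmxBr Av -scalemxAr Au scalerBr !scalerA mulrC.
  by rewrite mulmxBr -scalemxAr mxE [X in _ + X]mxE [X in _ - X]mxE /c divfK // subrr.
apply/eqP; rewrite -subr_eq0 -[v - _]mul1mx -(mulVmx Pu) -mulmxA w0 mulmx0.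
by [].
Qed.

(** [v] and [v A] have the same Hermitian norm. This serves the case [th = 0], where the twisted
    monodromy matrix is [h^-1]. *)
Lemma eigenvalue_orthogonal (R : realType) n (A : 'M[R]_n) (mu : R[i]) :
  A *m A^T = 1%:M -> eigenvalue (cmx A) mu -> `|mu| = 1.
Proof.
move=> AA /eigenvalueP[v vA v0].
have cjA : map_mx Num.conj (cmx A) = cmx A.
  by apply/matrixP => i j; rewrite !mxE; apply: conj_Creal; rewrite complex_real.
have vv : v *m (map_mx Num.conj v)^T = (\sum_j `|v 0 j| ^+ 2)%:M.
  apply/matrixP => i j; rewrite !ord1 !mxE eqxx mulr1n; apply: eq_bigr => k _.
  by rewrite !mxE normCK.
have S0 : \sum_j `|v 0 j| ^+ 2 != 0.
  rewrite psumr_neq0 => [|j _]; last by rewrite exprn_ge0.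
  have [j vj] := rV0Pn _ v0; apply/hasP; exists j; first by rewrite mem_index_enum.
  by rewrite exprn_gt0 // normr_gt0.
have : (v *m cmx A) *m (map_mx Num.conj (v *m cmx A))^T = v *m (map_mx Num.conj v)^T.
  rewrite map_mxM cjA trmx_mul mulmxA -[v *m _ *m _]mulmxA.
  have -> : cmx A *m (cmx A)^T = 1%:M.
    have -> : (cmx A)^T = map_mx (real_complex R) A^T.
      by apply/matrixP => i j; rewrite !mxE.
    by rewrite (_ : cmx A = map_mx (real_complex R) A) // -map_mxM AA map_mx1.
  by rewrite mulmx1.
rewrite vA map_mxZ linearZ /= -scalemxAl -scalemxAr scalerA vv -normCK.
rewrite scale_scalar_mx => /matrixP/(_ 0 0); rewrite !mxE eqxx !mulr1n.
move/eqP; rewrite -subr_eq0 -{2}[\sum_j _]mul1r -mulrBl mulf_eq0 (negbTE S0) orbF.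
by rewrite subr_eq0 sqrp_eq1 // => /eqP.
Qed.

Lemma eigenvalue_root_prod (F : fieldType) n (A : 'M[F]_n) (r : seq F) (a : F) :
  char_poly A = \prod_(mu <- r) ('X - mu%:P) -> eigenvalue A a = (a \in r).
Proof. by rewrite eigenvalue_root_char => ->; rewrite root_prod_XsubC. Qed.

Lemma char_poly_split (C : closedFieldType) n (A : 'M[C]_n) :
  exists r : seq C, char_poly A = \prod_(mu <- r) ('X - mu%:P).
Proof.
have [r E] := closed_field_poly_normal (char_poly A); exists r.
by rewrite E (eqP (char_poly_monic A)) scale1r.
Qed.

Lemma horner_mx_prod (F : comNzRingType) n (A : 'M[F]_n.+1) (r : seq F) :
  horner_mx A (\prod_(mu <- r) ('X - mu%:P)) =
  foldr (fun mu P => (A - mu%:M) *m P) 1%:M r.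
Proof.
elim: r => [|mu r IH]; first by rewrite big_nil rmorph1.
by rewrite big_cons rmorphM rmorphB /= horner_mx_X horner_mx_C IH.
Qed.

(* For a simple eigenvalue a with cofactor q = chi / (X - a), the matrix
   P = q(A) / q(a) is the spectral projection onto the eigenline. *)
Lemma spectral_projection (C : closedFieldType) n (A : 'M[C]_n) (a : C) :
  mup a (char_poly A) = 1%N ->
  exists (P : 'M[C]_n) (r : seq C),
  [/\ A *m P = a *: P, P *m A = a *: P,
     forall mu, mu \in r -> eigenvalue A mu /\ mu <> a &
     (1%:M - P) *m foldr (fun mu Q => (A - mu%:M) *m Q) 1%:M r = 0].
Proof.
case: n A => [|n] A a1.
  by exists 0, [::]; split=> //; rewrite ?[A]flatmx0 ?mulmx0 ?mul0mx ?scaler0 // flatmx0.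
have [s sE] := char_poly_split A.
move: a1; rewrite sE mu_prod_XsubC => sa.
have a_s : a \in s by rewrite -has_pred1 has_count sa.
have ps := perm_to_rem a_s; set r := rem a s in ps.
have ra : a \notin r.
  rewrite -has_pred1 has_count -leqNgt.
  by move: sa; rewrite (permP ps) /= eqxx add1n => -[->].
set Q := foldr (fun mu Q => (A - mu%:M) *m Q) 1%:M r.
have QE : Q = horner_mx A (\prod_(mu <- r) ('X - mu%:P)) by rewrite horner_mx_prod.
have CH := Cayley_Hamilton A; move: CH; rewrite sE (perm_big _ ps) big_cons /=.
move=> CH; have := CH; rewrite rmorphM rmorphB /= horner_mx_X horner_mx_C -QE => AQ.
move: CH; rewrite mulrC rmorphM rmorphB /= horner_mx_X horner_mx_C -QE => QA.
have {}AQ : A *m Q = a *: Q.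
  by apply/eqP; rewrite -subr_eq0 -mul_scalar_mx -mulmxBl; apply/eqP.
have {}QA : Q *m A = a *: Q.
  by apply/eqP; rewrite -subr_eq0 -mul_mx_scalar -mulmxBr; apply/eqP.
pose c := \prod_(mu <- r) (a - mu).
have c0 : c != 0.
  rewrite prodf_seq_neq0; apply/allP => mu mur /=; rewrite subr_eq0.
  by apply: contraNneq ra => ->.
(* The columns of [Q] are fixed by [A] up to the factor [a], so each [A - mu] acts on them as
   [a - mu]. *)
have QQ : Q *m Q = c *: Q.
  rewrite {1}/Q /c; elim: (r) => [|mu l IH]; first by rewrite big_nil scale1r mul1mx.
  rewrite /= big_cons -mulmxA IH -scalemxAr mulmxBl AQ mul_scalar_mx -scalerBl.
  by rewrite scalerA mulrC.
exists (c^-1 *: Q), r; split.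
- by rewrite -scalemxAr AQ !scalerA mulrC.
- by rewrite -scalemxAl QA !scalerA mulrC.
- move=> mu mur; split; last by move=> mua; move: ra; rewrite -mua mur.
  by rewrite (eigenvalue_root_prod _ sE) (perm_mem ps) inE mur orbT.
- by rewrite -/Q mulmxBl mul1mx -scalemxAl QQ scalerA mulVf // scale1r subrr.
Qed.

End SpectralFacts.

(** * Convergence of the linear cell problem to a fixed vector *)

Section LinearEstimate.
Context {R : realType} {N : nat} (beta theta : R) (M : 'M[R]_N).
Hypotheses (beta_gt0 : 0 < beta) (theta_gt0 : 0 < theta)
  (beta_theta : beta * theta < 1).
Hypotheses (simple1 : alg_mult M 1 = 1%N)
  (stableM : forall mu, in_spectrum M mu -> mu <> 1 -> stable_multiplier beta theta mu).

Local Notation linsys := (linsys beta theta M).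

(** Coefficients invariant under [M] give a scalar problem whose multiplier is 1. *)
Lemma oscillation_lincomb (a : 'I_N -> R) :
  (forall v : 'cV[R]_N, \sum_j a j * (M *m v) j 0 = \sum_j a j * v j 0) ->
  forall eps, 0 < eps -> exists K, forall m, (K <= m)%N -> exists C, 0 <= C /\
  forall w e A D, linsys w e m A D -> forall s, 0 <= s <= theta ->
  `|\sum_j a j * w m s j 0 - \sum_j a j * w m theta j 0| <= eps * A + C * D.
Proof.
move=> aM eps eps0.
have [C [q [C0 q01 H]]] := oscillation_decay beta_gt0 theta_gt0.
pose cL := \sum_j `|a j|; have cL0 : 0 <= cL by exact: sumr_ge0.
have CcL : 0 <= C * cL by exact: mulr_ge0.
have [K HK] := geometric_small CcL q01 eps0.
exists K => m Km; exists (C * cL); split=> // w e A D [[A0 D0] cw dw jw [wA eD]] s st.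
have {}H := H m (fun n r => \sum_j a j * w n r j 0)
  (fun n r => \sum_j a j * e n r j 0) (cL * A) (cL * D).
have le (v : 'cV[R]_N) b : `|v| <= b -> `|\sum_j a j * v j 0| <= cL * b.
  by move=> vb; rewrite (le_trans (lincomb_le _ _)) // ler_wpM2l.
have := H _ _ _ _ _ _ _ m s (leqnn _) st.
have -> : C * (q ^+ m * (cL * A) + cL * D) = C * cL * q ^+ m * A + C * cL * D by ring.
move=> h; apply: (le_trans (h _ _ _ _ _ _ _)).
- exact: mulr_ge0.
- exact: mulr_ge0.
- by move=> n nm; apply: lincomb_continuous; exact: cw.
- move=> n nm r rt; apply: (is_derive_eq (lincomb_is_derive a (dw n nm r rt))).
  rewrite mulrBr !mulr_sumr -sumrB -big_split /=; apply: eq_bigr => j _.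
  by rewrite !mxE; ring.
- by move=> n nm; rewrite jw // aM.
- by move=> r rt; apply: le; exact: wA.
- by move=> n r nm rt; apply: le; exact: eD.
- by rewrite lerD2r ler_wpM2r // HK.
Qed.

(** The spectral projection is built over the complex numbers; real parts commute with the real
    matrix [M] and lead back to real fixed vectors. *)
Definition Re_mx n (z : 'cV[R[i]]_n) : 'cV[R]_n := map_mx (fun x => complex.Re x) z.

Lemma Re_mx_mul m n (B : 'M[R]_(m, n)) z : Re_mx (cplx B *m z) = B *m Re_mx z.
Proof.
apply/colP => i; rewrite !mxE Re_sum; apply: eq_bigr => j _; rewrite !mxE.
by case: (z j 0) => a b /=; rewrite mul0r subr0.
Qed.

(** The rows of [1 - P] decay by [decays_prod], and the rows of [P] are invariant under [M], so
    their components have small oscillation. Hence [w m s] is close to the real part of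
    [P w_m(theta)], which is the vector [c]. *)
Lemma linear_estimate eps : 0 < eps -> exists m C, [/\ (0 < m)%N, 0 <= C &
  forall w e A D, linsys w e m A D ->
  exists c, [/\ M *m c = c, `|c| <= C * (A + D) &
    forall s, 0 <= s <= theta -> `|w m s - c| <= eps * A + C * D]].
Proof.
move=> eps0.
have [P [r [MP PM spec PQ]]] := spectral_projection simple1.
rewrite !scale1r in MP PM.
have e2 : 0 < eps / 2 by rewrite divr_gt0.
pose Lp i := row i P; pose Lq i := row i (1%:M - P).
have dq i : decays beta theta M (Lq i).
  apply: (decays_prod beta_gt0 theta_gt0 (r := r)) => // [mu /spec[]|]; first exact: stableM.
  by rewrite -row_mul PQ; apply/rowP => j; rewrite !mxE.
have dp i : forall eps, 0 < eps -> exists K, forall m, (K <= m)%N -> exists C, 0 <= C /\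
  forall w e A D, linsys w e m A D -> forall s, 0 <= s <= theta ->
  `|\sum_j complex.Re (Lp i 0 j) * w m s j 0 -
    \sum_j complex.Re (Lp i 0 j) * w m theta j 0| <= eps * A + C * D.
  apply: oscillation_lincomb => v; rewrite -!Re_pairing /pairing cplxM mulmxA.
  by rewrite -row_mul [P *m _]PM.
have [Kq HKq] := fin_all_exists (fun i => dq i _ e2).
have [Kp HKp] := fin_all_exists (fun i => dp i _ e2).
(* One length beyond the thresholds of all coordinates, and positive. *)
pose m := (\sum_i (Kq i + Kp i)).+1.
have Km i : (Kq i + Kp i <= m)%N.
  by rewrite /m (bigD1 i) //= ltnW // ltnS leq_addr.
have [Cq HCq] := fin_all_exists (fun i => HKq i m (leq_trans (leq_addr _ _) (Km i))).
have [Cp HCp] := fin_all_exists (fun i => HKp i m (leq_trans (leq_addl _ _) (Km i))).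
pose G := growth beta M ^+ m.
have G0 : 0 <= G by rewrite exprn_ge0 // (le_trans ler01) // growth_ge1.
pose cP := \sum_i \sum_j `|complex.Re (Lp i 0 j)|.
have cP0 : 0 <= cP by apply: sumr_ge0 => i _; exact: sumr_ge0.
have Cq0 i : 0 <= Cq i by case: (HCq i).
have Cp0 i : 0 <= Cp i by case: (HCp i).
have SC0 : 0 <= \sum_i (Cq i + Cp i) by apply: sumr_ge0 => i _; exact: addr_ge0.
exists m, (cP * G + \sum_i (Cq i + Cp i)); split=> //.
  by rewrite addr_ge0 // mulr_ge0.
move=> w e A D Hw; have [[A0 D0] _ _ _ _] := Hw.
have t_in : 0 <= theta <= theta by rewrite lexx ltW.
pose z := P *m cplx (w m theta).
have zE i : Re_mx z i 0 = \sum_j complex.Re (Lp i 0 j) * w m theta j 0.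
  by rewrite mxE -Re_pairing /pairing /Lp -row_mul [in RHS]mxE.
have wG : `|w m theta| <= G * (A + D).
  exact: (linsys_growth beta_gt0 theta_gt0 Hw (leqnn m) t_in).
exists (Re_mx z); split.
- by rewrite -Re_mx_mul /z mulmxA [cplx M *m P]MP.
- apply: (@le_trans _ _ (cP * G * (A + D))); last first.
    by rewrite ler_wpM2r ?addr_ge0 // lerDl.
  apply: norm_cV_le => [|i]; first by rewrite !mulr_ge0 ?addr_ge0.
  rewrite zE (le_trans (lincomb_le _ _)) // -mulrA ler_pM //; first exact: sumr_ge0.
  rewrite /cP [leRHS](bigD1 i) //= lerDl; apply: sumr_ge0 => k _; exact: sumr_ge0.
move=> s st; apply: norm_cV_le => [|i].
  by rewrite addr_ge0 ?mulr_ge0 ?addr_ge0 ?mulr_ge0 // ltW.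
have [_ /(_ _ _ _ _ Hw s st)[h1 _]] := HCq i.
have [_ /(_ _ _ _ _ Hw s st) h2] := HCp i.
have -> : (w m s - Re_mx z) i 0 = complex.Re (pairing (Lq i) (w m s)) +
   (\sum_j complex.Re (Lp i 0 j) * w m s j 0 -
    \sum_j complex.Re (Lp i 0 j) * w m theta j 0).
  rewrite mxE [X in _ + X]mxE zE addrA; congr (_ - _).
  have rowE (Q : 'M[R[i]]_N) v : pairing (row i Q) v = (Q *m cplx v) i 0.
    by rewrite /pairing -row_mul mxE.
  rewrite -Re_pairing -ReD !rowE mulmxBl mul1mx; move: (P *m _) => Pv.
  by rewrite !mxE subrK.
apply: le_trans (ler_normD _ _) _; apply: le_trans (lerD h1 h2) _.
have Ci : Cq i + Cp i <= \sum_i (Cq i + Cp i).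
  by rewrite [leRHS](bigD1 i) //= lerDl; apply: sumr_ge0 => k _; exact: addr_ge0.
have := ler_wpM2r D0 Ci.
have := mulr_ge0 (mulr_ge0 cP0 G0) D0.
by lra.
Qed.

End LinearEstimate.

(** * Second-order Taylor bounds *)

Section Taylor.
Context {R : realType} {N : nat}.
Implicit Types (f g : 'cV[R]_N -> 'cV[R]_N) (x y z v : 'cV[R]_N) (K B : R).
Local Notation e j := (delta_mx j 0 : 'cV[R]_N).

Lemma is_derive_line g x v (t : R) : derivable g (x + t *: v) v ->
  is_derive t 1 (fun s : R => g (x + s *: v)) ('D_v g (x + t *: v)).
Proof.
have E (h : R) : x + (h *: (1 : R) + t) *: v = h *: v + (x + t *: v).
  by rewrite scalerDl [h *: _]mulr1 addrCA.
move=> dg; split.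
  by rewrite /derivable /=; under eq_fun do rewrite E.
by rewrite /derive /=; under [in LHS]eq_fun do rewrite E.
Qed.

Lemma mvt_bound (h h' : R -> R) (c : R) :
  (forall t : R, 0 <= t <= 1 -> is_derive t 1 h (h' t)) ->
  (forall t : R, 0 <= t <= 1 -> `|h' t| <= c) -> `|h 1 - h 0| <= c.
Proof.
move=> dh h'c.
have H1 (x : R) : x \in `]0, 1[ -> is_derive x 1 h (h' x).
  by rewrite in_itv /= => /andP[x0 x1]; apply: dh; rewrite !ltW.
have H2 : {within `[0, 1], continuous h}%classic.
  apply: continuous_subspace_itv => x; rewrite in_itv => /dh; exact: is_derive_continuous.
have [r r01 ->] := MVT (ltr01 : (0 : R) < 1) H1 H2.
rewrite subr0 mulr1; apply: h'c; move: r01; rewrite in_itv /= => /andP[? ?].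
by rewrite !ltW.
Qed.

(** A path from [x] to [y] parallel to the axes leaves the segment but stays in this box, where
    bounds in the max norm persist. *)
Definition in_box x y z :=
  forall i, exists2 s : R, 0 <= s <= 1 & z i 0 = x i 0 + s * (y i 0 - x i 0).

Lemma in_box_norm x y z B : `|x| <= B -> `|y| <= B -> in_box x y z -> `|z| <= B.
Proof.
move=> xB yB xyz; apply: norm_cV_le => [|i]; first exact: le_trans xB.
have [s /andP[s0 s1] ->] := xyz i.
have := le_trans (norm_coord x i) xB; have := le_trans (norm_coord y i) yB.
by rewrite !ler_norml => /andP[? ?] /andP[? ?]; apply/andP; split; nra.
Qed.

Lemma in_box_dist x y z : in_box x y z -> `|z - x| <= `|y - x|.
Proof.
move=> xyz; apply: norm_cV_le => // i; have [s /andP[s0 s1] zE] := xyz i.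
rewrite !mxE zE addrAC subrr add0r normrM ger0_norm //.
have := norm_coord (y - x) i; rewrite !mxE; apply: le_trans.
exact: ler_piMl.
Qed.

(** [C2] speaks of directional derivatives, so [y] is reached by changing one coordinate at a time,
    with the mean value theorem on each edge. [d = 0] gives a Lipschitz bound, and the partial
    derivatives at [x] give a Taylor bound. *)
Lemma coordinate_path g x y (d : 'I_N -> 'cV[R]_N) K :
  (forall z j, derivable g z (e j)) -> 0 <= K ->
  (forall z j, in_box x y z -> `|'D_(e j) g z - d j| <= K) ->
  `|g y - g x - \sum_j (y j 0 - x j 0) *: d j| <= N%:R * K * `|y - x|.
Proof.
move=> dg K0 dK.
pose z n : 'cV[R]_N := \col_i (if (i < n)%N then y i 0 else x i 0).
have z0 : z 0%N = x by apply/colP => i; rewrite mxE.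
have zN : z N = y by apply/colP => i; rewrite mxE ltn_ord.
pose S n := \sum_(j < N | (j < n)%N) (y j 0 - x j 0) *: d j.
have main n : (n <= N)%N -> `|g (z n) - g x - S n| <= n%:R * (K * `|y - x|).
  elim: n => [|n IH] nN.
    by rewrite z0 subrr sub0r /S big_pred0 // oppr0 normr0 mul0r.
  pose j := Ordinal nN; pose c := y j 0 - x j 0.
  have zS : z n.+1 = z n + c *: e j.
    apply/colP => i; rewrite !mxE eqxx andbT ltnS leq_eqVlt.
    have [->|ij] := eqVneq i j; first by rewrite /= eqxx ltnn /= mulr1 /c addrC subrK.
    have -> : (nat_of_ord i == n) = false by apply/negbTE; exact: ij.
    by rewrite /= mulr0 addr0.
  have SS : S n.+1 = S n + c *: d j.
    rewrite /S [LHS](bigD1 j) /=; last exact: ltnSn.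
    rewrite addrC; congr (_ + _); apply: eq_bigl => i.
    rewrite ltnS [(i <= n)%N]leq_eqVlt andbC.
    have [->|ij] := eqVneq i j; first by rewrite /= ltnn.
    by have -> : (nat_of_ord i == n) = false by apply/negbTE; exact: ij.
  have box (t : R) : 0 <= t <= 1 -> in_box x y (z n + (c * t) *: e j).
    move=> t01 i; rewrite !mxE eqxx andbT.
    have [->|ij] := eqVneq i j.
      by exists t => //; rewrite /= ltnn mulr1 mulrC.
    rewrite mulr0 addr0; case: ifP => _.
      by exists 1; rewrite ?lexx ?ler01 // mul1r addrC subrK.
    by exists 0; rewrite ?lexx ?ler01 // mul0r addr0.
  have cxy : `|c| <= `|y - x| by have := norm_coord (y - x) j; rewrite !mxE.
  have step : `|g (z n.+1) - g (z n) - c *: d j| <= K * `|y - x|.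
    apply: norm_cV_le => [|i]; first exact: mulr_ge0.
    pose h t := g (z n + (c * t) *: e j) i 0 - c * t * d j i 0.
    have dh (t : R) : 0 <= t <= 1 -> is_derive t 1 h
        (('D_(e j) g (z n + (c * t) *: e j) - d j) i 0 * c).
      move=> t01; have := is_derive_line (dg (z n + (c * t) *: e j) j).
      move=> /is_derive_coord/(_ i 0) dl.
      have dc : is_derive t 1 (fun s : R => c * s) c.
        by deriv; rewrite addr0.
      have := is_derive_compf dl dc => dgl; rewrite /h; deriv.
      by rewrite !mxE; ring.
    have := mvt_bound dh (c := K * `|y - x|).
    rewrite /h !mulr1 !mulr0 scale0r addr0 mul0r subr0 -zS !mxE => H.
    have -> : g (z n.+1) i 0 - g (z n) i 0 - c * d j i 0 =
      g (z n.+1) i 0 - c * d j i 0 - g (z n) i 0 by ring.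
    apply: H => t t01; have := dK _ j (box t t01) => dKt.
    have := norm_coord ('D_(e j) g (z n + (c * t) *: e j) - d j) i; rewrite !mxE => dd.
    by rewrite normrM ler_pM // (le_trans dd).
  have -> : g (z n.+1) - g x - S n.+1 =
     (g (z n) - g x - S n) + (g (z n.+1) - g (z n) - c *: d j).
    rewrite SS; move: (g (z n.+1)) (g (z n)) (g x) (S n) (c *: d j) => a b p q r.
    by apply/colP => i; rewrite !mxE; ring.
  apply: le_trans (ler_normD _ _) _; rewrite -natr1 mulrDl mul1r.
  by apply: lerD => //; exact: IH (ltnW nN).
have := main N (leqnn N); rewrite zN mulrA.
by rewrite /S (eq_bigl xpredT) // => j; rewrite ltn_ord.
Qed.

(** Carries the compactness of closed balls from row vectors to column vectors. *)
Lemma trmx_continuous m n : continuous (fun A : 'M[R]_(m, n) => A^T).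
Proof.
move=> A P [S nS SP]; exists (fun j i => S i j) => [j i|B BS].
  by have := nS i j; rewrite mxE.
by apply: SP => i j; rewrite mxE.
Qed.

Lemma coordinate_path_lipschitz g x y K :
  (forall z j, derivable g z (e j)) -> 0 <= K ->
  (forall z j, in_box x y z -> `|'D_(e j) g z| <= K) ->
  `|g y - g x| <= N%:R * K * `|y - x|.
Proof.
move=> dg K0 dK; rewrite -[g y - g x]subr0.
have {1}<- : \sum_j (y j 0 - x j 0) *: (0 : 'cV[R]_N) = 0.
  by apply: big1 => j _; exact: scaler0.
by apply: coordinate_path => // z j zb; rewrite subr0 dK.
Qed.

Lemma ball_bound g B : continuous g -> exists K, 0 <= K /\
  forall x, `|x| <= B -> `|g x| <= K.
Proof.
move=> cg; pose A := closed_ball (0 : 'rV[R]_N) (`|B| + 1).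
have B1 : 0 < `|B| + 1 by rewrite ltr_wpDl.
have cA : compact A.
  apply: bounded_closed_compact; last exact: closed_ball_closed.
  exists (`|B| + 1); split=> [|M BM r]; first exact: num_real.
  rewrite /A closed_ballE // /closed_ball_ /= sub0r normrN => /le_trans; apply.
  exact: ltW.
have ct : {within A, continuous (fun r : 'rV[R]_N => g r^T)}%classic.
  apply: continuous_subspaceT => r; apply: continuous_comp; last exact: cg.
  exact: trmx_continuous.
have /ex_strict_bound_gt0[K K0 HK] := compact_bounded (continuous_compact ct cA).
exists K; split=> [|x xB]; first exact: ltW.
apply: ltW; apply: HK; exists x^T; last by rewrite trmxK.
rewrite /A closed_ballE // /closed_ball_ /= sub0r normrN.
apply: (@le_trans _ _ `|x|); last first.
  by rewrite (le_trans xB) // (le_trans (ler_norm _)) // lerDl.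
rewrite [leLHS]/Num.norm /= mx_normrE.
by apply: bigmax_le => // -[i j] _ /=; rewrite mxE ord1 norm_coord.
Qed.

(** Bounded second derivatives make the partial derivatives Lipschitz on the ball; in
    [coordinate_path] they then differ from their values at [x] by at most a multiple of [|y - x|],
    whence the square. *)
Lemma C2_bounds f B : C2 f -> exists K, [/\ 0 <= K,
  forall x y, `|x| <= B -> `|y| <= B -> `|f y - f x| <= K * `|y - x|,
  forall x, `|x| <= B -> `|jacobian f x| <= K &
  forall x y, `|x| <= B -> `|y| <= B ->
    `|f y - f x - jacobian f x *m (y - x)| <= K * `|y - x| ^+ 2].
Proof.
move=> [df ddf cddf].
have [K2 HK2] : exists K, 0 <= K /\ forall x j k, `|x| <= B ->
    `|'D_(e k) ('D_(e j) f) x| <= K.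
  have [K HK] := fin_all_exists (fun jk : 'I_N * 'I_N =>
    ball_bound B (cddf (e jk.2) (e jk.1))).
  have K0 jk : 0 <= K jk by case: (HK jk).
  exists (\sum_jk K jk); split=> [|x j k xB]; first exact: sumr_ge0.
  have [_ /(_ x xB)] := HK (j, k); move=> /le_trans; apply.
  by rewrite [leRHS](bigD1 (j, k)) //= lerDl sumr_ge0.
have [K20 {}HK2] := HK2.
have lipD j x y : `|x| <= B -> `|y| <= B ->
    `|'D_(e j) f y - 'D_(e j) f x| <= N%:R * K2 * `|y - x|.
  move=> xB yB; apply: (@coordinate_path_lipschitz ('D_(e j) f) x y K2) => [z k||z k zb].
  - exact: ddf.
  - exact: K20.
  - by apply: HK2; exact: in_box_norm zb.
have [K1 HK1] : exists K, 0 <= K /\ forall x j, `|x| <= B -> `|'D_(e j) f x| <= K.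
  exists (\sum_j `|'D_(e j) f 0| + N%:R * K2 * `|B|); split=> [|x j xB].
    by rewrite addr_ge0 ?sumr_ge0 // mulr_ge0 // mulr_ge0.
  have B0 : 0 <= B by exact: le_trans xB.
  have z0 : `|0 : 'cV[R]_N| <= B by rewrite normr0.
  have := lipD j 0 x z0 xB; rewrite subr0 => h.
  have -> : 'D_(e j) f x = 'D_(e j) f 0 + ('D_(e j) f x - 'D_(e j) f 0).
    by rewrite addrC subrK.
  apply: le_trans (ler_normD _ _) _; apply: lerD.
    by rewrite [leRHS](bigD1 j) //= lerDl sumr_ge0.
  by rewrite (le_trans h) // ger0_norm // ler_wpM2l // mulr_ge0.
have [K10 {}HK1] := HK1.
have NK1 : 0 <= N%:R * K1 by rewrite mulr_ge0.
have NK2 : 0 <= N%:R * (N%:R * K2) by rewrite !mulr_ge0.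
exists (N%:R * K1 + N%:R * (N%:R * K2) + K1); split.
- by rewrite !addr_ge0.
- move=> x y xB yB; apply: (@le_trans _ _ (N%:R * K1 * `|y - x|)).
    apply: (@coordinate_path_lipschitz f x y K1) => [z k||z k zb].
    + exact: df.
    + exact: K10.
    + by apply: HK1; exact: in_box_norm zb.
  by rewrite ler_wpM2r // -addrA lerDl addr_ge0.
- move=> x xB; apply: (@le_trans _ _ K1); last by rewrite lerDr addr_ge0.
  rewrite [leLHS]/Num.norm /= mx_normrE.
  apply: bigmax_le => [|[i j] _] //=; rewrite mxE.
  by rewrite (le_trans (norm_coord _ i)) // HK1.
- move=> x y xB yB.
  have := @coordinate_path f x y (fun j => 'D_(e j) f x) (N%:R * K2 * `|y - x|).
  have -> : \sum_j (y j 0 - x j 0) *: 'D_(e j) f x = jacobian f x *m (y - x).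
    apply/colP => i; rewrite summxE mxE; apply: eq_bigr => j _.
    by rewrite !mxE mulrC.
  move=> H; apply: le_trans (H _ _ _) _ => [z j||z j zb|].
  + exact: df.
  + by rewrite !mulr_ge0.
  + apply: le_trans (lipD j x z xB (in_box_norm xB yB zb)) _.
    by rewrite ler_wpM2l ?mulr_ge0 // in_box_dist.
  + rewrite mulrA -mulrA -expr2 mulrA ler_wpM2r ?sqr_ge0 //.
    by rewrite [leRHS]addrAC -mulrA lerDr addr_ge0.
Qed.

End Taylor.

(** * The periodic orbit and its fundamental solution *)

Section MatrixCalculus.
Context {R : realType}.
Implicit Types (a b s t c k : R).

Lemma segment_bound (V : normedModType R) (F : R -> V) a b : continuous F ->
  exists K, 0 <= K /\ forall t, a <= t <= b -> `|F t| <= K.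
Proof.
move=> cF.
have cI := continuous_compact (continuous_subspaceT cF) (@segment_compact R a b).
have /ex_strict_bound_gt0[K K0 HK] := compact_bounded cI.
exists K; split=> [|t tab]; first exact: ltW.
by apply: ltW; apply: HK; exists t; rewrite //= in_itv.
Qed.

Lemma derivable_prod (I : Type) (r : seq I) (F : I -> R -> R) t :
  (forall i, derivable (F i) t 1) ->
  derivable (fun s : R => \prod_(i <- r) F i s) t 1.
Proof.
move=> dF; elim: r => [|i r IH].
  rewrite (_ : (fun s => _) = fun=> 1); first exact: derivable_cst.
  by apply/funext => s; rewrite big_nil.
rewrite (_ : (fun s => _) = fun s => F i s * \prod_(j <- r) F j s).
  exact: derivableM.
by apply/funext => s; rewrite big_cons.
Qed.

Lemma derivable_bigsum (I : Type) (r : seq I) (F : I -> R -> R) t :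
  (forall i, derivable (F i) t 1) ->
  derivable (fun s : R => \sum_(i <- r) F i s) t 1.
Proof.
move=> dF; have H i : is_derive t 1 (F i) ('D_1 (F i) t) by exact: derivableP.
by have [] := is_derive_sumf r H.
Qed.

Lemma derivable_det n (F : R -> 'M[R]_n) t :
  (forall i j, derivable (fun s : R => F s i j) t 1) ->
  derivable (fun s : R => \det (F s)) t 1.
Proof.
move=> dF; apply: derivable_bigsum => sg; apply: derivableM; first exact: derivable_cst.
by apply: derivable_prod => i; exact: dF.
Qed.

(** The cofactor formula gives differentiability, and differentiating [F^-1 F = 1] gives the
    value. *)
Lemma is_derive_invmx n (F : R -> 'M[R]_n) t d : (forall s, F s \in unitmx) ->
  is_derive t 1 F d ->
  is_derive t 1 (fun s => invmx (F s)) (- (invmx (F t) *m d *m invmx (F t))).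
Proof.
move=> Fu dF; have dFij i j : derivable (fun s : R => F s i j) t 1.
  by have /is_derive_coord/(_ i j)[] := dF.
have dI : derivable (fun s => invmx (F s)) t 1.
  apply/derivable_mxP => i j.
  rewrite (_ : (fun s => _) = fun s => (\det (F s))^-1 * cofactor (F s) j i); last first.
    by apply/funext => s; rewrite /invmx Fu !mxE.
  apply: derivableM.
    apply: derivableV; last exact: derivable_det.
    by have := Fu t; rewrite unitmxE unitfE.
  apply: derivableM; first exact: derivable_cst.
  apply: derivable_det => k l.
  rewrite (_ : (fun s => _) = fun s => F s (lift j k) (lift i l)); first exact: dFij.
  by apply/funext => s; rewrite !mxE.
have dI' := derivableP dI; set D := 'D_1 _ t in dI'.
have := is_derive_mulmx dI' dF.
rewrite (_ : (fun s => _) = fun=> 1%:M); last first.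
  by apply/funext => s; rewrite mulVmx.
move=> [_]; rewrite derive_cst => E.
suff -> : - (invmx (F t) *m d *m invmx (F t)) = D by [].
rewrite -[RHS]mulmx1 -(mulmxV (Fu t)) mulmxA -mulNmx; congr (_ *m _).
by apply/eqP; rewrite eq_sym -addr_eq0; apply/eqP.
Qed.

Lemma unitmx_ker0 n (A : 'M[R]_n) : (forall v : 'cV[R]_n, A *m v = 0 -> v = 0) ->
  A \in unitmx.
Proof.
move=> A0; rewrite -unitmx_tr -row_free_unit; apply: inj_row_free => v vA.
by apply: trmx_inj; rewrite trmx0; apply: A0; rewrite -[A]trmxK -trmx_mul vA trmx0.
Qed.

Lemma mulmx_norm_le2 n (A : 'M[R]_n) (v : 'cV[R]_n) K c :
  `|A| <= K -> `|v| <= c -> `|A *m v| <= n%:R * K * c.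
Proof.
move=> AK vc; apply: (le_trans (mulmx_norm_le _ _)).
by apply: ler_pM => //; rewrite ler_wpM2l.
Qed.

(** The Euclidean norm is preserved, the max norm only up to [sqrt n], here rounded up to an integer
    that is at least 1. *)
Lemma orthogonal_norm n (A : 'M[R]_n) (v : 'cV[R]_n) : A^T *m A = 1%:M ->
  `|A *m v| <= n.+1%:R * `|v|.
Proof.
move=> AA; rewrite -(ler_pXn2r (n := 2)) ?nnegrE ?mulr_ge0 //.
apply: (le_trans (norm_le_sqnorm _)).
have sq (z : 'cV[R]_n) : (z^T *m z) 0 0 = \sum_i z i 0 ^+ 2.
  by rewrite mxE; apply: eq_bigr => i _; rewrite mxE expr2.
rewrite -sq trmx_mul -mulmxA (mulmxA A^T) AA mul1mx sq.
apply: (le_trans (sqnorm_le_norm _)); rewrite exprMn ler_wpM2r ?sqr_ge0 //.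
by rewrite -natrX ler_nat expnS expn1 (leq_trans (leqnSn n)) // leq_pmulr.
Qed.

End MatrixCalculus.

(** * The chain rule for [C2] maps along curves *)

Section ChainRule.
Context {R : realType}.

Lemma is_deriveP (V : normedModType R) (u : R -> V) (t : R) (d : V) :
  is_derive t 1 u d <-> forall eps : R, 0 < eps -> exists2 del : R, 0 < del &
    forall k : R, `|k| < del -> `|u (t + k) - u t - k *: d| <= eps * `|k|.
Proof.
split=> [[du duE] eps eps0|H].
  have : (k^-1 *: (u (k *: (1 : R) + t) - u t) @[k --> (0 : R)^'] --> d)%classic.
    by rewrite -duE.
  move=> /cvgrPdist_le/(_ eps eps0)[del /= del0 Hd]; exists del => // k kd.
  have [->|k0] := eqVneq k 0; first by rewrite addr0 subrr scale0r subrr !normr0 mulr0.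
  have := Hd k; rewrite /ball /= sub0r normrN => /(_ kd k0).
  rewrite [k *: 1]mulr1 [k + t]addrC => Hk.
  have kn0 : 0 < `|k| by rewrite normr_gt0.
  rewrite mulrC -ler_pdivrMl // -normfV -normrZ scalerBr scalerA mulVf // scale1r.
  by rewrite distrC.
have C : (k^-1 *: (u (k *: (1 : R) + t) - u t) @[k --> (0 : R)^'] --> d)%classic.
  apply/cvgrPdist_le => eps eps0; have [del del0 Hd] := H eps eps0.
  exists del => //= k; rewrite /ball /= sub0r normrN => kd k0.
  rewrite [k *: 1]mulr1 [k + t]addrC distrC.
  have kn0 : 0 < `|k| by rewrite normr_gt0.
  have := Hd k kd; rewrite mulrC -ler_pdivrMl // -normfV -normrZ.
  by rewrite scalerBr scalerA mulVf // scale1r.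
split; first by apply/cvg_ex; exists d.
exact: cvg_lim C.
Qed.

Lemma C2_chain N (f : 'cV[R]_N -> 'cV[R]_N) (u : R -> 'cV[R]_N) (t : R) d :
  C2 f -> is_derive t 1 u d ->
  is_derive t 1 (fun s => f (u s)) (jacobian f (u t) *m d).
Proof.
move=> fC2 /is_deriveP du; apply/is_deriveP => eps eps0.
have [K [K0 _ JK fK]] := C2_bounds (`|u t| + 1) fC2.
have NK : 0 <= N%:R * K by rewrite mulr_ge0.
have d1 : 0 < `|d| + 1 by rewrite ltr_wpDl.
(* The cap 1 yields [|a - x| <= (|d| + 1) * |k|]; the other entry leaves [eps / 2] for the linear
   part. *)
pose eps1 := Num.min 1 (eps / (2 * (N%:R * K + 1))).
have e10 : 0 < eps1 by rewrite lt_min ltr01 divr_gt0 // mulr_gt0 // ltr_wpDl.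
have [del1 del10 Hd] := du eps1 e10.
pose K2 := K * (`|d| + 1) ^+ 2.
have K20 : 0 <= K2 by rewrite mulr_ge0 // sqr_ge0.
exists (Num.min del1 (Num.min (`|d| + 1)^-1 (eps / (2 * (K2 + 1))))).
  by rewrite !lt_min del10 invr_gt0 d1 divr_gt0 // mulr_gt0 // ltr_wpDl.
move=> k; rewrite !lt_min => /and3P[kd kd1 kd2].
have := Hd k kd; set a := u (t + k); set x := u t => axd.
have e11 : eps1 <= 1 by rewrite ge_min lexx.
have ax : `|a - x| <= (`|d| + 1) * `|k|.
  have -> : a - x = (a - x - k *: d) + k *: d by rewrite subrK.
  apply: (le_trans (ler_normD _ _)); rewrite normrZ.
  have := ler_wpM2r (normr_ge0 k) e11; lra.
have ax1 : `|a - x| <= 1.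
  by apply: (le_trans ax); rewrite mulrC -ler_pdivlMr // div1r ltW.
have xB : `|x| <= `|u t| + 1 by rewrite lerDl.
have aB : `|a| <= `|u t| + 1.
  by rewrite -[a](subrK x) addrC (le_trans (ler_normD _ _)) // lerD.
have -> : f a - f x - k *: (jacobian f x *m d) =
   (f a - f x - jacobian f x *m (a - x)) + jacobian f x *m (a - x - k *: d).
  by rewrite (mulmxBr _ (a - x)) -scalemxAr addrA subrK.
apply: (le_trans (ler_normD _ _)).
have h1 := fK x a xB aB.
have h2 : `|jacobian f x *m (a - x - k *: d)| <= N%:R * K * (eps1 * `|k|).
  by apply: mulmx_norm_le2 => //; exact: JK.
have h3 : K * `|a - x| ^+ 2 <= K2 * `|k| * `|k|.
  by rewrite /K2 -!mulrA ler_wpM2l // mulrA -expr2 -exprMn ler_pXn2r ?nnegrE.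
have h4 : N%:R * K * eps1 <= eps / 2.
  have : eps1 <= eps / (2 * (N%:R * K + 1)) by rewrite ge_min lexx orbT.
  rewrite ler_pdivlMr; last by rewrite mulr_gt0 // ltr_wpDl.
  by have := ltW e10; rewrite ler_pdivlMr //; nra.
have h5 : K2 * `|k| <= eps / 2.
  move: kd2; rewrite ltr_pdivlMr; last by rewrite mulr_gt0 // ltr_wpDl.
  by have := normr_ge0 k; rewrite ler_pdivlMr //; lra.
have := ler_wpM2r (normr_ge0 k) h4; have := ler_wpM2r (normr_ge0 k) h5.
by move: h1 h2 h3; lra.
Qed.

End ChainRule.

(** * Orbit, variational equation and the action of [h] *)

Section Orbit.
Context {R : realType} {N : nat} (f : 'cV[R]_N -> 'cV[R]_N) (xs : R -> 'cV[R]_N).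
Hypotheses (fC2 : C2 f) (ode : ode_solution f xs).
Implicit Types (s t : R).

Lemma ode_continuous : continuous xs.
Proof. by move=> t; apply: is_derive_continuous (ode t). Qed.

Lemma periodic_bounded (p : R) : 0 < p -> (forall t, xs (t + p) = xs t) ->
  exists B, forall t, `|xs t| <= B.
Proof.
move=> p0 per; have [B [_ HB]] := segment_bound 0 p ode_continuous.
have pern n t : xs (t + p *+ n) = xs t.
  by elim: n => [|n IH]; rewrite ?addr0 // mulrS addrCA addrC per.
exists B => t; pose k := Num.floor (t / p).
pose s := t - p * k%:~R.
have s01 : 0 <= s <= p.
  have /andP[k1 k2] := floor_itv (t / p); apply/andP; split.
    by rewrite subr_ge0 mulrC -ler_pdivlMr.
  move: k2; rewrite ltr_pdivrMr // intrD mulrDl mul1r => k2.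
  by rewrite /s lerBlDr addrC mulrC ltW.
have <- : xs s = xs t; last exact: HB.
rewrite /s; case: (k) => n.
  by rewrite -[LHS](pern n) -[p *+ n]mulr_natr subrK.
rewrite NegzE mulrNz mulrN opprK -(pern n.+1 t); congr (xs (_ + _)).
by rewrite mulr_natr.
Qed.

Lemma ode_solution_unique (x y : R -> 'cV[R]_N) B t0 :
  ode_solution f x -> ode_solution f y -> (forall t, `|x t| <= B) ->
  (forall t, `|y t| <= B) -> x t0 = y t0 -> forall t, x t = y t.
Proof.
move=> ox oy xB yB xy t; have [K [_ fK _ _]] := C2_bounds B fC2.
apply/eqP; rewrite -subr_eq0; apply/eqP.
apply: (@ode_unique _ _ (fun t => x t - y t) (fun t => f (x t) - f (y t)) K t0).
- by move=> s; exact: is_deriveB (ox s) (oy s).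
- by move=> s; exact: fK.
- by rewrite xy subrr.
Qed.

Variable B : R.
Hypothesis xsB : forall t, `|xs t| <= B.

Lemma linear_unique (u : R -> 'cV[R]_N) (c t0 : R) :
  (forall t, is_derive t 1 u (jacobian f (xs (c + t)) *m u t)) -> u t0 = 0 ->
  forall t, u t = 0.
Proof.
move=> du; have [K [K0 _ JK _]] := C2_bounds B fC2.
apply: (@ode_unique _ _ u _ (N%:R * K) t0 du) => t.
by rewrite (le_trans (mulmx_norm_le _ _)) // ler_wpM2r // ler_wpM2l // JK.
Qed.

Variable Y : R -> 'M[R]_N.
Hypothesis fundY : fundamental_solution f xs Y.

Let dYv (v : 'cV[R]_N) t : is_derive t 1 (fun s => Y s *m v) (jacobian f (xs t) *m (Y t *m v)).
Proof.
have [_ dY] := fundY; have := is_derive_mulmx (dY t) (is_derive_cst v t 1).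
by rewrite mulmx0 addr0 mulmxA.
Qed.

Lemma fundamental_continuous : continuous Y.
Proof. by move=> t; have [_ dY] := fundY; apply: is_derive_continuous (dY t). Qed.

Lemma fundamental_unit t : Y t \in unitmx.
Proof.
apply: unitmx_ker0 => v Yv0; have [Y0 _] := fundY.
have := @linear_unique (fun s => Y s *m v) 0 t.
move=> /(_ _ Yv0 0); rewrite Y0 mul1mx; apply => s; rewrite add0r; exact: dYv.
Qed.

(** By the chain rule the velocity solves the variational equation, and the two sides agree at 0. *)
Lemma velocity_fundamental t : f (xs t) = Y t *m f (xs 0).
Proof.
have [Y0 _] := fundY; apply/eqP; rewrite -subr_eq0; apply/eqP.
apply: (@linear_unique (fun s => f (xs s) - Y s *m f (xs 0)) 0 0).
- move=> s; rewrite add0r mulmxBr; exact: is_deriveB (C2_chain fC2 (ode s)) (dYv _ s).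
- by rewrite Y0 mul1mx subrr.
Qed.

Lemma velocity_neq0 (p : R) : minimal_period xs p -> f (xs 0) != 0.
Proof.
move=> [p0 per minp]; apply/eqP => f0.
have p2 : 0 < p / 2 < p by rewrite divr_gt0 //=; lra.
have [t] := minp _ p2; apply.
have cst t' : xs t' = xs 0.
  apply: (@ode_solution_unique xs (fun=> xs 0) B 0) => // [s].
  rewrite f0; exact: is_derive_cst.
by rewrite !cst.
Qed.

Variables (h : 'M[R]_N) (th : R).
Hypotheses (fh : forall x, f (h *m x) = h *m f x) (hh : h^T *m h = 1%:M)
  (hth : h *m xs 0 = xs th).

Lemma orthogonal_unit : h \in unitmx.
Proof. by have [] := mulmx1_unit hh. Qed.

Lemma symmetry_shift t : h *m xs t = xs (th + t).
Proof.
have B0 : 0 <= B by exact: le_trans (xsB 0).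
have leB t' : `|xs t'| <= N.+1%:R * B.
  by rewrite (le_trans (xsB t')) // ler_peMl // ler1n.
apply: (@ode_solution_unique (fun s => h *m xs s) (fun s => xs (th + s))
  (N.+1%:R * B) 0).
- by move=> s; rewrite /= fh; exact: is_derive_cst_mulmx (ode s).
- by move=> s; exact: is_derive_shiftl (ode (th + s)).
- by move=> s; rewrite (le_trans (orthogonal_norm _ hh)) // ler_wpM2l.
- by move=> s; exact: leB.
- by rewrite addr0.
Qed.

(** Derivative at [s = 0] of [f (h (x + s v)) = h f (x + s v)]. *)
Lemma jacobian_equivariant x (v : 'cV[R]_N) :
  jacobian f (h *m x) *m (h *m v) = h *m (jacobian f x *m v).
Proof.
have dl : is_derive (0 : R) 1 (fun s : R => x + s *: v) v.
  apply/is_derive_coord => i j.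
  rewrite (_ : (fun s => _) = fun s => x i j + s * v i j); last first.
    by apply/funext => s; rewrite !mxE.
  by deriv; ring.
have := C2_chain fC2 dl; rewrite scale0r addr0 => /(is_derive_cst_mulmx h) [_ <-].
have := C2_chain fC2 (is_derive_cst_mulmx h dl); rewrite scale0r addr0 => -[_ <-].
by under [in LHS]eq_fun do rewrite fh.
Qed.

(** Applied to a fixed vector, both sides solve the variational equation along
    [xs (th + t) = h *m xs t] and agree at [t = 0]. *)
Lemma fundamental_shift t : Y (th + t) = h *m Y t *m (invmx h *m Y th).
Proof.
have [Y0 _] := fundY; set M := invmx h *m Y th.
suff H (v : 'cV[R]_N) : Y (th + t) *m v = h *m Y t *m M *m v.
  move: (h *m Y t *m M) H => Z H; apply/matrixP => i j.
  by have := H (delta_mx j 0); rewrite -!colE => /colP/(_ i); rewrite !mxE.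
apply/eqP; rewrite -subr_eq0; apply/eqP.
apply: (@linear_unique (fun s => Y (th + s) *m v - h *m Y s *m M *m v) th 0).
- move=> s; rewrite mulmxBr.
  apply: is_deriveB; first exact: is_derive_shiftl (dYv v (th + s)).
  have -> : (fun s => h *m Y s *m M *m v) = (fun s => h *m (Y s *m (M *m v))).
    by apply/funext => r; rewrite !mulmxA.
  rewrite -symmetry_shift -!mulmxA jacobian_equivariant.
  exact: is_derive_cst_mulmx (dYv _ s).
- by rewrite addr0 Y0 mulmx1 /M mulmxA mulmxV ?orthogonal_unit // mul1mx subrr.
Qed.

End Orbit.

(** * The nonlinear cell problem *)

Section MatrixContinuity.
Context {R : realType}.

Lemma mx_continuous m n (F : R -> 'M[R]_(m, n)) :
  (forall i j, continuous (fun s : R => F s i j)) -> continuous F.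
Proof.
move=> cF t P [S nS SP].
apply: (@filterS _ _ _ (fun s => forall i j, S i j (F s i j))) => [s Ss|].
  exact: SP.
have H i j : nbhs t (fun s => S i j (F s i j)) by exact: (cF i j t _ (nS i j)).
have H' i : nbhs t (fun s => forall j, S i j (F s i j)).
  exact: (@filter_forall R 'I_n (fun j s => S i j (F s i j)) (nbhs t) _ (H i)).
exact: (@filter_forall R 'I_m (fun i s => forall j, S i j (F s i j)) (nbhs t) _ H').
Qed.

Lemma continuous_mulmx m n q (F : R -> 'M[R]_(m, n)) (H : R -> 'M[R]_(n, q)) :
  continuous F -> continuous H -> continuous (fun s => F s *m H s).
Proof.
move=> cF cH; apply: mx_continuous => i j.
rewrite (_ : (fun s => _) = fun s => \sum_k F s i k * H s k j); last first.
  by apply/funext => s; rewrite mxE.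
by apply: sum_continuous => k t; apply: cvgM; exact: entry_continuous.
Qed.

End MatrixContinuity.

Section NonlinearCells.
Context {R : realType} {N : nat} (f : 'cV[R]_N -> 'cV[R]_N) (xs : R -> 'cV[R]_N)
  (h : 'M[R]_N) (th b B : R).
Hypotheses (fC2 : C2 f) (ode : ode_solution f xs) (xsB : forall t, `|xs t| <= B)
  (fh : forall x, f (h *m x) = h *m f x) (hh : h^T *m h = 1%:M)
  (hth : h *m xs 0 = xs th) (th_gt0 : 0 < th) (b_lt0 : b < 0).
Implicit Types (s t psi alpha A : R) (u : nat -> R -> 'cV[R]_N).

Let hu : h \in unitmx. Proof. exact: orthogonal_unit hh. Qed.

Lemma invmx_orthogonal : invmx h = h^T.
Proof. by rewrite -[LHS]mul1mx -hh -mulmxA mulmxV // mulmx1. Qed.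

Lemma invmx_orthogonal_norm (v : 'cV[R]_N) : `|invmx h *m v| <= N.+1%:R * `|v|.
Proof.
by apply: orthogonal_norm; rewrite invmx_orthogonal trmxK; apply: mulmx1C.
Qed.

Lemma invmx_shift t : invmx h *m xs (th + t) = xs t.
Proof. by rewrite -(symmetry_shift fC2 ode xsB fh hh hth) mulmxA mulVmx // mul1mx. Qed.

Lemma orbit_taylor : exists K, 0 <= K /\ forall t alpha,
  `|xs (t + alpha) - xs t| <= K * `|alpha| /\
  `|xs (t + alpha) - xs t - alpha *: f (xs t)| <= K * alpha ^+ 2.
Proof.
have B0 : 0 <= B by exact: le_trans (xsB 0).
have [K [K0 fK _ _]] := C2_bounds B fC2.
have [F [F0 HF]] : exists F, 0 <= F /\ forall t, `|f (xs t)| <= F.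
  exists (`|f (xs 0)| + K * (B + B)); split=> [|t].
    by rewrite addr_ge0 // mulr_ge0 // addr_ge0.
  rewrite -[f (xs t)](subrK (f (xs 0))) addrC.
  apply: (le_trans (ler_normD _ _)); rewrite lerD2l.
  apply: (le_trans (fK _ _ (xsB 0) (xsB t))); rewrite ler_wpM2l //.
  by apply: (le_trans (ler_normB _ _)); apply: lerD.
have dg t alpha i (r : R) :
    is_derive r 1 (fun r : R => xs (t + r * alpha) i 0) (f (xs (t + r * alpha)) i 0 * alpha).
  have /is_derive_coord/(_ i 0) dx := ode (t + r * alpha).
  have dl : is_derive r 1 (fun r : R => t + r * alpha) alpha by deriv; ring.
  exact: (@is_derive_compf _ r (fun s => xs s i 0) (fun r : R => t + r * alpha) _ _ dx dl).
have lip t alpha : `|xs (t + alpha) - xs t| <= F * `|alpha|.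
  apply: norm_cV_le => [|i]; first exact: mulr_ge0.
  have := mvt_bound (c := F * `|alpha|) (fun r _ => dg t alpha i r).
  rewrite !mul1r mul0r addr0 !mxE; apply=> r _.
  by rewrite normrM ler_wpM2r // (le_trans (norm_coord _ i)).
exists (F + K * F); split=> [|t alpha]; first by rewrite addr_ge0 // mulr_ge0.
split; first by rewrite (le_trans (lip _ _)) // ler_wpM2r // lerDl mulr_ge0.
apply: (@le_trans _ _ (K * F * alpha ^+ 2)); last first.
  by rewrite ler_wpM2r ?sqr_ge0 // lerDr.
apply: norm_cV_le => [|i]; first by rewrite mulr_ge0 ?sqr_ge0 // mulr_ge0.
pose g r := xs (t + r * alpha) i 0 - r * (alpha * f (xs t) i 0).
have dg' (r : R) : 0 <= r <= 1 ->
    is_derive r 1 g ((f (xs (t + r * alpha)) - f (xs t)) i 0 * alpha).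
  by move=> _; have := dg t alpha i r => d; rewrite /g; deriv; rewrite !mxE; ring.
have := mvt_bound (c := K * F * alpha ^+ 2) dg'.
rewrite /g !mul1r !mul0r addr0 subr0 !mxE => H.
rewrite addrAC; apply: H => r /andP[r0 r1].
rewrite normrM -real_normK ?num_real // expr2 mulrA ler_wpM2r //.
apply: (le_trans (norm_coord _ i)); apply: (le_trans (fK _ _ (xsB _) (xsB _))).
rewrite -mulrA ler_wpM2l // (le_trans (lip _ _)) // ler_wpM2l // normrM.
by rewrite ger0_norm // ler_piMl.
Qed.

(** [tau] is [th] except for the last cell, which may be cut short. *)
Definition cell_ode (u0 u1 : R -> 'cV[R]_N) tau :=
  [/\ continuous u0, continuous u1,
      forall s, 0 < s < tau -> is_derive s 1 u1 (f (u1 s) + b *: (u1 s - u0 s)) &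
      u1 0 = invmx h *m u0 th].

(** Gronwall for the sum of squares of [y = u1 - xs]. The Lipschitz constant is at hand only while
    [|y| < 1]; [first_exit] closes this circle, since [A <= rho] makes the resulting bound [G * A]
    less than 1. *)
Lemma step_growth : exists G rho, [/\ 1 <= G, 0 < rho &
  forall (u0 u1 : R -> 'cV[R]_N) tau psi A, 0 <= tau <= th -> cell_ode u0 u1 tau -> 0 <= A <= rho ->
  (forall s, 0 <= s <= th -> `|u0 s - xs (psi + s)| <= A) ->
  forall s, 0 <= s <= tau -> `|u1 s - xs (psi + s)| <= G * A].
Proof.
have B0 : 0 <= B by exact: le_trans (xsB 0).
have [K [K0 fK _ _]] := C2_bounds (B + 1) fC2.
pose beta := - b; have beta0 : 0 < beta by rewrite oppr_gt0.
pose c := N%:R * (2 * K + 3 * beta).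
have c0 : 0 <= c by rewrite mulr_ge0 // addr_ge0 ?mulr_ge0 // ltW.
pose G := expR (c * th) * N.+2%:R ^+ 2.
have e1 : 1 <= expR (c * th) by rewrite -expR0 ler_expR mulr_ge0 // ltW.
have G1 : 1 <= G.
  by rewrite -[1]mulr1 ler_pM // -natrX ler1n expn_gt0.
have G0 : 0 < G by exact: lt_le_trans G1.
exists G, (2 * G)^-1; split=> //; first by rewrite invr_gt0 mulr_gt0.
move=> u0 u1 tau psi A /andP[tau0 tauth] [cu0 cu1 du1 j1] /andP[A0 Arho] u0A.
pose y s := u1 s - xs (psi + s).
have cy : continuous y.
  move=> s; apply: cvgB; first exact: cu1.
  apply: (@is_derive_continuous _ _ (fun s => xs (psi + s)) s (f (xs (psi + s)))).
  exact: is_derive_shiftl (ode _).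
have th_in : 0 <= th <= th by rewrite lexx ltW.
have y0A : `|y 0| <= N.+1%:R * A.
  rewrite /y j1 addr0 -(invmx_shift psi) -mulmxBr (le_trans (invmx_orthogonal_norm _)) //.
  by rewrite ler_wpM2l // [th + psi]addrC u0A.
have GA : G * A < 1.
  apply: (@le_lt_trans _ _ (G * (2 * G)^-1)); first by rewrite ler_pM2l.
  by rewrite invfM mulrCA mulfV ?gt_eqF // mulr1 invf_lt1 // ltr1n.
have est s : 0 <= s <= tau -> (forall r, 0 <= r < s -> `|y r| < 1) -> `|y s| <= G * A.
  move=> /andP[s0 st] y1.
  pose phi r := \sum_i y r i 0 ^+ 2.
  pose y' r := f (u1 r) - f (xs (psi + r)) + b *: (u1 r - u0 r).
  have dy r : 0 < r < s -> is_derive r 1 y (y' r).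
    move=> /andP[r0 rs]; have rt : 0 < r < tau by rewrite r0 (lt_le_trans rs).
    have := is_deriveB (du1 r rt) (is_derive_shiftl (ode (psi + r))).
    by rewrite addrAC.
  have cphi r : 0 <= r <= s -> {for r, continuous phi}.
    move=> _; apply: sum_continuous => i z; apply: cvgM; exact: entry_continuous.
  have dphi r : 0 < r < s -> is_derive r 1 phi (\sum_i 2 * y r i 0 * y' r i 0).
    by move=> rs; exact: is_derive_sqnorm (dy r rs).
  have phile r : 0 < r < s ->
      \sum_i 2 * y r i 0 * y' r i 0 <= - - c * (phi r - - A ^+ 2).
    move=> /andP[r0 rs]; have yr1 := y1 r _; rewrite (ltW r0) rs in yr1.
    have {}yr1 := ltW (yr1 isT).
    have rth : 0 <= r <= th by rewrite ltW //= (le_trans (ltW rs)) // (le_trans st).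
    have uB : `|u1 r| <= B + 1.
      rewrite -[u1 r](subrK (xs (psi + r))) addrC.
      by apply: (le_trans (ler_normD _ _)); apply: lerD.
    have xB : `|xs (psi + r)| <= B + 1 by rewrite (le_trans (xsB _)) // lerDl.
    have y'le : `|y' r| <= (K + beta) * `|y r| + beta * A.
      have -> : y' r = (f (u1 r) - f (xs (psi + r))) + b *: y r - b *: (u0 r - xs (psi + r)).
        rewrite /y' /y -[RHS]addrA -scalerBr; congr (_ + _ *: _).
        by rewrite opprB addrA subrK.
      apply: (le_trans (ler_normB _ _)); apply: lerD.
        apply: (le_trans (ler_normD _ _)); rewrite mulrDl; apply: lerD.
          exact: fK.
        by rewrite normrZ ltr0_norm.
      by rewrite normrZ ltr0_norm // ler_wpM2l ?u0A // ltW.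
    have yi i : 2 * y r i 0 * y' r i 0 <= (2 * K + 3 * beta) * (`|y r| ^+ 2 + A ^+ 2).
      apply: (le_trans (ler_norm _)); rewrite !normrM ger0_norm // -mulrA.
      apply: (@le_trans _ _ (2 * (`|y r| * ((K + beta) * `|y r| + beta * A)))).
        rewrite ler_wpM2l // ler_pM // ?norm_coord // (le_trans (norm_coord _ i)) //.
      have := sqr_ge0 (`|y r| - A) => sq.
      have := mulr_ge0 (ltW beta0) sq => h1.
      have := mulr_ge0 K0 (sqr_ge0 A) => h2.
      have := mulr_ge0 (ltW beta0) (sqr_ge0 A) => h3.
      by move: h1 h2 h3; rewrite /beta; lra.
    apply: (@le_trans _ _ (\sum_(i < N) (2 * K + 3 * beta) * (`|y r| ^+ 2 + A ^+ 2))).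
      by apply: ler_sum => i _; exact: yi.
    rewrite sumr_const card_ord -[leLHS]mulr_natl mulrA opprK -/c opprK.
    rewrite ler_wpM2l // lerD2r; exact: norm_le_sqnorm.
  have := relax_le s0 cphi dphi phile; rewrite opprK opprK => H.
  rewrite -(ler_pXn2r (n := 2)) ?nnegrE ?mulr_ge0 ?(ltW G0) //.
  apply: (le_trans (norm_le_sqnorm _)).
  have phi0 : phi 0 <= N%:R * (N.+1%:R * A) ^+ 2.
    apply: (le_trans (sqnorm_le_norm _)); rewrite ler_wpM2l //.
    by rewrite ler_pXn2r ?nnegrE ?mulr_ge0.
  have es : expR (c * s) <= expR (c * th) by rewrite ler_expR ler_wpM2l // (le_trans st).
  have phs : phi s <= expR (c * th) * (N%:R * (N.+1%:R * A) ^+ 2 + A ^+ 2).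
    have p0 : 0 <= phi 0 + A ^+ 2 by rewrite addr_ge0 ?sqr_ge0 // sqnorm_ge0.
    have h1 := ler_pM (expR_ge0 (c * s)) p0 es (lerD phi0 (lexx (A ^+ 2))).
    have := sqr_ge0 A; lra.
  apply: (le_trans phs); rewrite /G; move: (expR (c * th)) e1 => E E1.
  have E0 : 0 <= E by exact: le_trans E1.
  have -> : (E * N.+2%:R ^+ 2 * A) ^+ 2 = E * (E * ((N.+2%:R ^+ 2) ^+ 2 * A ^+ 2)).
    by ring.
  rewrite ler_wpM2l //; apply: (@le_trans _ _ ((N.+2%:R ^+ 2) ^+ 2 * A ^+ 2)); last first.
    by rewrite ler_peMl // mulr_ge0 ?sqr_ge0.
  have -> : N%:R * (N.+1%:R * A) ^+ 2 + A ^+ 2 =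
    (N%:R * N.+1%:R ^+ 2 + 1) * A ^+ 2 :> R by ring.
  rewrite ler_wpM2r ?sqr_ge0 // -addn2 -[N.+1]addn1 !natrD; set x : R := N%:R.
  have x0 : 0 <= x by exact: ler0n.
  have := exprn_ge0 2 x0; have := exprn_ge0 3 x0; have := exprn_ge0 4 x0.
  by lra.
have y1 s : 0 <= s <= tau -> `|y s| < 1.
  apply: (@first_exit _ (fun s => `|y s|)) => [r _|r rt yr].
    by apply: (continuous_comp (cy r)); exact: norm_continuous.
  exact: le_lt_trans (est r rt yr) GA.
move=> s st; apply: est => // r /andP[r0 rs]; apply: y1.
by rewrite r0 (le_trans (ltW rs)) //; case/andP: st.
Qed.

Lemma cells_growth (G rho : R) : 1 <= G -> (forall (u0 u1 : R -> 'cV[R]_N) tau psi A,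
   0 <= tau <= th -> cell_ode u0 u1 tau -> 0 <= A <= rho ->
  (forall s, 0 <= s <= th -> `|u0 s - xs (psi + s)| <= A) ->
  forall s, 0 <= s <= tau -> `|u1 s - xs (psi + s)| <= G * A) ->
  forall m u psi A, (forall n, (n < m)%N -> cell_ode (u n) (u n.+1) th) ->
  0 <= A -> G ^+ m * A <= rho ->
  (forall s, 0 <= s <= th -> `|u 0%N s - xs (psi + s)| <= A) ->
  forall n s, (n <= m)%N -> 0 <= s <= th -> `|u n s - xs (psi + s)| <= G ^+ n * A.
Proof.
move=> G1 step m u psi A cu A0 Arho uA; have G0 : 0 <= G by exact: le_trans G1.
elim=> [|n IH] s nm st; first by rewrite expr0 mul1r uA.
rewrite exprS -mulrA; apply: (step (u n) (u n.+1) th) => //.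
- by rewrite lexx ltW.
- exact: cu.
- rewrite mulr_ge0 ?exprn_ge0 //= (le_trans _ Arho) // ler_wpM2r //.
  by rewrite ler_weXn2l // ltnW.
- by move=> r rt; apply: IH => //; exact: ltnW.
Qed.

Variable Y : R -> 'M[R]_N.
Hypothesis fundY : fundamental_solution f xs Y.
Let M := invmx h *m Y th.

Hypotheses (bth : - b * th < 1) (simple1 : alg_mult M 1 = 1%N)
  (stableM : forall mu, in_spectrum M mu -> mu <> 1 -> stable_multiplier (- b) th mu)
  (vel0 : f (xs 0) != 0).

Lemma velocity_fixed : M *m f (xs 0) = f (xs 0).
Proof.
rewrite /M -mulmxA -(velocity_fundamental fC2 ode xsB fundY) -hth fh mulmxA.
by rewrite mulVmx // mul1mx.
Qed.

(** The complex fixed space is the line of the velocity; both vectors being real, the real part of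
    the coefficient suffices. *)
Lemma fixed_velocity (v : 'cV[R]_N) : M *m v = v ->
  exists alpha, v = alpha *: f (xs 0).
Proof.
move=> Mv; have Mr := velocity_fixed.
have fix1 (z : 'cV[R]_N) : M *m z = z -> cmx M *m cplx z = 1 *: cplx z.
  by move=> Mz; rewrite scale1r -[in RHS]Mz cplxM.
have r0 : cplx (f (xs 0)) != 0.
  apply: contraNneq vel0 => /colP r0; apply/eqP/colP => i.
  by have := r0 i; rewrite !mxE => -[].
have [a va] := simple_eigenline simple1 (fix1 _ Mr) (fix1 _ Mv) r0.
exists (complex.Re a); apply/colP => i.
have := congr1 (fun z : 'cV[R[i]]_N => complex.Re (z i 0)) va; rewrite !mxE.
by case: (a) => x y /=; rewrite mulr0 subr0.
Qed.

(** Confining the phase [psi] to [[c1, c2]] bounds [Y] and [Y^-1] on all cells considered, so that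
    [m], [C] and [rho] do not depend on [psi]. *)
Lemma block_contraction c1 c2 : exists m C rho, [/\ (0 < m)%N, 0 <= C, 0 < rho &
  forall u psi A, (forall n, (n < m)%N -> cell_ode (u n) (u n.+1) th) ->
  c1 <= psi <= c2 -> 0 <= A <= rho ->
  (forall s, 0 <= s <= th -> `|u 0%N s - xs (psi + s)| <= A) ->
  exists2 alpha, `|alpha| <= C * A &
    forall s, 0 <= s <= th -> `|u m s - xs (psi + alpha + s)| <= A / 2].
Proof.
have B0 : 0 <= B by exact: le_trans (xsB 0).
have beta0 : 0 < - b by rewrite oppr_gt0.
have [K [K0 _ _ fK]] := C2_bounds (B + 1) fC2.
have Yu t : Y t \in unitmx by exact: (fundamental_unit fC2 xsB fundY).
have [_ dY] := fundY.
have dZ t := is_derive_invmx Yu (dY t).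
have [CY1 [CY10 HY1]] := segment_bound c1 (c2 + th) (fundamental_continuous fundY).
have cZ : continuous (fun t => invmx (Y t)).
  by move=> t; exact: is_derive_continuous (dZ t).
have [CY2 [CY20 HY2]] := segment_bound c1 (c2 + th) cZ.
have [K' [K'0 HK']] := orbit_taylor.
have [G [rho [G1 rho0 step]]] := step_growth.
have G0 : 0 <= G by exact: le_trans G1.
pose P1 := N%:R * CY1; pose P2 := N%:R * CY2.
have P10 : 0 <= P1 by rewrite mulr_ge0.
have P20 : 0 <= P2 by rewrite mulr_ge0.
have P12 : 0 < 4 * (P1 * P2 + 1) by rewrite mulr_gt0 // ltr_wpDl // mulr_ge0.
(* Passing from [y] to [w] and back costs [P1 * P2]. This precision bounds the linear part by
   [A / 4]; the other [A / 4] is kept for the quadratic terms, collected in [CQ]. *)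
have eps0 : 0 < (4 * (P1 * P2 + 1))^-1 by rewrite invr_gt0.
have [m [CL [m0 CL0 lin]]] := linear_estimate beta0 th_gt0 bth simple1 stableM eps0.
pose CE := P2 * (K * (G ^+ m) ^+ 2).
have CE0 : 0 <= CE.
  by apply: mulr_ge0 => //; apply: mulr_ge0 => //; exact: sqr_ge0.
have r0 : 0 < `|f (xs 0)| by rewrite normr_gt0.
pose Ca := CL * (P2 + CE) / `|f (xs 0)|.
have PC0 : 0 <= P2 + CE by exact: addr_ge0.
have Ca0 : 0 <= Ca by apply: divr_ge0; [exact: mulr_ge0|exact: ltW].
pose CQ := P1 * (CL * CE) + K' * Ca ^+ 2.
have CQ0 : 0 <= CQ.
  apply: addr_ge0; first by apply: mulr_ge0 => //; exact: mulr_ge0.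
  by apply: mulr_ge0 => //; exact: sqr_ge0.
have Gm0 : 0 < G ^+ m by rewrite exprn_gt0 // (lt_le_trans _ G1).
(* In turn: [step_growth] applies [m] times, deviations stay below 1 as the ball [B + 1] demands,
   [A ^+ 2 <= A], and [CQ * A <= 1 / 4]. *)
pose rho1 := Num.min (rho / G ^+ m) (Num.min (G ^+ m)^-1 (Num.min 1 (4 * (CQ + 1))^-1)).
exists m, Ca, rho1; split=> //.
  rewrite !lt_min ltr01 divr_gt0 // !invr_gt0 Gm0 mulr_gt0 //.
  by rewrite ltr_wpDl.
move=> u psi A cu /andP[psi1 psi2] /andP[A0]; rewrite !le_min => /and4P[A1 A2 A3 A4] uA.
have GA : G ^+ m * A <= rho by rewrite mulrC -ler_pdivlMr.
have GA1 : G ^+ m * A <= 1 by rewrite mulrC -ler_pdivlMr // div1r.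
have ug := cells_growth G1 step cu A0 GA uA.
pose y n s := u n s - xs (psi + s).
have y_le n s : (n <= m)%N -> 0 <= s <= th -> `|y n s| <= G ^+ m * A.
  move=> nm st; apply: (le_trans (ug n s nm st)).
  by rewrite ler_wpM2r // ler_weXn2l.
pose w n s := invmx (Y (psi + s)) *m y n s.
pose e n s := invmx (Y (psi + s)) *m
  (f (u n.+1 s) - f (xs (psi + s)) - jacobian f (xs (psi + s)) *m (u n.+1 s - xs (psi + s))).
have Zle s : 0 <= s <= th -> `|invmx (Y (psi + s))| <= CY2.
  by move=> /andP[s0 st]; apply: HY2; rewrite lerD ?andbT // -[c1]addr0 lerD.
have Yle s : 0 <= s <= th -> `|Y (psi + s)| <= CY1.
  by move=> /andP[s0 st]; apply: HY1; rewrite lerD ?andbT // -[c1]addr0 lerD.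
have th_in : 0 <= th <= th by rewrite lexx ltW.
have Yw n s : Y (psi + s) *m w n s = y n s by rewrite /w mulmxA mulmxV // mul1mx.
have dx s : is_derive s 1 (fun s => xs (psi + s)) (f (xs (psi + s))).
  exact: is_derive_shiftl (ode _).
have dZs s := is_derive_shiftl (dZ (psi + s)).
have cu' n : (n <= m)%N -> continuous (u n).
  case: n => [|n] nm; first by case: (cu 0%N m0).
  by case: (cu n nm).
(* In the derivative of [w = Y^-1 y] the derivative of [Y^-1] cancels the linear part of [f];
   besides the relaxation only the Taylor remainder [e] is left. *)
have Hw : linsys (- b) th M w e m (P2 * A) (CE * A ^+ 2).
  split.
  - by split; apply: mulr_ge0 => //; exact: sqr_ge0.
  - move=> n nm; apply: continuous_mulmx => s.
      exact: is_derive_continuous (dZs s).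
    by apply: cvgB; [exact: cu'|exact: is_derive_continuous (dx s)].
  - move=> n nm s st; have [_ _ du _] := cu n nm.
    have dy : is_derive s 1 (y n.+1)
       (f (u n.+1 s) + b *: (u n.+1 s - u n s) - f (xs (psi + s))).
      exact: is_deriveB (du s st) (dx s).
    apply: (is_derive_eq (is_derive_mulmx (dZs s) dy)).
    have -> : u n.+1 s - u n s = y n.+1 s - y n s.
      by rewrite /y opprB addrA subrK.
    rewrite /w /e; set Z := invmx _; set J := jacobian _ _.
    have ZJ : Z *m (J *m Y (psi + s)) *m Z = Z *m J.
      by rewrite -!mulmxA mulmxV // mulmx1.
    rewrite ZJ mulNmx -/(y n.+1 s).
    have -> : Z *m (f (u n.+1 s) + b *: (y n.+1 s - y n s) - f (xs (psi + s))) =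
      Z *m f (u n.+1 s) + b *: (Z *m y n.+1 s - Z *m y n s) - Z *m f (xs (psi + s)).
      by rewrite mulmxBr mulmxDr -scalemxAr mulmxBr.
    have -> : Z *m (f (u n.+1 s) - f (xs (psi + s)) - J *m y n.+1 s) =
      Z *m f (u n.+1 s) - Z *m f (xs (psi + s)) - Z *m J *m y n.+1 s.
      by rewrite mulmxBr mulmxBr mulmxA.
    move: (Z *m J *m _) (Z *m f _) (Z *m f _) (Z *m y n s) (Z *m y n.+1 s).
    by move=> p1 p2 p3 p4 p5; apply/colP => i; rewrite !mxE; ring.
  (* By [fundamental_shift], [Y(psi)^-1 h^-1 Y(psi + th) = M] whatever the phase. *)
  - move=> n nm; have [_ _ _ j1] := cu n nm.
    have -> : w n.+1 0 = invmx (Y psi) *m (invmx h *m (Y (th + psi) *m w n th)).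
      rewrite [th + psi]addrC Yw /w /y j1 !addr0 -(invmx_shift psi) -mulmxBr.
      by rewrite [th + psi]addrC.
    rewrite (fundamental_shift fC2 ode xsB fundY fh hh hth) -/M.
    rewrite -!(mulmxA h) (mulmxA (invmx h) h) mulVmx // mul1mx.
    by rewrite -mulmxA (mulmxA (invmx (Y psi))) mulVmx // mul1mx.
  - split=> [s st|n s nm /andP[s0 st]].
      by apply: mulmx_norm_le2; [exact: Zle|exact: uA].
    have st' : 0 <= s <= th by rewrite !ltW.
    have xB : `|xs (psi + s)| <= B + 1 by rewrite (le_trans (xsB _)) // lerDl.
    have yl := y_le n.+1 s nm st'.
    have uB : `|u n.+1 s| <= B + 1.
      rewrite -[u n.+1 s](subrK (xs (psi + s))) addrC.
      by apply: (le_trans (ler_normD _ _)); apply: lerD => //; exact: le_trans GA1.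
    rewrite /CE /P2 -!mulrA mulrA; apply: mulmx_norm_le2; first exact: Zle.
    apply: (le_trans (fK _ _ xB uB)); rewrite ler_wpM2l //.
    have -> : G ^+ m * (G ^+ m * A ^+ 2) = (G ^+ m * A) ^+ 2 by ring.
    by rewrite ler_pXn2r ?nnegrE // (le_trans _ yl).
have [c [Mc cle wc]] := lin _ _ _ _ Hw.
have [alpha cE] := fixed_velocity Mc.
have Asq : A ^+ 2 <= A by rewrite expr2 ler_piMl.
have ale : `|alpha| <= Ca * A.
  rewrite /Ca mulrAC ler_pdivlMr // -normrZ -cE; apply: (le_trans cle).
  have h0 : P2 * A + CE * A ^+ 2 <= (P2 + CE) * A.
    by have := ler_wpM2l CE0 Asq; lra.
  by have := ler_wpM2l CL0 h0; lra.
exists alpha => // s st.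
(* Since [Y (psi + s) *m c = alpha *: f (xs (psi + s))], removing [c] from [w m] is to first order a
   phase shift by [alpha]. *)
have -> : u m s - xs (psi + alpha + s) =
   Y (psi + s) *m (w m s - c) - (xs ((psi + s) + alpha) - xs (psi + s) - alpha *: f (xs (psi + s))).
  rewrite mulmxBr Yw cE -scalemxAr -(velocity_fundamental fC2 ode xsB fundY) /y.
  rewrite [psi + alpha + s]addrAC.
  move: (u m s) (xs _) (xs _) (alpha *: _) => p1 p2 p3 p4.
  by apply/colP => i; rewrite !mxE; ring.
apply: (le_trans (ler_normB _ _)).
have h1 : `|Y (psi + s) *m (w m s - c)| <=
    P1 * ((4 * (P1 * P2 + 1))^-1 * (P2 * A) + CL * (CE * A ^+ 2)).
  by apply: mulmx_norm_le2; [exact: Yle|exact: wc].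
have [_ h2] := HK' (psi + s) alpha.
have h3 : K' * alpha ^+ 2 <= K' * Ca ^+ 2 * A ^+ 2.
  rewrite -mulrA ler_wpM2l // -exprMn -real_normK ?num_real //.
  by rewrite ler_pXn2r ?nnegrE // mulr_ge0.
have h4 : P1 * ((4 * (P1 * P2 + 1))^-1 * (P2 * A)) <= A / 4.
  have -> : P1 * ((4 * (P1 * P2 + 1))^-1 * (P2 * A)) =
    (P1 * P2 * A) / (4 * (P1 * P2 + 1)) by ring.
  rewrite ler_pdivrMr //; have := mulr_ge0 P10 P20; nra.
have h5 : CQ * A ^+ 2 <= A / 4.
  have q0 : 0 < 4 * (CQ + 1) by rewrite mulr_gt0 // ltr_wpDl.
  have : A * (4 * (CQ + 1)) <= 1 by rewrite -ler_pdivlMr // div1r.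
  move=> q1; have := ler_wpM2l A0 q1; have := sqr_ge0 A; lra.
rewrite /CQ in h5; move: h1 h2 h3 h4 h5; lra.
Qed.

Definition hinv n : 'M[R]_N := iter n (mulmx (invmx h)) 1%:M.

Lemma hinvSr n : hinv n.+1 *m h = hinv n.
Proof.
elim: n => [|n IH]; first by rewrite /hinv /= mulmx1 mulVmx.
by rewrite [hinv n.+2]/(invmx h *m hinv n.+1) -mulmxA IH.
Qed.

Lemma hinv_orthogonal n : (hinv n)^T *m hinv n = 1%:M.
Proof.
elim: n => [|n IH]; first by rewrite /hinv /= trmx1 mulmx1.
rewrite [hinv n.+1]/(invmx h *m hinv n) trmx_mul -mulmxA (mulmxA (invmx h)^T).
have -> : (invmx h)^T *m invmx h = 1%:M.
  by rewrite invmx_orthogonal trmxK; exact: mulmx1C.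
by rewrite mul1mx.
Qed.

Lemma hinv_equivariant n x : f (hinv n *m x) = hinv n *m f x.
Proof.
have fV z : f (invmx h *m z) = invmx h *m f z.
  by rewrite -[in RHS](mul1mx z) -(mulmxV hu) -mulmxA fh mulmxA mulVmx // mul1mx.
elim: n => [|n IH]; first by rewrite /hinv /= !mul1mx.
by rewrite [hinv n.+1]/(invmx h *m hinv n) -!mulmxA fV IH.
Qed.

Lemma hinv_orbit n t : hinv n *m xs (n%:R * th + t) = xs t.
Proof.
elim: n t => [|n IH] t; first by rewrite /hinv /= mul1mx mul0r add0r.
rewrite [hinv n.+1]/(invmx h *m hinv n) -mulmxA.
have -> : n.+1%:R * th + t = n%:R * th + (th + t) by rewrite -natr1; ring.
by rewrite IH invmx_shift.
Qed.

Lemma norm_le_hinv n (v : 'cV[R]_N) : `|v| <= N.+1%:R * `|hinv n *m v|.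
Proof.
rewrite -{1}[v]mul1mx -(hinv_orthogonal n) -mulmxA; apply: orthogonal_norm.
by rewrite trmxK; apply: mulmx1C; exact: hinv_orthogonal.
Qed.

(** Cell 0 is the initial history on [[sigma - th, sigma]]. *)
Definition cell_start (sigma : R) (n : nat) : R := sigma - th + n%:R * th.

Lemma cell_startS sigma n : cell_start sigma n.+1 = cell_start sigma n + th.
Proof. by rewrite /cell_start -natr1; ring. Qed.

(* Clamping makes a cell continuous on the whole line. *)
Definition cell (x : R -> 'cV[R]_N) sigma n tau s : 'cV[R]_N :=
  let c := cell_start sigma n in hinv n *m x (clamp c (c + tau) (c + s)).

Lemma cellE x sigma n tau s : 0 <= s <= tau ->
  cell x sigma n tau s = hinv n *m x (cell_start sigma n + s).
Proof.
by move=> /andP[s0 st]; rewrite /cell clamp_id // lerDl s0 lerD2l.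
Qed.

Lemma cell_continuous x sigma T n tau : dde_solution f b h th sigma T x ->
  0 <= tau -> cell_start sigma n + tau < T -> continuous (cell x sigma n tau).
Proof.
move=> [cx _] tau0 tauT; rewrite /cell; set c := cell_start sigma n in tauT *.
have c0 : sigma - th <= c by rewrite lerDl mulr_ge0 // ltW.
have ccl : continuous (fun s : R => x (clamp c (c + tau) s)).
  apply: (clamp_continuous (A := [set t | sigma - th <= t < T]%classic)) => //.
    by rewrite lerDl.
  move=> s /andP[s1 s2] /=; apply/andP; split; first exact: le_trans s1.
  exact: le_lt_trans tauT.
apply: continuous_mulmx; first by move=> s; exact: cvg_cst.
move=> s; apply: (@continuous_comp _ _ _ (fun s : R => c + s)
  (fun s => x (clamp c (c + tau) s))); last exact: ccl.
by apply: cvgD; [exact: cvg_cst|exact: cvg_id].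
Qed.

(** By [hinvSr], [hinv n.+1] applied to [h *m x (t - th)] is the previous cell at the same local
    time. *)
Lemma dde_cell_ode x sigma T n tau : dde_solution f b h th sigma T x ->
  0 <= tau <= th -> cell_start sigma n.+1 + tau < T ->
  cell_ode (cell x sigma n th) (cell x sigma n.+1 tau) tau.
Proof.
move=> sol /andP[tau0 tauth] tauT; have [_ dx] := sol.
have th0 := ltW th_gt0.
split.
- apply: cell_continuous sol th0 _; rewrite -cell_startS.
  by rewrite (le_lt_trans _ tauT) // lerDl.
- exact: cell_continuous sol tau0 tauT.
- move=> s /andP[s0 st]; have s_in : 0 <= s <= tau by rewrite !ltW.
  have sth : 0 <= s <= th by rewrite ltW //= (le_trans (ltW st)).
  rewrite !cellE //.
  apply: (@is_derive_itv _ _ (fun r => hinv n.+1 *m x (cell_start sigma n.+1 + r)) _ 0 tau).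
  + by move=> r /andP[r0 rt]; rewrite cellE // !ltW.
  + by rewrite s0.
  have cs : sigma < cell_start sigma n.+1 + s < T.
    rewrite (lt_trans _ tauT) ?ltrD2l // andbT /cell_start -natr1.
    have := mulr_ge0 (ler0n R n) th0; lra.
  have := is_derive_cst_mulmx (hinv n.+1) (is_derive_shiftl (dx _ cs)).
  move=> d; apply: (is_derive_eq d); rewrite /dde_rhs mulmxDr -hinv_equivariant.
  rewrite -scalemxAr mulmxBr mulmxA hinvSr; congr (_ + _ *: (_ - _ *m x _)).
  by rewrite cell_startS; ring.
- rewrite !cellE ?lexx ?tau0 ?th0 // addr0 cell_startS.
  by rewrite [hinv n.+1]/(invmx h *m hinv n) -mulmxA.
Qed.

Lemma core_stable : dde_stable f b h th xs.
Proof.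
move=> sigma eps eps0.
have [m [C [rho [m0 C0 rho0 block]]]] :=
  block_contraction (sigma - th - 1) (sigma - th + 1).
have [G [rho' [G1 rho'0 step]]] := step_growth.
have [K [K0 HK]] := orbit_taylor.
have G0 : 0 <= G by exact: le_trans G1.
have Gm0 : 0 < G ^+ m by rewrite exprn_gt0 // (lt_le_trans _ G1).
(* [N.+1] undoes the frame [hinv n.+1], [G ^+ m.+1] covers the cells after the last full block, and
   [K * (2 * C)] the drift of the phase. *)
pose E := N.+1%:R * (G ^+ m.+1 + K * (2 * C)) + 1.
have E0 : 0 < E.
  by rewrite ltr_wpDl // mulr_ge0 // addr_ge0 ?exprn_ge0 // mulr_ge0 // mulr_ge0.
(* In turn: a block contracts, growth over an unfinished block stays within [rho'], the phase drifts
   by at most 1 and so keeps to the window given to [block_contraction], and the final bound is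
   below [eps]. *)
pose del := Num.min rho (Num.min (rho' / G ^+ m) (Num.min (2 * C + 1)^-1 (eps / (2 * E)))).
have C1 : 0 < 2 * C + 1 by rewrite ltr_wpDl // mulr_ge0.
have del0 : 0 < del.
  by rewrite !lt_min rho0 divr_gt0 // invr_gt0 C1 divr_gt0 // mulr_gt0.
exists del => // T x sol init t /andP[st tT].
have /and4P[d1 d2 d3 d4] : [&& del <= rho, del <= rho' / G ^+ m,
    del <= (2 * C + 1)^-1 & del <= eps / (2 * E)].
  by rewrite -!le_min.
have Gdel : G ^+ m * del <= rho' by rewrite mulrC -ler_pdivlMr.
have Cdel : 2 * C * del <= 1.
  have : del * (2 * C + 1) <= 1 by rewrite -ler_pdivlMr // div1r.
  by have := ltW del0; lra.
have th0 := ltW th_gt0.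
have tq0 : 0 <= (t - sigma) / th by rewrite divr_ge0 // subr_ge0.
(* [n] full cells fit between [sigma] and [t]; cell 0 being the history, [t] lies in the cell [n.+1]
   at distance [tau] from its start. *)
have := Num.Theory.truncn_itv tq0; set n := Num.truncn _.
rewrite ler_pdivlMr // ltr_pdivrMr // => /andP[n1 n2].
pose tau := t - sigma - n%:R * th.
have tau_in : 0 <= tau <= th.
  rewrite subr_ge0 n1 /tau lerBlDr; move: n2; rewrite -natr1; lra.
have ct : cell_start sigma n.+1 + tau = t by rewrite /cell_start /tau -natr1; ring.
pose u k := cell x sigma k th.
have cu k : (k < n)%N -> cell_ode (u k) (u k.+1) th.
  move=> kn; apply: (dde_cell_ode sol); first by rewrite lexx th0.
  rewrite -cell_startS (le_lt_trans _ tT) // -ct; case/andP: tau_in => tau0 _.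
  apply: (@le_trans _ _ (cell_start sigma n.+1)); last by rewrite lerDl.
  by rewrite /cell_start lerD2l ler_wpM2r // ler_nat.
have clast : cell_ode (u n) (cell x sigma n.+1 tau) tau.
  by apply: (dde_cell_ode sol) => //; rewrite ct.
have u0 s : 0 <= s <= th -> `|u 0%N s - xs (sigma - th + s)| <= del.
  move=> /[dup] sth /andP[s0 s1]; rewrite /u cellE // /hinv /= mul1mx.
  rewrite /cell_start mul0r addr0; apply: ltW; apply: init.
  by rewrite lerDl s0 /= -lerBrDl; lra.
(* [2 * C * (del / 2 ^+ j)] bounds the sum of all phase shifts still to come; added to [|phi|] it
   stays below its initial value. *)
have blocks j : (j * m <= n)%N -> exists2 phi,
    `|phi| + 2 * C * (del / 2 ^+ j) <= 2 * C * del &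
    forall s, 0 <= s <= th -> `|u (j * m)%N s - xs (sigma - th + phi + s)| <= del / 2 ^+ j.
  elim: j => [|j IH] jm.
    by exists 0; rewrite ?normr0 expr0 divr1 ?add0r // => s sth; rewrite addr0 mul0n u0.
  have jm' : (j * m <= n)%N by rewrite (leq_trans _ jm) // leq_mul2r leqnSn orbT.
  have [phi phile uphi] := IH jm'.
  have A0 : 0 <= del / 2 ^+ j by rewrite divr_ge0 ?exprn_ge0 // ltW.
  have Ale : del / 2 ^+ j <= del.
    by rewrite ler_pdivrMr ?exprn_gt0 // ler_peMr ?exprn_ege1 ?ler1n // ltW.
  have CA : 0 <= 2 * C * (del / 2 ^+ j) by rewrite mulr_ge0 // mulr_ge0.
  have phi1 : `|phi| <= 1 by apply: le_trans Cdel; apply: le_trans phile; rewrite lerDl.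
  have [||||alpha ale ualpha] := block (fun k => u (j * m + k)%N) (sigma - th + phi) (del / 2 ^+ j).
  - move=> k km; rewrite addnS; apply: cu; apply: leq_trans jm.
    by rewrite mulSn addnC ltn_add2r.
  - by move: phi1; rewrite ler_norml => /andP[? ?]; apply/andP; split; lra.
  - by rewrite A0 (le_trans Ale).
  - by rewrite addn0.
  exists (phi + alpha).
    apply: le_trans phile; rewrite exprS invfM.
    have := ler_normD phi alpha; move: ale; lra.
  by move=> s sth; rewrite mulSn addnC addrA exprSr invfM mulrA; exact: ualpha.
have [phi phile uphi] := blocks (n %/ m)%N (leq_trunc_div n m).
set A := del / _ in phile uphi.
have A0 : 0 <= A by rewrite divr_ge0 ?exprn_ge0 // ltW.
have Ale : A <= del.
  by rewrite ler_pdivrMr ?exprn_gt0 // ler_peMr ?exprn_ege1 ?ler1n // ltW.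
have CA : 0 <= 2 * C * A by rewrite mulr_ge0 // mulr_ge0.
have phiC : `|phi| <= 2 * C * del by apply: le_trans phile; rewrite lerDl.
have rm : (n %% m < m)%N by rewrite ltn_mod.
have GA : G ^+ (n %% m) * A <= G ^+ m * del.
  by rewrite ler_pM ?exprn_ge0 // ler_weXn2l // ltnW.
(* Fewer than [m] complete cells remain, so mere growth is affordable. *)
have un s : 0 <= s <= th -> `|u n s - xs (sigma - th + phi + s)| <= G ^+ m * del.
  move=> sth; apply: le_trans GA; rewrite {1}(divn_eq n m).
  apply: (cells_growth G1 step (m := (n %% m)%N) (u := fun k => u (n %/ m * m + k)%N)) => //.
  - by move=> k km; rewrite addnS; apply: cu; rewrite {2}(divn_eq n m) ltn_add2l.
  - by apply: le_trans Gdel; rewrite ler_pM ?exprn_ge0 // ler_weXn2l // ltnW.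
  - by rewrite addn0.
have Gd0 : 0 <= G ^+ m * del <= rho' by rewrite Gdel mulr_ge0 // ltW.
have tt : 0 <= tau <= tau by rewrite lexx andbT; case/andP: tau_in.
have := step (u n) (cell x sigma n.+1 tau) tau _ _ tau_in clast Gd0 un tau tt.
rewrite cellE // ct mulrA -exprS => last_le.
have xst : hinv n.+1 *m xs t = xs (sigma - th + tau).
  by rewrite -(hinv_orbit n.+1 (sigma - th + tau)) -ct /cell_start; congr (_ *m xs _); ring.
apply: (le_lt_trans (norm_le_hinv n.+1 _)); rewrite mulmxBr xst.
have [drift _] := HK (sigma - th + tau) phi.
have bound : `|hinv n.+1 *m x t - xs (sigma - th + tau)| <= G ^+ m.+1 * del + K * (2 * C * del).
  have -> : hinv n.+1 *m x t - xs (sigma - th + tau) =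
    (hinv n.+1 *m x t - xs (sigma - th + phi + tau)) +
    (xs (sigma - th + tau + phi) - xs (sigma - th + tau)).
    rewrite [sigma - th + phi + tau]addrAC.
    move: (hinv _ *m _) (xs (_ + phi)) (xs _) => p1 p2 p3.
    by apply/colP => i; rewrite !mxE; ring.
  apply: (le_trans (ler_normD _ _)); apply: lerD => //.
  by apply: (le_trans drift); rewrite ler_wpM2l.
apply: (@le_lt_trans _ _ ((E - 1) * del)).
  apply: (le_trans (ler_wpM2l _ bound)); first exact: ler0n.
  by rewrite /E; lra.
move: d4; rewrite ler_pdivlMr ?mulr_gt0 // => d4.
by lra.
Qed.

End NonlinearCells.

(** * The theorem *)

Section Threshold.
Context {R : realType}.

(** The eigenvalues are finitely many, so the strict bound [e^2] leaves room for one [b0 < 1] common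
    to all. *)
Lemma exp_threshold (r : seq R[i]) : (forall mu, mu \in r -> - expR 2 < complex.Re mu) ->
  exists2 b0 : R, 0 < b0 < 1 & forall mu, mu \in r -> - expR (2 * b0) < complex.Re mu.
Proof.
elim: r => [|mu r IH] H; first by exists 2^-1; rewrite // invr_gt0 ltr0n /= invf_lt1 // ltr1n.
have [|b1 /andP[b10 b11] Hb1] := IH.
  by move=> nu nur; apply: H; rewrite inE nur orbT.
pose y := Num.max 1 (- complex.Re mu).
have y1 : 1 <= y by rewrite le_max lexx.
have y0 : 0 < y by exact: lt_le_trans y1.
have ly0 : 0 <= ln y by rewrite ln_ge0.
have ly2 : ln y < 2.
  rewrite -ltr_expR lnK ?posrE // gt_max ltrNl H ?mem_head // andbT.
  by rewrite -[1]expR0 ltr_expR.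
(* The midpoint between the least admissible value [ln y / 2] and 1. *)
pose b2 := (ln y / 2 + 1) / 2.
have mono (b c : R) : b <= c -> - expR (2 * c) <= - expR (2 * b).
  by move=> bc; rewrite lerN2 ler_expR ler_wpM2l.
exists (Num.max b1 b2); first by rewrite lt_max b10 gt_max b11 /b2 /=; lra.
move=> nu; rewrite inE => /orP[/eqP ->|nur].
  have le2 : b2 <= Num.max b1 b2 by rewrite le_max lexx orbT.
  apply: (le_lt_trans (mono _ _ le2)); rewrite ltrNl.
  apply: (@le_lt_trans _ _ y); first by rewrite le_max lexx orbT.
  by rewrite -{1}[y]lnK ?posrE // ltr_expR /b2; lra.
by apply: le_lt_trans (Hb1 _ nur); apply: mono; rewrite le_max lexx.
Qed.

(** Links the modulus in the spectral hypotheses with the real and imaginary parts in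
    [stable_multiplier]. *)
Lemma norm_complex_ltgt (mu : R[i]) :
  [\/ complex.Re mu ^+ 2 + complex.Im mu ^+ 2 < 1, `|mu| = 1 | 1 < `|mu|].
Proof.
rewrite normc_def; set x := _ + _.
have [x1|x1|x1] := ltgtP x 1; first by constructor 1.
- constructor 3; rewrite -[1]/(real_complex R 1) ltcR -sqrtr1 ltr_sqrt //.
  exact: lt_trans x1.
- by constructor 2; rewrite x1 sqrtr1.
Qed.

(* For th = 0 the twisted monodromy matrix is orthogonal, so N = 1, and a
   scalar autonomous equation has no nonconstant periodic solution. *)
Lemma shift_neq0 N (f : 'cV[R]_N -> 'cV[R]_N) (xs : R -> 'cV[R]_N) (p : R)
    (Y : R -> 'M[R]_N) (h : 'M[R]_N) :
  C2 f -> ode_solution f xs -> minimal_period xs p -> fundamental_solution f xs Y ->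
  h^T *m h = 1%:M -> alg_mult (invmx h) 1 = 1%N ->
  (forall mu : R[i], in_spectrum (invmx h) mu -> `|mu| = 1 -> mu = 1) -> False.
Proof.
move=> fC2 ode minp fundY hh alg1 spec1.
have [p0 per _] := minp; have [B xsB] := periodic_bounded ode p0 per.
have hhT : invmx h *m (invmx h)^T = 1%:M.
  by rewrite (invmx_orthogonal hh) trmxK.
have [r rE] := char_poly_split (cmx (invmx h)).
have r1 mu : mu \in r -> mu = 1.
  rewrite -(eigenvalue_root_prod _ rE) => emu; apply: spec1 => //.
  exact: eigenvalue_orthogonal hhT emu.
(* All roots of the characteristic polynomial equal 1, and 1 is simple, so its degree [N] is 1. *)
have N1 : N = 1%N.
  have := size_char_poly (cmx (invmx h)); rewrite rE size_prod_XsubC => -[<-].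
  move: alg1; rewrite /alg_mult rE mu_prod_XsubC => <-; apply/esym/eqP.
  by rewrite -all_count; apply/allP => mu /r1 ->; rewrite /= eqxx.
have vel0 := velocity_neq0 fC2 ode xsB minp.
subst N.
have d (t : R) : is_derive t 1 (fun s => xs s 0 0) (f (xs t) 0 0).
  by have /is_derive_coord := ode t; exact.
have [c _ [_ dc]] : exists2 c, c \in `]0, p[ & is_derive c 1 (fun s : R => xs s 0 0) 0.
  apply: Rolle => //.
  - by apply: continuous_subspaceT => t; exact: is_derive_continuous (d t).
  - by rewrite -(per 0) add0r.
have fc : f (xs c) = 0.
  apply/colP => i; rewrite ord1 [RHS]mxE.
  by case: (d c) => _ <-.
move: vel0; have := velocity_fundamental fC2 ode xsB fundY c; rewrite fc => Yc.
rewrite -[f (xs 0)]mul1mx -(mulVmx (fundamental_unit fC2 xsB fundY c)) -mulmxA -Yc.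
by rewrite mulmx0 eqxx.
Qed.

End Threshold.

Theorem theorem2p2 (R : realType) (N : nat) (f : 'cV[R]_N -> 'cV[R]_N)
    (G : set 'M[R]_N) (xs : R -> 'cV[R]_N) (p : R) (Y : R -> 'M[R]_N)
    (h : 'M[R]_N) (th : R) :
  C2 f -> compact_subgroup_ON G -> equivariant G f ->
  ode_solution f xs -> minimal_period xs p ->
  discrete_wave G xs ->
  fundamental_solution f xs Y ->
  spatiotemporal_sym G xs h ->
  0 <= th < p -> h *m xs 0 = xs th ->
  (* (1) *)
  alg_mult (invmx h *m Y th) 1 = 1%N ->
  (forall mu : R[i], in_spectrum (invmx h *m Y th) mu -> `|mu| = 1 -> mu = 1) ->
  (* (2) *)
  (forall mu : R[i], in_spectrum (invmx h *m Y th) mu -> 1 < `|mu| ->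
     complex.Im mu = 0 /\ - expR 2 < complex.Re mu < -1) ->
  exists a c : R, [/\ a < c, c <= 0 &
    forall b : R, a < b < c -> dde_stable f b h th xs].
Proof.
move=> fC2 [_ _ _ Gorth _] equi ode minp _ fundY [Gh _] /andP[th0 _] hth alg1 spec1 spec2.
have hh := Gorth _ Gh; have fh x : f (h *m x) = h *m f x by exact: equi.
have [p0 per _] := minp; have [B xsB] := periodic_bounded ode p0 per.
have th_gt0 : 0 < th.
  rewrite lt_def th0 andbT; apply/negP => /eqP thE.
  have [Y0 _] := fundY; move: alg1 spec1; rewrite thE Y0 mulmx1 => alg1 spec1.
  exact: (shift_neq0 fC2 ode minp fundY hh alg1 spec1).
have [r rE] := char_poly_split (cmx (invmx h *m Y th)).
have mem_r mu : eigenvalue (cmx (invmx h *m Y th)) mu = (mu \in r).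
  exact: eigenvalue_root_prod.
have re_r mu : mu \in r -> - expR 2 < complex.Re mu.
  rewrite -mem_r => smu; have e2 : 1 < expR 2 :> R by rewrite -[1]expR0 ltr_expR.
  case: (norm_complex_ltgt mu) => [mu1|mu1|mu1].
  - have := sqr_ge0 (complex.Im mu); have := sqr_ge0 (complex.Re mu - 1); nra.
  - by rewrite (spec1 _ smu mu1) /=; lra.
  - by have [_ /andP[]] := spec2 _ smu mu1.
have [b0 /andP[b00 b01] Hb0] := exp_threshold re_r.
(* This interval says [b0 < - b * th < 1]: the lower bound covers the unstable eigenvalues, and the
   upper one is what the Lyapunov functional demands. *)
exists (- th^-1), (- (b0 / th)); split.
- by rewrite ltrN2 ltr_pdivrMr // mulVf // gt_eqF.
- by rewrite oppr_le0 divr_ge0 // ltW.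
move=> b /andP[b1 b2].
have bth1 : - b * th < 1 by move: b1; rewrite ltrNl -ltr_pdivlMr // div1r.
have bth0 : b0 < - b * th by move: b2; rewrite ltrNr ltr_pdivrMr.
have b_lt0 : b < 0 by nra.
have stableM mu : in_spectrum (invmx h *m Y th) mu -> mu <> 1 ->
    stable_multiplier (- b) th mu.
  move=> smu mu1; case: (norm_complex_ltgt mu) => [?|mu2|mu2]; first by left.
    by case: mu1; exact: spec1.
  have [im0 /andP[_ re1]] := spec2 _ smu mu2; right; split=> //.
  rewrite re1 andbT; apply: le_lt_trans (Hb0 mu _); last by rewrite -mem_r.
  by rewrite lerN2 ler_expR ler_wpM2l // ltW.
exact: (core_stable fC2 ode xsB fh hh hth th_gt0 b_lt0 fundY bth1 alg1 stableM
  (velocity_neq0 fC2 ode xsB minp)).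
Qed.
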